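(* For every real $s$ with $-1\le s<-3/4$, the real Korteweg-de Vries equation $$u_t+u_{xxx}=6uu_x,\qquad u(0,x)=u_0(x),\qquad x\in\mathbb R,$$ with $u$ real-valued, is not locally well-posed in $H^s(\mathbb R)$; more precisely, the solution operator fails to be uniformly continuous with respect to the $H^s$ norm.
   Context: For every real-valued initial datum $u_0$ in the Schwartz class $\mathcal S(\mathbb R)$ there is a unique global smooth solution $u\in C^\infty_t(\mathbb R;\mathcal S(\mathbb R))$; this defines the solution map (solution operator) $S$, $Su_0:=u$, on real-valued Schwartz functions. Definition (local well-posedness). The equation is locally well-posed in $H^s(\mathbb R)$ if for every radius $R>0$ there exists a time $T=T(R)>0$ such that the solution map $S$ (restricted to Schwartz data) can be uniformly continuously and uniquely extended to a map from the ball $\{u_0\in H^s(\mathbb R):\|u_0\|_{H^s}<R\}$ (with the $H^s$ norm, real-valued functions) to the space $C^0_t((-T,T);H^s(\mathbb R))$, the latter endowed with the topology induced by the norm $\sup_{t\in(-T,T)}\|u(t)\|_{H^s}$. Failure of uniform continuity of the solution operator refers to the restriction of $S$ to Schwartz data, in these norms. *)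

(* Defs.v *)
From HB Require Import structures.
From mathcomp Require Import all_boot all_order all_algebra.
From mathcomp Require Import all_classical all_reals all_analysis.

Set Implicit Arguments.
Unset Strict Implicit.
Unset Printing Implicit Defensive.

Import Order.TTheory GRing.Theory Num.Theory.
Import numFieldNormedType.Exports.

Local Open Scope classical_set_scope.
Local Open Scope ring_scope.

Section SchwartzSpace.
Context {R : realType}.
Implicit Types f g : R -> R.

Definition smooth f : Prop := forall n x, derivable (derive1n n f) x 1.

Definition rapidly_decreasing f : Prop :=
  forall k n, exists C : R, forall x, `|x ^+ k * derive1n n f x| <= C.

Definition schwartz_pred : {pred R -> R} :=
  [pred f | `[< smooth f /\ rapidly_decreasing f >]].

Lemma smooth_derive1nD (a : R) f g n : smooth f -> smooth g ->
  derive1n n (a *: f + g) = a *: derive1n n f + derive1n n g.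
Proof.
move=> sf sg; elim: n => [//|n IH]; rewrite !derive1nS IH.
apply/funext => x; rewrite derive1E deriveD//; last exact: derivableZ.
by rewrite deriveZ// -!derive1E.
Qed.

Lemma smooth0 n : derive1n n (0 : R -> R) = 0.
Proof.
elim: n => [//|n IH]; rewrite derive1nS IH; apply/funext => x.
by rewrite derive1_cst.
Qed.

Lemma schwartz_submod : submod_closed schwartz_pred.
Proof.
split.
  apply/asboolP; split=> [n x|k n].
    by rewrite smooth0; exact: derivable_cst.
  by exists 0 => x; rewrite smooth0 [X in _ * X](_ : _ = 0)// mulr0 normr0.
move=> a f g /asboolP[sf df] /asboolP[sg dg]; apply/asboolP; split=> [n x|k n].
  by rewrite smooth_derive1nD//; apply: derivableD => //; exact: derivableZ.
have [C fC] := df k n; have [D gD] := dg k n.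
exists (`|a| * C + D) => x; rewrite smooth_derive1nD//.
rewrite [X in _ * X](_ : _ = a * derive1n n f x + derive1n n g x)// mulrDr.
apply: (le_trans (ler_normD _ _)); apply: lerD => //.
by rewrite mulrCA normrM ler_wpM2l.
Qed.

HB.instance Definition _ :=
  GRing.isSubmodClosed.Build R (R -> R) schwartz_pred schwartz_submod.

End SchwartzSpace.

Record schwartz (R : realType) := Schwartz {
  schwartz_fun :> R -> R ;
  _ : schwartz_fun \in schwartz_pred }.

HB.instance Definition _ (R : realType) := [isSub for @schwartz_fun R].
HB.instance Definition _ (R : realType) := [Choice of schwartz R by <:].
HB.instance Definition _ (R : realType) :=
  [SubChoice_isSubLmodule of schwartz R by <:].

Section KdV.
Context {R : realType}.
Local Notation mu := (@lebesgue_measure R).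

Definition schwartz_seminorm (k n : nat) (f : schwartz R) : R :=
  sup (range (fun x : R => `|x ^+ k * derive1n n f x|)).

(** [v] is the derivative at [t] of the curve [u], for the Frechet topology
    that the seminorms above induce on the Schwartz space. *)
Definition is_schwartz_derivative (u : R -> schwartz R) (t : R)
    (v : schwartz R) : Prop :=
  forall k n,
    schwartz_seminorm k n (h^-1 *: (u (t + h) - u t) - v) @[h --> 0^'] --> 0.

Definition smooth_curve (u : R -> schwartz R) : Prop :=
  exists2 d : nat -> R -> schwartz R, d 0%N = u &
    forall m t, is_schwartz_derivative (d m) t (d m.+1 t).

Definition kdv_solution (u0 : schwartz R) (u : R -> schwartz R) : Prop :=
  [/\ smooth_curve u, u 0 = u0 &
    forall t x : R,
      derive1 (fun t' => u t' x) t + derive1n 3 (u t) x =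
      6 * u t x * derive1 (u t) x].

(** [S] maps each datum to its unique global smooth solution. *)
Definition solution_map (S : schwartz R -> R -> schwartz R) : Prop :=
  forall u0 u, kdv_solution u0 u <-> u = S u0.

(** Functionals on real-valued test functions; the tempered ones are exactly
    the real-valued tempered distributions. *)
Definition functional := schwartz R -> R.

HB.instance Definition _ := GRing.Zmodule.on functional.

Definition tempered (F : functional) : Prop :=
  scalar F /\
  exists N : nat, exists C : R, forall f,
    `|F f| <= C * \sum_(k < N) \sum_(n < N) schwartz_seminorm k n f.

Definition distr (f : schwartz R) : functional :=
  fun g => \int[mu]_x (f x * g x).

(** The Fourier transform of a real function [f], with kernel
    [exp (- i x xi)], is [fourier_cos f - i fourier_sin f]. *)
Definition fourier_cos (f : R -> R) (xi : R) : R :=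
  \int[mu]_x (f x * cos (x * xi)).

Definition fourier_sin (f : R -> R) (xi : R) : R :=
  \int[mu]_x (f x * sin (x * xi)).

(** The Fourier transform of [F] is the function [a + i b]: testing
    [<F^, f> = <F, f^>] on a real [f], whose cosine and sine transforms [c] and
    [d] are again Schwartz functions, and separating real and imaginary parts.
    This determines [a] and [b] almost everywhere. *)
Definition fourier_function (F : functional) (a b : R -> R) : Prop :=
  [/\ measurable_fun setT a, measurable_fun setT b &
    forall f : schwartz R,
      [/\ mu.-integrable setT (fun xi => (a xi * f xi)%:E),
          mu.-integrable setT (fun xi => (b xi * f xi)%:E),
          forall c : schwartz R, (c : R -> R) = fourier_cos f ->
            F c = \int[mu]_xi (a xi * f xi) &
          forall d : schwartz R, (d : R -> R) = fourier_sin f ->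
            - F d = \int[mu]_xi (b xi * f xi)]].

(** The infimum is over representatives that agree almost everywhere, hence over
    at most one value; it is [+oo] if the Fourier transform of [F] is not a
    function. *)
Definition Hs_norm (s : R) (F : functional) : \bar R :=
  ereal_inf [set y | exists a b : R -> R, fourier_function F a b /\
    y = ((\int[mu]_xi
      ((1 + xi ^+ 2) `^ s * (a xi ^+ 2 + b xi ^+ 2))%:E) `^ 2^-1)%E].

Definition Hs (s : R) : set functional :=
  [set F | tempered F /\ (Hs_norm s F < +oo)%E].

Definition Hs_ball (s M : R) : set functional :=
  [set F | Hs s F /\ (Hs_norm s F < M%:E)%E].

Definition C0Hs (s T : R) : set (R -> functional) :=
  [set v | forall t, t \in `]- T, T[ ->
    Hs s (v t) /\ Hs_norm s (v t' - v t) @[t' --> t] --> 0%E].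

Definition C0Hs_norm (s T : R) (v : R -> functional) : \bar R :=
  ereal_sup [set Hs_norm s (v t) | t in [set` `]- T, T[]].

(** Uniform continuity on [D] of [G], valued in [C0Hs s T], the points of [D]
    being compared in [H^s] through [e]. *)
Definition Hs_unif_continuous (s T : R) (I : Type) (D : set I)
    (e : I -> functional) (G : I -> R -> functional) : Prop :=
  forall eps : R, 0 < eps -> exists2 delta : R, 0 < delta &
    forall i j, D i -> D j -> (Hs_norm s (e i - e j)%R < delta%:E)%E ->
      (C0Hs_norm s T (fun t => G i t - G j t)%R < eps%:E)%E.

Definition solution_map_unif_continuous (S : schwartz R -> R -> schwartz R)
    (s M T : R) : Prop :=
  Hs_unif_continuous s T [set u0 | Hs_ball s M (distr u0)] distr
    (fun u0 t => distr (S u0 t)).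

Definition unif_continuous_extension (S : schwartz R -> R -> schwartz R)
    (s M T : R) (Phi : functional -> R -> functional) : Prop :=
  [/\ forall F, Hs_ball s M F -> C0Hs s T (Phi F),
      Hs_unif_continuous s T (Hs_ball s M) id Phi &
      forall u0, Hs_ball s M (distr u0) -> forall t, t \in `]- T, T[ ->
        Phi (distr u0) t = distr (S u0 t)].

Definition locally_well_posed (S : schwartz R -> R -> schwartz R) (s : R) :
    Prop :=
  forall M : R, 0 < M -> exists2 T : R, 0 < T &
    exists2 Phi, unif_continuous_extension S s M T Phi &
      forall Psi, unif_continuous_extension S s M T Psi ->
        forall F, Hs_ball s M F -> forall t, t \in `]- T, T[ ->
          Psi F t = Phi F t.

End KdV.

(* Main.v *)
(** Miura's map sends a solution [w] of the defocusing mKdV equation to the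
    solutions [w ^ 2 +- w'] of KdV.  For the slowly modulated wave
    [w = rho phi (x / L) cos (N x)] the cubic term of mKdV turns the phase at the
    rate [beta phi ^ 2], where [beta] is proportional to the square of the
    amplitude.  With [L = N ^ (- 2 s - 1) / beta] the KdV data [w ^ 2 + w'] stay
    bounded in [H ^ s]; two data with [beta2 - beta1 = 1 / t] differ by
    [O(1 / (t beta1))] at time [0], but at time [t] their phases differ by
    [phi ^ 2] and their distance is bounded below.  The condition [s < - 3 / 4] makes
    [N / L ^ 2] small, and [s >= -1] makes [L / N ^ 2] small; these are the sizes of
    the errors of the modulation ansatz.

    No well-posedness theory of mKdV enters: [w] is recovered from the two KdV
    solutions with data [w ^ 2 +- w'], their half difference being [w'].  The
    distance to the ansatz is controlled by an [L ^ 2] energy estimate, in which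
    the sup norm is bounded through [w'' + kap ^ 2 w], a quantity controlled by
    the conservation laws.  All this is done in a frame moving with the group
    velocity [- 3 N ^ 2], rescaled by [L], where [kap = N L]. *)

From HB Require Import structures.
Require Import Defs.
From mathcomp Require Import all_boot all_order all_algebra.
From mathcomp Require Import all_classical all_reals all_analysis.
From mathcomp Require Import measurable_realfun ring lra.

Set Implicit Arguments.
Unset Strict Implicit.
Unset Printing Implicit Defensive.

Import Order.TTheory GRing.Theory Num.Theory.
Import numFieldNormedType.Exports.

Local Open Scope classical_set_scope.
Local Open Scope ring_scope.

(** * Calculus on the line *)

(** The ball must not depend on the time, while phases that differ by [phi ^ 2] at a time [t] below
    [T] need [beta2 - beta1 = 1 / t]. Both amplitudes are therefore raised until their ratio is
    close to [1], and only then is [N] sent to infinity. Both data share the carrier [N] and the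
    scale [L], so at time [0] they differ only by an amplitude factor and by lower order terms.

    The plain wave is not accurate enough: besides turning the phase, the cubic term forces a third
    harmonic of the same order. In the moving frame this harmonic is off resonance by [24 A], with
    [A = N ^ 3], and a correction of size [beta / (24 A)] absorbs it.

    The lower bound in the negative Sobolev norm comes from duality: the difference is paired with
    an explicit wave in quadrature with it, whose dual norm is controlled. In this pairing the
    square in Miura's map is a perturbation, because the derivative gains the large wave number. *)

Section Derivatives.
Context {R : realType}.
Implicit Types (f g : R -> R) (x a b : R).

Definition hasD f x a := is_derive x (1 : R) f a.

Lemma hasD_eq f x a b : hasD f x a -> a = b -> hasD f x b.
Proof. by move=> ? <-. Qed.

Lemma hasD_ext f g x a : f =1 g -> hasD f x a -> hasD g x a.
Proof. by move=> /funext ->. Qed.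

Lemma hasD_cst x a : hasD (fun=> a) x 0.
Proof. exact: is_derive_cst. Qed.

Lemma hasD_id x : hasD (fun y => y) x 1.
Proof. exact: is_derive_id. Qed.

Lemma hasDD f g x a b : hasD f x a -> hasD g x b ->
  hasD (fun y => f y + g y) x (a + b).
Proof. by move=> ? ?; exact: is_deriveD. Qed.

Lemma hasDN f x a : hasD f x a -> hasD (fun y => - f y) x (- a).
Proof. by move=> ?; exact: is_deriveN. Qed.

Lemma hasDB f g x a b : hasD f x a -> hasD g x b ->
  hasD (fun y => f y - g y) x (a - b).
Proof. by move=> ? ?; exact: is_deriveB. Qed.

Lemma hasDM f g x a b : hasD f x a -> hasD g x b ->
  hasD (fun y => f y * g y) x (a * g x + f x * b).
Proof.
move=> ? ?; apply: (@hasD_eq _ _ (f x *: b + g x *: a)); first exact: is_deriveM.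
by rewrite addrC /GRing.scale/= (mulrC (g x)).
Qed.

Lemma hasD_comp f g x a b : hasD g x b -> hasD f (g x) a ->
  hasD (fun y => f (g y)) x (a * b).
Proof.
by move=> gb fa; exact: (@is_derive1_comp _ f g).
Qed.

Lemma hasDZ f x a b : hasD f x a -> hasD (fun y => b * f y) x (b * a).
Proof.
by move=> fa; apply: hasD_eq (hasDM (hasD_cst x b) fa) _; rewrite mul0r add0r.
Qed.

Lemma hasD_cos f x a : hasD f x a ->
  hasD (fun y => cos (f y)) x (- sin (f x) * a).
Proof. by move=> fa; apply: (hasD_comp fa); exact: is_derive_cos. Qed.

Lemma hasD_sin f x a : hasD f x a ->
  hasD (fun y => sin (f y)) x (cos (f x) * a).
Proof. by move=> fa; apply: (hasD_comp fa); exact: is_derive_sin. Qed.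

Lemma hasD_expR f x a : hasD f x a ->
  hasD (fun y => expR (f y)) x (expR (f x) * a).
Proof. by move=> fa; apply: (hasD_comp fa); exact: is_derive_expR. Qed.

Lemma hasD_derive1 f x a : hasD f x a -> derive1 f x = a.
Proof. by move=> [_ <-]; rewrite derive1E. Qed.

Lemma hasD_derivable f x a : hasD f x a -> derivable f x 1.
Proof. by case. Qed.

Lemma derivable_hasD f x : derivable f x 1 -> hasD f x (derive1 f x).
Proof. by move=> fx; rewrite derive1E; exact: derivableP. Qed.

Lemma hasD_continuous f x a : hasD f x a -> {for x, continuous f}.
Proof. by move=> /hasD_derivable/derivable1_diffP/differentiable_continuous. Qed.

Lemma hasD_MVT f f' a b : (forall x, hasD f x (f' x)) ->
  exists2 c, `|c - a| <= `|b - a| & f b - f a = f' c * (b - a).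
Proof.
move=> ff'; have cf : continuous f by move=> x; exact: hasD_continuous (ff' x).
have [ab|ba|->] := ltgtP a b.
- have [c /[!in_itv]/= /andP[ac cb] ->] := MVT ab (fun x _ => ff' x)
     (continuous_subspaceT cf).
  by exists c => //; rewrite !ger0_norm; lra.
- have [c /[!in_itv]/= /andP[ac cb] e] := MVT ba (fun x _ => ff' x)
     (continuous_subspaceT cf).
  by exists c; [rewrite !ler0_norm; lra|lra].
- by exists b; rewrite ?subrr ?mulr0.
Qed.

(** A quadratic remainder stands in for joint differentiability in [hasD_frame], the chain rule
    along a moving frame. *)
Lemma hasD_quad f x a K : (forall s, `|s| <= 1 ->
  `|f (x + s) - f x - s * a| <= K * s ^+ 2) -> hasD f x a.
Proof.
move=> fK.
have lim : (h^-1 * (f (h + x) - f x)) @[h --> 0^'] --> a.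
  apply/cvgrPdist_le => /= e e0.
  have K1 : 0 < `|K| + 1 by rewrite ltr_wpDl.
  near=> h.
  have h0 : h != 0 by near: h; exact: nbhs_dnbhs_neq.
  have h1 : `|h| <= 1 by near: h; apply: dnbhs0_le.
  have he : `|h| <= e / (`|K| + 1) by near: h; apply: dnbhs0_le; exact: divr_gt0.
  have -> : a - h^-1 * (f (h + x) - f x) = - (h^-1 * (f (x + h) - f x - h * a)).
    by rewrite (addrC h x); field.
  rewrite normrN normrM normfV ler_pdivrMl ?normr_gt0//.
  apply: (le_trans (fK _ h1)); rewrite -real_normK ?num_real// expr2 mulrCA ler_wpM2l//.
  move: he; rewrite ler_pdivlMr// => he.
  apply: le_trans he; rewrite mulrC ler_wpM2l// (le_trans (ler_norm _))//; lra.
apply: DeriveDef.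
  apply/cvg_ex; exists a => /=; under eq_fun do rewrite scaler1.
  exact: lim.
rewrite /derive; apply: cvg_lim => //; under eq_fun do rewrite scaler1.
exact: lim.
Unshelve. all: by end_near. Qed.

End Derivatives.

(** * Integrals over the line and the weight [1 / (1 + x ^ 2)] *)

Section IntegralLine.
Context {R : realType}.
Local Notation mu := (@lebesgue_measure R).
Implicit Types (f g : R -> R).

(** The inverse square of the Japanese bracket. Its powers measure decay, and one of them, of
    integral [pi], is spent at each integration. *)
Definition jap (x : R) : R := (1 + x ^+ 2)^-1.

Lemma jap_gt0 x : 0 < jap x.
Proof. by rewrite invr_gt0 ltr_pwDl// sqr_ge0. Qed.

Lemma jap_ge0 x : 0 <= jap x. Proof. exact: ltW (jap_gt0 x). Qed.

Lemma jap_le1 x : jap x <= 1.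
Proof. by rewrite invf_le1 ?lerDl ?sqr_ge0// ltr_pwDl// sqr_ge0. Qed.

Lemma japX_ge0 x k : 0 <= jap x ^+ k. Proof. exact: exprn_ge0 (jap_ge0 x). Qed.

Lemma continuous_jap : continuous jap.
Proof. exact: continuous_oneDsqrV. Qed.

Definition decay f := continuous f /\ exists C, forall x, `|f x| <= C * jap x.

Definition Int f : R := \int[mu]_x f x.

Definition integ f := mu.-integrable setT (EFin \o f).

Lemma continuous_measurable_EFin f : continuous f ->
  measurable_fun [set: R] (EFin \o f).
Proof. by move=> cf; apply/measurable_EFinP; exact: continuous_measurable_fun. Qed.

Lemma ge0_even_integral_jap : (\int[mu]_x (jap x)%:E = (pi : R)%:E)%E.
Proof.
rewrite ge0_symfun_integralT; first last.
- by move=> x; rewrite /= /jap sqrrN.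
- exact: continuous_jap.
- by move=> x; exact: jap_ge0.
rewrite -set_itvcy integral0y_oneDsqr -EFinM; congr (_%:E); lra.
Qed.

Lemma integ_jap : integ jap.
Proof.
apply/integrableP; split; first exact: continuous_measurable_EFin continuous_jap.
rewrite (_ : (\int[mu]_x _ = \int[mu]_x (jap x)%:E)%E).
  by rewrite ge0_even_integral_jap ltry.
by apply: eq_integral => x _; rewrite gee0_abs// lee_fin jap_ge0.
Qed.

Lemma Int_jap : Int jap = pi.
Proof. by rewrite /Int /Rintegral ge0_even_integral_jap. Qed.

Lemma decay_integ f : decay f -> integ f.
Proof.
move=> [cf [C fC]].
have iC : mu.-integrable setT (fun x => (C * jap x)%:E).
  exact: (integrableZl _ C integ_jap).
apply: (le_integrable _ _ _ iC) => //; first exact: continuous_measurable_EFin.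
by move=> x _ /=; rewrite lee_fin (le_trans (fC x))// ler_norm.
Qed.

Lemma integD f g : integ f -> integ g -> integ (fun x => f x + g x).
Proof.
by move=> If Ig; apply: eq_integrable (integrableD _ If Ig) => // x _; rewrite EFinD.
Qed.

Lemma integZ f c : integ f -> integ (fun x => c * f x).
Proof.
by move=> If; apply: eq_integrable (integrableZl _ c If) => // x _; rewrite EFinM.
Qed.

Lemma eq_Int f g : f =1 g -> Int f = Int g.
Proof. by move=> /funext ->. Qed.

Lemma IntD f g : integ f -> integ g -> Int (fun x => f x + g x) = Int f + Int g.
Proof. by move=> ? ?; exact: RintegralD. Qed.

Lemma IntB f g : integ f -> integ g -> Int (fun x => f x - g x) = Int f - Int g.
Proof. by move=> ? ?; exact: RintegralB. Qed.

Lemma IntZ f c : integ f -> Int (fun x => c * f x) = c * Int f.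
Proof. by move=> ?; exact: RintegralZl. Qed.

Lemma Int_le f g : integ f -> integ g -> (forall x, f x <= g x) -> Int f <= Int g.
Proof. by move=> ? ? fg; apply: le_Rintegral. Qed.

Lemma Int_ge0 f : (forall x, 0 <= f x) -> 0 <= Int f.
Proof. by move=> f0; apply: Rintegral_ge0. Qed.

Lemma Int_norm_le f : integ f -> `|Int f| <= Int (fun x => `|f x|).
Proof. by move=> ?; exact: le_normr_Rintegral. Qed.

Lemma integ_norm f : integ f -> integ (fun x => `|f x|).
Proof. by move=> If; apply: eq_integrable (integrable_abse If). Qed.

Lemma Int_bound f C : integ f -> (forall x, `|f x| <= C * jap x) ->
  `|Int f| <= C * pi.
Proof.
move=> If fC; apply: (le_trans (Int_norm_le If)).
rewrite -Int_jap -IntZ; last exact: integ_jap.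
by apply: Int_le => //; [exact: integ_norm|exact: integZ integ_jap].
Qed.

Lemma decayD f g : decay f -> decay g -> decay (fun x => f x + g x).
Proof.
move=> [cf [C fC]] [cg [D gD]]; split.
  by move=> x; apply: continuousD; [exact: cf|exact: cg].
exists (C + D) => x; rewrite mulrDl; exact: le_trans (ler_normD _ _) (lerD _ _).
Qed.

Lemma decayM f g : decay f -> continuous g -> (exists C, forall x, `|g x| <= C) ->
  decay (fun x => f x * g x).
Proof.
move=> [cf [C fC]] cg [D gD]; split.
  by move=> x; apply: continuousM; [exact: cf|exact: cg].
exists (C * D) => x; rewrite normrM mulrAC; exact: ler_pM.
Qed.

Lemma decayZ f c : decay f -> decay (fun x => c * f x).
Proof.
move=> df; rewrite (_ : (fun x => _) = (fun x => f x * c)); last first.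
  by apply/funext => x; rewrite mulrC.
by apply: decayM => //; [move=> x; exact: cvg_cst|exists `|c|].
Qed.

Lemma decayN f : decay f -> decay (fun x => - f x).
Proof.
move=> df; rewrite (_ : (fun x => _) = (fun x => -1 * f x)); first exact: decayZ.
by apply/funext => x; rewrite mulN1r.
Qed.

Lemma decayB f g : decay f -> decay g -> decay (fun x => f x - g x).
Proof. by move=> df /decayN; exact: decayD. Qed.

Lemma decay_bounded f : decay f -> exists C, forall x, `|f x| <= C.
Proof.
move=> [_ [C fC]]; exists C => x.
have C0 : 0 <= C.
  by have := le_trans (normr_ge0 _) (fC 0); rewrite pmulr_lge0// jap_gt0.
by rewrite (le_trans (fC x))// ler_piMr// jap_le1.
Qed.

Lemma decayMM f g : decay f -> decay g -> decay (fun x => f x * g x).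
Proof. by move=> df dg; apply: decayM => //; [case: dg|exact: decay_bounded]. Qed.

Lemma decay_jap : decay jap.
Proof.
split; first exact: continuous_jap.
by exists 1 => x; rewrite mul1r ger0_norm// jap_ge0.
Qed.

(** Cauchy--Schwarz, from the discriminant of [int (f + c g)^2]. *)
Lemma Int_CS f g : decay f -> decay g ->
  Int (fun x => f x * g x) ^+ 2 <= Int (fun x => f x ^+ 2) * Int (fun x => g x ^+ 2).
Proof.
move=> df dg.
have sq : forall h, decay h -> integ (fun x => h x ^+ 2).
  by move=> h dh; apply: decay_integ; exact: (decayMM dh dh).
have ifg : integ (fun x => f x * g x) by apply: decay_integ; exact: decayMM.
set a := Int (fun x => f x * g x); set b := Int (fun x => g x ^+ 2).
set c := Int (fun x => f x ^+ 2).
have quad l : 0 <= c + l * (2 * a) + l ^+ 2 * b.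
  have : 0 <= Int (fun x => (f x + l * g x) ^+ 2).
    by apply: Int_ge0 => x; exact: sqr_ge0.
  rewrite (@eq_Int _ (fun x => f x ^+ 2 + l * (2 * (f x * g x)) + l ^+ 2 * g x ^+ 2)).
    rewrite IntD ?IntD ?IntZ//; do ?[apply: integD|apply: integZ|exact: sq|by []].
  by move=> x; ring.
have b0 : 0 <= b by apply: Int_ge0 => x; exact: sqr_ge0.
have [b_eq0|b_neq0] := eqVneq b 0.
  have [->|a0] := eqVneq a 0; first by rewrite expr0n/= b_eq0 mulr0.
  have := quad (- (c + 1) / (2 * a)); rewrite b_eq0 mulr0 addr0 divfK; first lra.
  by rewrite mulf_neq0// pnatr_eq0.
have bp : 0 < b by rewrite lt_neqAle eq_sym b_neq0.
have := quad (- a / b).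
rewrite (_ : _ + _ = (c * b - a ^+ 2) / b); last by field.
by rewrite pmulr_lge0 ?invr_gt0// subr_ge0.
Qed.

End IntegralLine.

(** * Antiderivatives, affine substitution and derivatives under the integral *)

Section Primitive.
Context {R : realType}.
Local Notation mu := (@lebesgue_measure R).
Implicit Types (f g F : R -> R).

Lemma hasD0_const f : (forall x, hasD f x 0) -> forall x y, f x = f y.
Proof.
move=> f0 x y; have [c _] := hasD_MVT y x f0.
by rewrite mul0r => /eqP; rewrite subr_eq0 => /eqP.
Qed.

Lemma hasD_unique f x a b : hasD f x a -> hasD f x b -> a = b :> R.
Proof. by move=> /hasD_derive1 <- /hasD_derive1. Qed.

Lemma jap_lt e : 0 < e -> exists2 X : R, 0 <= X & forall x, X <= `|x| -> jap x < e.
Proof.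
move=> e0; exists (e^-1) => [|x xe]; first by rewrite invr_ge0 ltW.
have x1 : 0 < `|x| by rewrite (lt_le_trans _ xe)// invr_gt0.
rewrite /jap -[ltRHS]invrK ltf_pV2 ?posrE ?invr_gt0//; last first.
  by rewrite ltr_pwDl// sqr_ge0.
apply: (le_lt_trans xe); rewrite -real_normK ?num_real//.
by have := sqr_ge0 (`|x| - 1); nra.
Qed.

(** This identifies antiderivatives: two of them differ by a constant, which vanishes once both
    decay at the same end of the line. *)
Lemma eq0_of_jap (c C X : R) :
  (forall x, X <= x -> `|c| <= C * jap x) -> c = 0.
Proof.
move=> cC; apply/eqP; rewrite -normr_le0 leNgt; apply/negP => c0.
have C1 : 0 < `|C| + 1 by rewrite ltr_wpDl.
have [Y Y0 Yj] := jap_lt (divr_gt0 c0 C1).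
have := cC (`|X| + Y); rewrite (le_trans (ler_norm X)) ?lerDl// => /(_ isT).
have := Yj (`|X| + Y); rewrite (ger0_norm (addr_ge0 _ _))// lerDr normr_ge0 => /(_ isT).
rewrite ltr_pdivlMr// => h1 h2.
have : C * jap (`|X| + Y) <= jap (`|X| + Y) * (`|C| + 1).
  by rewrite mulrC ler_wpM2l ?jap_ge0// (le_trans (ler_norm _))// lerDl.
lra.
Qed.

Definition prim f (x : R) : R := \int[mu]_(y in `]-oo, x]) f y.

Lemma integ_on f (D : set (measurableTypeR R)) : measurable D -> integ f ->
  mu.-integrable D (EFin \o f).
Proof. by move=> mD; apply: integrableS. Qed.

Lemma prim_hasD f x : integ f -> continuous f -> hasD (prim f) x (f x).
Proof.
move=> If cf.
have [] // := @continuous_FTC1 R f -oo%O x (x + 1) _ _ _ (cf x).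
- by rewrite ltrDl.
- exact: integ_on.
- by rewrite ltNyr.
by move=> dF <-; exact: derivable_hasD.
Qed.

Lemma norm_set_Int f (D : set (measurableTypeR R)) : measurable D -> integ f ->
  `|\int[mu]_(y in D) f y| <= Int (fun y => `|f y|).
Proof.
move=> mD If; apply: (le_trans (le_normr_Rintegral mD (integ_on mD If))).
rewrite /Int Rintegral_mkcond; apply: le_Rintegral => //.
- have iD := integ_on mD (integ_norm If).
  by rewrite -restrict_EFin; apply: (proj1 (integrable_mkcond _ mD) iD).
- exact: integ_norm.
- by move=> y _; rewrite patchE; case: ifPn => _ //; exact: normr_ge0.
Qed.

Lemma norm_prim_le f x : integ f -> `|prim f x| <= Int (fun y => `|f y|).
Proof. by move=> If; exact: norm_set_Int. Qed.

(** Half-line integrals of a function with [k + 1] powers of decay keep [k] of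
    them, the last one being integrated. *)
Lemma set_Int_jap f k C (D : set (measurableTypeR R)) x : measurable D -> integ f ->
  (forall y, `|f y| <= C * jap y ^+ k.+1) ->
  (forall y, D y -> `|x| <= `|y|) ->
  `|\int[mu]_(y in D) f y| <= C * pi * jap x ^+ k.
Proof.
move=> mD If fC Dx.
have C0 : 0 <= C.
  by have := le_trans (normr_ge0 _) (fC 0); rewrite pmulr_lge0// exprn_gt0// jap_gt0.
apply: (le_trans (le_normr_Rintegral mD (integ_on mD If))).
have IC : integ (fun y => (C * jap x ^+ k) * jap y) by apply: integZ; exact: integ_jap.
apply: (@le_trans _ _ (\int[mu]_(y in D) ((C * jap x ^+ k) * jap y))).
  apply: le_Rintegral => //; [exact: integ_on (integ_norm If)|exact: integ_on|].
  move=> y Dy; apply: (le_trans (fC y)); rewrite exprSr mulrA ler_wpM2r ?jap_ge0//.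
  rewrite ler_wpM2l// lerXn2r ?nnegrE ?jap_ge0// /jap lef_pV2 ?posrE ?ltr_pwDl ?sqr_ge0//.
  by rewrite lerD2l -(real_normK (num_real x)) -(real_normK (num_real y)) lerXn2r ?nnegrE// Dx.
apply: (le_trans (ler_norm _)); apply: (le_trans (norm_set_Int mD IC)).
rewrite (@eq_Int _ _ (fun y => (C * jap x ^+ k) * jap y)); last first.
  by move=> y; rewrite ger0_norm// mulr_ge0 ?jap_ge0// mulr_ge0// japX_ge0.
by rewrite IntZ ?Int_jap; [rewrite mulrAC|exact: integ_jap].
Qed.

Lemma prim_jap f k C x : integ f -> (forall y, `|f y| <= C * jap y ^+ k.+1) ->
  x <= 0 -> `|prim f x| <= C * pi * jap x ^+ k.
Proof.
move=> If fC x0; apply: set_Int_jap => // y /=; rewrite in_itv/= => yx.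
by have y0 := le_trans yx x0; rewrite !ler0_norm// lerN2.
Qed.

Lemma Int_prim f x : integ f -> Int f - prim f x = \int[mu]_(y in `]x, +oo[) f y.
Proof.
move=> If; rewrite /prim -(@Rintegral_itvB _ f -oo%O +oo%O x) ?set_itvNyy//.

Qed.

Lemma Int_prim_jap f k C x : integ f ->
  (forall y, `|f y| <= C * jap y ^+ k.+1) ->
  0 <= x -> `|Int f - prim f x| <= C * pi * jap x ^+ k.
Proof.
move=> If fC x0; rewrite Int_prim//; apply: set_Int_jap => // y /=.
rewrite in_itv/= andbT => /ltW xy.
by have y0 := le_trans x0 xy; rewrite !ger0_norm.
Qed.

Lemma primE f F C X : continuous f -> (forall x, `|f x| <= C * jap x ^+ 2) ->
  (forall x, hasD F x (f x)) -> (forall x, x <= - X -> `|F x| <= C * jap x) ->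
  prim f = F.
Proof.
move=> cf fC FD FC; have If : integ f.
  apply: decay_integ; split=> //; exists `|C| => x; apply: (le_trans (fC x)).
  rewrite expr2 mulrA ler_wpM2r ?jap_ge0//.
  apply: (le_trans (ler_norm _)); rewrite normrM (ger0_norm (jap_ge0 _)).
  by rewrite ler_piMr// jap_le1.
have G0 := @hasD0_const (fun x => prim f x - F x) (fun x => hasD_eq (hasDB (prim_hasD x If cf) (FD x)) (subrr _)).
apply/funext => x; apply/eqP; rewrite -subr_eq0; apply/eqP.
apply: (@eq0_of_jap _ (C * pi + C) `|X|) => y Xy.
have y0 : - y <= 0 by rewrite oppr_le0 (le_trans _ Xy).
rewrite (G0 _ (- y)) (le_trans (ler_normB _ _))// mulrDl.
have -> : jap y = jap (- y) by rewrite /jap sqrrN.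
apply: lerD; first exact: (@prim_jap f 1).
by apply: FC; rewrite lerN2 (le_trans (ler_norm _)).
Qed.

Lemma Int_FTC f F l C X : continuous f -> (forall x, `|f x| <= C * jap x ^+ 2) ->
  (forall x, hasD F x (f x)) -> (forall x, x <= - X -> `|F x| <= C * jap x) ->
  (forall x, X <= x -> `|l - F x| <= C * jap x) -> Int f = l.
Proof.
move=> cf fC FD FC Fl.
have FE := primE cf fC FD FC; have If : integ f.
  apply: decay_integ; split=> //; exists `|C| => x; apply: (le_trans (fC x)).
  rewrite expr2 mulrA ler_wpM2r ?jap_ge0//.
  apply: (le_trans (ler_norm _)); rewrite normrM (ger0_norm (jap_ge0 _)).
  by rewrite ler_piMr// jap_le1.
apply/eqP; rewrite -subr_eq0; apply/eqP.
apply: (@eq0_of_jap _ (C * pi + C) `|X|) => y Xy.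
have -> : Int f - l = (Int f - prim f y) - (l - F y) by rewrite FE; ring.
rewrite (le_trans (ler_normB _ _))// mulrDl; apply: lerD.
  by apply: (@Int_prim_jap f 1) => //; rewrite (le_trans _ Xy).
by apply: Fl; rewrite (le_trans (ler_norm _)).
Qed.

Lemma Int_deriv0 f F C : continuous f -> (forall x, `|f x| <= C * jap x ^+ 2) ->
  (forall x, hasD F x (f x)) -> (forall x, `|F x| <= C * jap x) -> Int f = 0.
Proof.
by move=> cf fC FD FC; apply: (Int_FTC (X := 0) cf fC FD) => x _; rewrite ?sub0r ?normrN.
Qed.

Lemma norm_le_Int_deriv f F C x : continuous f ->
  (forall x, `|f x| <= C * jap x ^+ 2) ->
  (forall x, hasD F x (f x)) -> (forall x, `|F x| <= C * jap x) ->
  `|F x| <= Int (fun y => `|f y|).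
Proof.
move=> cf fC FD FC; rewrite -(primE (X := 0) cf fC FD) => [|y _]; last exact: FC.
apply: norm_prim_le; apply: decay_integ; split=> //; exists `|C| => y.
apply: (le_trans (fC y)); rewrite expr2 mulrA ler_wpM2r ?jap_ge0//.
apply: (le_trans (ler_norm _)); rewrite normrM (ger0_norm (jap_ge0 _)).
by rewrite ler_piMr// jap_le1.
Qed.

Lemma jap_affine (a b x : R) : a != 0 ->
  jap (a * x + b) <= (1 + 2 * (1 + b ^+ 2) / a ^+ 2) * jap x.
Proof.
move=> a0; have a2 : 0 < a ^+ 2 by rewrite exprn_even_gt0.
rewrite /jap ler_pdivlMr ?ltr_pwDl ?sqr_ge0// mulrC ler_pdivrMr ?ltr_pwDl ?sqr_ge0//.
set y := a * x + b.
have -> : x = (y - b) / a by rewrite /y addrK mulrAC mulfV ?mul1r.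
rewrite -(ler_pM2r a2) expr_div_n.
rewrite [X in X <= _](_ : _ = a ^+ 2 + (y - b) ^+ 2); last by field.
rewrite [X in _ <= X](_ : _ = (a ^+ 2 + 2 * (1 + b ^+ 2)) * (1 + y ^+ 2)); last by field.
have := sqr_ge0 (y + b); have := mulr_ge0 (ltW a2) (sqr_ge0 y).
have := mulr_ge0 (sqr_ge0 b) (sqr_ge0 y); have := sqr_ge0 y; have := sqr_ge0 b.
by nra.
Qed.

(** The function [prim f (a x + b) / a] is an antiderivative of the left integrand with the right
    limits at both ends, so no change of variables in the measure is needed. *)
Lemma Int_affine f C (a b : R) : 0 < a -> continuous f ->
  (forall x, `|f x| <= C * jap x ^+ 2) ->
  Int (fun x => f (a * x + b)) = a^-1 * Int f.
Proof.
move=> a0 cf fC; have an0 : a != 0 by rewrite gt_eqF.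
have C0 : 0 <= C.
  by have := le_trans (normr_ge0 _) (fC 0); rewrite pmulr_lge0// exprn_gt0// jap_gt0.
have If : integ f.
  apply: decay_integ; split=> //; exists C => x; apply: (le_trans (fC x)).
  by rewrite ler_wpM2l// expr2 ler_piMr ?jap_le1 ?jap_ge0.
pose K := 1 + 2 * (1 + b ^+ 2) / a ^+ 2.
have K0 : 0 <= K.
  by rewrite addr_ge0// divr_ge0 ?sqr_ge0// mulr_ge0// addr_ge0// sqr_ge0.
have aff x : hasD (fun y => a * y + b) x a.
  by apply: hasD_eq (hasDD (hasDZ _ (hasD_id x)) (hasD_cst x b)) _; rewrite addr0 mulr1.
have ca : continuous (fun x => a * x + b) by move=> x; exact: hasD_continuous (aff x).
have Kx x : jap (a * x + b) <= K * jap x by exact: jap_affine.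
(* The first summand dominates the integrand, the second its antiderivative at both ends. *)
pose C' := C * K ^+ 2 + a^-1 * (C * pi * K).
have ai : 0 <= a^-1 by rewrite invr_ge0 ltW.
have D0 : 0 <= C * pi * K by rewrite !mulr_ge0// pi_ge0.
apply: (@Int_FTC _ (fun x => a^-1 * prim f (a * x + b)) _ C' (`|b| / a)).
- by move=> x; apply: (@continuous_comp _ _ _ (fun x => a * x + b) f); [exact: ca|exact: cf].
- move=> x; apply: (le_trans (fC _)); apply: (@le_trans _ _ (C * (K * jap x) ^+ 2)).
    by rewrite ler_wpM2l// lerXn2r ?nnegrE ?mulr_ge0 ?jap_ge0.
  by rewrite exprMn mulrA ler_wpM2r ?japX_ge0// lerDl mulr_ge0.
- move=> x; apply: hasD_eq (hasDZ _ (hasD_comp (aff x) (prim_hasD _ If cf))) _.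
  by rewrite mulrCA mulVf// mulr1.
- move=> x; rewrite -mulNr ler_pdivlMr// => xb.
  have ab0 : a * x + b <= 0 by have := ler_norm b; lra.
  rewrite normrM (ger0_norm ai) /C' mulrDl.
  apply: (@le_trans _ _ (a^-1 * (C * pi * (K * jap x)))).
    rewrite ler_wpM2l//; apply: (le_trans (@prim_jap f 1 C _ If fC ab0)).
    by rewrite expr1 ler_wpM2l// mulr_ge0// pi_ge0.
  by rewrite !mulrA lerDr !mulr_ge0// jap_ge0.
- move=> x; rewrite ler_pdivrMr// => xb.
  have ab0 : 0 <= a * x + b by have := ler_norm (- b); rewrite normrN; lra.
  rewrite -mulrBr normrM (ger0_norm ai) /C' mulrDl.
  apply: (@le_trans _ _ (a^-1 * (C * pi * (K * jap x)))).
    rewrite ler_wpM2l//; apply: (le_trans (@Int_prim_jap f 1 C _ If fC ab0)).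
    by rewrite expr1 ler_wpM2l// mulr_ge0// pi_ge0.
  by rewrite !mulrA lerDr !mulr_ge0// jap_ge0.
Qed.

Lemma hasD_set_Int (f ft : R -> R -> R) (D : set (measurableTypeR R)) t0 C : measurable D ->
  (forall t, integ (f t)) ->
  (forall t x, hasD (fun t => f t x) t (ft t x)) ->
  (forall t x, `|t - t0| <= 1 -> `|ft t x| <= C * jap x) ->
  hasD (fun t => \int[mu]_(x in D) f t x) t0 (\int[mu]_(x in D) ft t0 x).
Proof.
move=> mD If fD fC.
have It0 : `]t0 - 1, t0 + 1[%classic t0.
  by rewrite /= in_itv/= ltrBlDr ltrDl ltr01.
have close t : `]t0 - 1, t0 + 1[%classic t -> `|t - t0| <= 1.
  by rewrite /= in_itv/= => /andP[? ?]; rewrite ler_norml; lra.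
have d1E t x : partial1of2 f t x = ft t x by exact: hasD_derive1 (fD t x).
have C0 : 0 <= C.
  have := fC t0 0; rewrite subrr normr0 ler01 => /(_ isT) /(le_trans (normr_ge0 _)).
  by rewrite pmulr_lge0// jap_gt0.
pose F t := \int[mu]_(x in D) f t x.
have := @cvg_differentiation_under_integral R _ _ mu f D mD t0 (t0 - 1) (t0 + 1)
  It0 _ _ (fun x => C * jap x) _ _ _.
have If' t : `]t0 - 1, t0 + 1[%classic t -> mu.-integrable D (EFin \o f t).
  by move=> _; exact: integ_on.
have Df' t x : `]t0 - 1, t0 + 1[%classic t -> D x -> derivable (f ^~ x) t 1.
  by move=> _ _; exact: hasD_derivable (fD t x).
move=> /(_ If' Df') lim.
have {lim} := lim _ _ _.
rewrite (_ : \int[mu]_(y in D) partial1of2 f t0 y = \int[mu]_(x in D) ft t0 x); last first.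
  by apply: eq_Rintegral => x _; exact: d1E.
move=> lim.
have {lim}lim : (h^-1 *: (F (h + t0) - F t0)) @[h --> 0^'] --> \int[mu]_(x in D) ft t0 x.
  apply: lim.
  - by move=> y; rewrite mulr_ge0// jap_ge0.
  - by apply: integ_on => //; apply: integZ; exact: integ_jap.
  - by move=> t x /close tt _; rewrite d1E; exact: fC.
apply: DeriveDef.
  apply/cvg_ex; exists (\int[mu]_(x in D) ft t0 x) => /=.
  by under eq_fun do rewrite scaler1; exact: lim.
by rewrite /derive; apply: cvg_lim => //; under eq_fun do rewrite scaler1; exact: lim.
Qed.

Lemma hasD_Int (f ft : R -> R -> R) t0 C :
  (forall t, integ (f t)) ->
  (forall t x, hasD (fun t => f t x) t (ft t x)) ->
  (forall t x, `|t - t0| <= 1 -> `|ft t x| <= C * jap x) ->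
  hasD (fun t => Int (f t)) t0 (Int (ft t0)).
Proof.
by move=> If fD fC; exact: (@hasD_set_Int f ft setT t0 C measurableT If fD fC).
Qed.

End Primitive.

(** * Rapidly decreasing functions of time and space *)

(** Locked, so that iterated partial derivatives are opaque atoms for rewriting and for [ring]. *)
HB.lock Definition dt {R : realType} (f : R -> R -> R) (t x : R) : R :=
  derive1 (fun t' => f t' x) t.

HB.lock Definition dx {R : realType} (f : R -> R -> R) (t x : R) : R :=
  derive1 (f t) x.

Section Nice.
Context {R : realType}.
Implicit Types (f g : R -> R -> R) (k l n : nat).

Definition jap_bounded k f := forall T, exists C, forall t x, `|t| <= T ->
  `|f t x| <= C * jap x ^+ k.

(** [k] powers of decay in space, locally uniformly in time, for all partial
    derivatives of order at most [n]. *)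
Fixpoint nice k n f : Prop := jap_bounded k f /\
  if n is n'.+1 then
    [/\ forall t x, derivable (fun t' => f t' x) t 1,
        forall t x, derivable (f t) x 1, nice k n' (dt f) & nice k n' (dx f)]
  else True.

Lemma dt_val f t x a : hasD (fun t' => f t' x) t a -> dt f t x = a.
Proof. by rewrite dt.unlock => /hasD_derive1. Qed.

Lemma dx_val f t x a : hasD (f t) x a -> dx f t x = a.
Proof. by rewrite dx.unlock => /hasD_derive1. Qed.

Lemma dtE f g : (forall t x, hasD (fun t' => f t' x) t (g t x)) -> dt f = g.
Proof.
by move=> fg; apply/funext => t; apply/funext => x; exact: dt_val (fg t x).
Qed.

Lemma dxE f g : (forall t x, hasD (f t) x (g t x)) -> dx f = g.
Proof.
by move=> fg; apply/funext => t; apply/funext => x; exact: dx_val (fg t x).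
Qed.

Lemma nice_jap k n f : nice k n f -> jap_bounded k f.
Proof. by case: n => [|n] []. Qed.

Lemma nice_dtD k n f t x : nice k n.+1 f -> hasD (fun t' => f t' x) t (dt f t x).
Proof. by move=> [_ [dft _ _ _]]; rewrite dt.unlock; exact: derivable_hasD. Qed.

Lemma nice_dxD k n f t x : nice k n.+1 f -> hasD (f t) x (dx f t x).
Proof. by move=> [_ [_ dfx _ _]]; rewrite dx.unlock; exact: derivable_hasD. Qed.

Lemma niceS k n f ft fx : jap_bounded k f ->
  (forall t x, hasD (fun t' => f t' x) t (ft t x)) ->
  (forall t x, hasD (f t) x (fx t x)) -> nice k n ft -> nice k n fx ->
  nice k n.+1 f.
Proof.
move=> bf ftD fxD nt nx; split=> //; split; rewrite ?(dtE ftD) ?(dxE fxD)//.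
- by move=> t x; exact: hasD_derivable (ftD t x).
- by move=> t x; exact: hasD_derivable (fxD t x).
Qed.

Lemma nice_dt k n f : nice k n.+1 f -> nice k n (dt f).
Proof. by case=> _ []. Qed.

Lemma nice_dx k n f : nice k n.+1 f -> nice k n (dx f).
Proof. by case=> _ []. Qed.

Lemma niceW k n f : nice k n.+1 f -> nice k n f.
Proof.
elim: n f => [|n IH] f; first by move=> /nice_jap.
move=> nf; apply: (@niceS _ _ _ (dt f) (dx f)).
- exact: nice_jap nf.
- by move=> t x; exact: nice_dtD nf.
- by move=> t x; exact: nice_dxD nf.
- by apply: IH; exact: nice_dt.
- by apply: IH; exact: nice_dx.
Qed.

Lemma jap_bounded_weak k l f : (k <= l)%N -> jap_bounded l f -> jap_bounded k f.
Proof.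
move=> kl bf T; have [C fC] := bf T; exists `|C| => t x tT.
apply: (le_trans (fC t x tT)); apply: (@le_trans _ _ (`|C| * jap x ^+ l)).
  by rewrite ler_wpM2r ?japX_ge0// ler_norm.
by rewrite ler_wpM2l// -(subnK kl) exprD ler_piMl ?japX_ge0// exprn_ile1 ?jap_ge0 ?jap_le1.
Qed.

Lemma nice_weak k l n f : (k <= l)%N -> nice l n f -> nice k n f.
Proof.
move=> kl; elim: n f => [|n IH] f nf.
  by split=> //; apply: jap_bounded_weak kl (nice_jap nf).
apply: (@niceS _ _ _ (dt f) (dx f)).
- exact: jap_bounded_weak kl (nice_jap nf).
- by move=> t x; exact: nice_dtD nf.
- by move=> t x; exact: nice_dxD nf.
- by apply: IH; exact: nice_dt.
- by apply: IH; exact: nice_dx.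
Qed.

Lemma niceD k n f g : nice k n f -> nice k n g ->
  nice k n (fun t x => f t x + g t x).
Proof.
have b f' g' : jap_bounded k f' -> jap_bounded k g' ->
    jap_bounded k (fun t x => f' t x + g' t x).
  move=> bf bg T; have [C fC] := bf T; have [D gD] := bg T.
  by exists (C + D) => t x tT; rewrite mulrDl (le_trans (ler_normD _ _))// lerD ?fC ?gD.
elim: n f g => [|n IH] f g nf ng.
  by split=> //; apply: b; [exact: nice_jap nf|exact: nice_jap ng].
apply: (@niceS _ _ _ (fun t x => dt f t x + dt g t x) (fun t x => dx f t x + dx g t x)).
- by apply: b; [exact: nice_jap nf|exact: nice_jap ng].
- by move=> t x; apply: hasDD; [exact: nice_dtD nf|exact: nice_dtD ng].
- by move=> t x; apply: hasDD; [exact: nice_dxD nf|exact: nice_dxD ng].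
- by apply: IH; exact: nice_dt.
- by apply: IH; exact: nice_dx.
Qed.

Lemma niceM k l n f g : nice k n f -> nice l n g ->
  nice (k + l) n (fun t x => f t x * g t x).
Proof.
have b f' g' : jap_bounded k f' -> jap_bounded l g' ->
    jap_bounded (k + l) (fun t x => f' t x * g' t x).
  move=> bf bg T; have [C fC] := bf T; have [D gD] := bg T.
  by exists (C * D) => t x tT; rewrite normrM exprD mulrACA ler_pM ?fC ?gD.
elim: n f g => [|n IH] f g nf ng.
  by split=> //; apply: b; [exact: nice_jap nf|exact: nice_jap ng].
apply: (@niceS _ _ _ (fun t x => dt f t x * g t x + f t x * dt g t x)
                     (fun t x => dx f t x * g t x + f t x * dx g t x)).
- by apply: b; [exact: nice_jap nf|exact: nice_jap ng].
- by move=> t x; apply: hasDM; [exact: nice_dtD nf|exact: nice_dtD ng].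
- by move=> t x; apply: hasDM; [exact: nice_dxD nf|exact: nice_dxD ng].
- by apply: niceD; apply: IH; (try exact: nice_dt); exact: niceW.
- by apply: niceD; apply: IH; (try exact: nice_dx); exact: niceW.
Qed.

Lemma nice_cst n (c : R) : nice 0 n (fun _ _ => c).
Proof.
have b (d : R) : jap_bounded 0 (fun _ _ => d).
  by move=> T; exists `|d| => t x _; rewrite expr0 mulr1.
elim: n c => [|n IH] c; first by split=> //; exact: b.
by apply: (@niceS _ _ _ (fun _ _ => 0) (fun _ _ => 0)) => // t x; exact: hasD_cst.
Qed.

Lemma nice_time n : nice 0 n (fun t _ => t).
Proof.
have b : jap_bounded 0 (fun t _ => t).
  by move=> T; exists T => t x tT; rewrite expr0 mulr1.
case: n => [|n]; first by split.
apply: (@niceS _ _ _ (fun _ _ => 1) (fun _ _ => 0)); rewrite //.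
- by move=> t x; exact: hasD_id.
- by move=> t x; exact: hasD_cst.
- exact: nice_cst.
- exact: nice_cst.
Qed.

(** Sine and cosine are treated together because the derivative of each calls for the other at the
    previous order. *)
Lemma nice_cos_sin n f : nice 0 n f ->
  nice 0 n (fun t x => cos (f t x)) /\ nice 0 n (fun t x => sin (f t x)).
Proof.
have b (h : R -> R) g : (forall x, `|h x| <= 1) -> jap_bounded 0 (fun t x => h (g t x)).
  by move=> h1 T; exists 1 => t x _; rewrite expr0 mulr1.
have cos1 x : `|cos x : R| <= 1 by rewrite ler_norml cos_geN1 cos_le1.
have sin1 x : `|sin x : R| <= 1 by rewrite ler_norml sin_geN1 sin_le1.
elim: n f => [|n IH] f nf; first by split; split=> //; exact: b.
have [nc ns] := IH f (niceW nf).
have nN : nice 0 n (fun t x => - sin (f t x)).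
  rewrite (_ : (fun t x => _) = (fun t x => -1 * sin (f t x))).
    exact: (niceM (nice_cst n (-1)) ns).
  by apply/funext => t; apply/funext => x; rewrite mulN1r.
split.
- apply: (@niceS _ _ _ (fun t x => - sin (f t x) * dt f t x)
                       (fun t x => - sin (f t x) * dx f t x)); first exact: b.
  + by move=> t x; apply: (@hasD_cos _ (fun t => f t x)); exact: nice_dtD nf.
  + by move=> t x; apply: hasD_cos; exact: nice_dxD nf.
  + exact: niceM nN (nice_dt nf).
  + exact: niceM nN (nice_dx nf).
- apply: (@niceS _ _ _ (fun t x => cos (f t x) * dt f t x)
                       (fun t x => cos (f t x) * dx f t x)); first exact: b.
  + by move=> t x; apply: (@hasD_sin _ (fun t => f t x)); exact: nice_dtD nf.
  + by move=> t x; apply: hasD_sin; exact: nice_dxD nf.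
  + exact: niceM nc (nice_dt nf).
  + exact: niceM nc (nice_dx nf).
Qed.

Lemma nice_lipschitz g T : nice 0 1 g -> exists C, forall t x t' x',
  `|t| <= T -> `|t'| <= T -> `|g t x - g t' x'| <= C * (`|t - t'| + `|x - x'|).
Proof.
move=> ng; have [A gA] := nice_jap (nice_dt ng) T.
have [B gB] := nice_jap (nice_dx ng) T; exists (`|A| + `|B|) => t x t' x' tT t'T.
have [s sT sE] : exists2 s, `|s| <= T & g t x - g t' x = dt g s x * (t - t').
  have cg : continuous (fun s => g s x).
    by move=> s; exact: hasD_continuous (nice_dtD s x ng).
  have [tt'|tt'|->] := ltgtP t t'; last first.
    by exists t'; rewrite ?subrr ?mulr0.
  - have [c /[!in_itv]/= /andP[a b] e] := MVT tt' (fun s _ => nice_dtD s x ng)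
      (continuous_subspaceT cg).
    exists c; last by rewrite e.
    by move: tT t'T; rewrite !ler_norml => /andP[? ?] /andP[? ?]; apply/andP; split; lra.
  - have [c /[!in_itv]/= /andP[a b] e] := MVT tt' (fun s _ => nice_dtD s x ng)
      (continuous_subspaceT cg).
    exists c; last by rewrite -[LHS]opprB e -mulrN opprB.
    by move: tT t'T; rewrite !ler_norml => /andP[? ?] /andP[? ?]; apply/andP; split; lra.
have [y _ yE] := hasD_MVT x' x (fun y => nice_dxD t' y ng).
have -> : g t x - g t' x' = (g t x - g t' x) + (g t' x - g t' x') by ring.
rewrite (le_trans (ler_normD _ _))// sE yE !normrM mulrDl !mulrDr.
have hA : `|dt g s x| <= `|A|.
  by have := gA s x sT; rewrite expr0 mulr1 => /le_trans; apply; exact: ler_norm.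
have hB : `|dx g t' y| <= `|B|.
  by have := gB t' y t'T; rewrite expr0 mulr1 => /le_trans; apply; exact: ler_norm.
have h1 := ler_wpM2r (normr_ge0 (t - t')) hA.
have h2 := ler_wpM2r (normr_ge0 (x - x')) hB.
have h3 : 0 <= `|A| * `|x - x'| by rewrite mulr_ge0.
have h4 : 0 <= `|B| * `|t - t'| by rewrite mulr_ge0.
lra.
Qed.

End Nice.

(** * Schwartz functions of space depending smoothly on time *)

Section SNice.
Context {R : realType}.
Local Notation mu := (@lebesgue_measure R).
Implicit Types (f g : R -> R -> R) (k l n : nat).

Definition snice f := forall k n, nice k n f.
(** The algebra of multipliers, in which the [snice] functions form an ideal: envelopes keep their
    decay when multiplied by oscillating phases. *)
Definition bnice f := forall n, nice 0 n f.

Lemma snice_bnice f : snice f -> bnice f. Proof. by move=> sf n. Qed.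

Lemma snice_dtD f t x : snice f -> hasD (fun t' => f t' x) t (dt f t x).
Proof. by move=> sf; exact: (nice_dtD t x (sf 0%N 1%N)). Qed.

Lemma snice_dxD f t x : snice f -> hasD (f t) x (dx f t x).
Proof. by move=> sf; exact: (nice_dxD t x (sf 0%N 1%N)). Qed.

Lemma snice_dt f : snice f -> snice (dt f).
Proof. by move=> sf k n; apply: nice_dt; exact: sf. Qed.

Lemma snice_dx f : snice f -> snice (dx f).
Proof. by move=> sf k n; apply: nice_dx; exact: sf. Qed.

Lemma sniceD f g : snice f -> snice g -> snice (fun t x => f t x + g t x).
Proof. by move=> sf sg k n; exact: niceD. Qed.

Lemma bniceD f g : bnice f -> bnice g -> bnice (fun t x => f t x + g t x).
Proof. by move=> sf sg n; exact: niceD. Qed.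

Lemma bniceM f g : bnice f -> bnice g -> bnice (fun t x => f t x * g t x).
Proof. by move=> sf sg n; exact: (niceM (sf n) (sg n)). Qed.

Lemma sniceMb f g : snice f -> bnice g -> snice (fun t x => f t x * g t x).
Proof. by move=> sf sg k n; have := niceM (sf k n) (sg n); rewrite addn0. Qed.

Lemma sniceMl f g : bnice f -> snice g -> snice (fun t x => f t x * g t x).
Proof. by move=> sf sg k n; exact: (niceM (sf n) (sg k n)). Qed.

Lemma sniceM f g : snice f -> snice g -> snice (fun t x => f t x * g t x).
Proof. by move=> sf /snice_bnice; exact: sniceMb. Qed.

Lemma bnice_cst (c : R) : bnice (fun _ _ => c).
Proof. by move=> n; exact: nice_cst. Qed.

Lemma bnice_time : bnice (fun t _ => t).
Proof. by move=> n; exact: nice_time. Qed.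

Lemma sniceZ (c : R) f : snice f -> snice (fun t x => c * f t x).
Proof. by apply: sniceMl; exact: bnice_cst. Qed.

Lemma bniceZ (c : R) f : bnice f -> bnice (fun t x => c * f t x).
Proof. by apply: bniceM; exact: bnice_cst. Qed.

Lemma sniceN f : snice f -> snice (fun t x => - f t x).
Proof.
move=> sf; rewrite (_ : (fun t x => _) = (fun t x => -1 * f t x)); first exact: sniceZ.
by apply/funext => t; apply/funext => x; rewrite mulN1r.
Qed.

Lemma sniceB f g : snice f -> snice g -> snice (fun t x => f t x - g t x).
Proof. by move=> sf /sniceN; exact: sniceD. Qed.

Lemma sniceXS f n : snice f -> snice (fun t x => f t x ^+ n.+1).
Proof.
move=> sf; elim: n => [|n IH].
  by rewrite (_ : (fun t x => _) = f)//; apply/funext => t; apply/funext => x; rewrite expr1.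
rewrite (_ : (fun t x => _) = (fun t x => f t x * f t x ^+ n.+1)).
  exact: sniceM.
by apply/funext => t; apply/funext => x; rewrite exprS.
Qed.

Lemma bnice_cos f : bnice f -> bnice (fun t x => cos (f t x)).
Proof. by move=> sf n; have [] := nice_cos_sin (sf n). Qed.

Lemma bnice_sin f : bnice f -> bnice (fun t x => sin (f t x)).
Proof. by move=> sf n; have [] := nice_cos_sin (sf n). Qed.

Lemma snice_freeze f t0 : snice f -> snice (fun _ => f t0).
Proof.
move=> sf k n; elim: n f sf => [|n IH] f sf.
  split=> // T; have [C fC] := nice_jap (sf k 0%N) `|t0|.
  by exists C => t x _; exact: fC.
apply: (@niceS _ _ _ _ (fun _ _ => 0) (fun _ => dx f t0)).
- move=> T; have [C fC] := nice_jap (sf k 0%N) `|t0|.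
  by exists C => t x _; exact: fC.
- by move=> t x; exact: hasD_cst.
- by move=> t x; exact: snice_dxD.
- rewrite (_ : (fun _ _ => 0) = (fun t x => 0 * f t x)); first exact: sniceZ.
  by apply/funext => t; apply/funext => x; rewrite mul0r.
- by apply: IH; exact: snice_dx.
Qed.

(** Splitting the increment into a step in space and a step in time leaves increments of [dx f] and
    [dt f]. Bounded second derivatives make these linear in [s], so the remainder is quadratic. *)
Lemma hasD_frame f (a b : R) t x : nice 0 2 f ->
  hasD (fun t => f t (a * x + b * t)) t
    (dt f t (a * x + b * t) + b * dx f t (a * x + b * t)).
Proof.
move=> nf; set y := a * x + b * t.
have [A HA] := nice_lipschitz (`|t| + 1) (nice_dt nf).
have [B HB] := nice_lipschitz (`|t| + 1) (nice_dx nf).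
have tT : `|t| <= `|t| + 1 by rewrite lerDl.
apply: (@hasD_quad _ _ _ _ (`|A| + `|B| * (1 + `|b|) * `|b|)) => s s1.
have tsT : `|t + s| <= `|t| + 1 by rewrite (le_trans (ler_normD _ _))// lerD.
have nf1 := niceW nf.
have -> : a * x + b * (t + s) = y + b * s by rewrite /y; ring.
have [c cE fc] := hasD_MVT y (y + b * s) (fun z => nice_dxD (t + s) z nf1).
have [r rE fr] := hasD_MVT t (t + s) (fun z => nice_dtD z y nf1).
have cy : `|c - y| <= `|b| * `|s| by rewrite (le_trans cE)// addrAC subrr add0r normrM.
have rs : `|r - t| <= `|s| by rewrite (le_trans rE)// addrAC subrr add0r.
have rT : `|r| <= `|t| + 1.
  by rewrite -(subrK t r) (le_trans (ler_normD _ _))// addrC lerD// (le_trans rs).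
have -> : f (t + s) (y + b * s) - f t y - s * (dt f t y + b * dx f t y) =
   (dx f (t + s) c - dx f t y) * (b * s) + (dt f r y - dt f t y) * s.
  have -> : f (t + s) (y + b * s) - f t y =
      (f (t + s) (y + b * s) - f (t + s) y) + (f (t + s) y - f t y) by ring.
  by rewrite fc fr; ring.
rewrite (le_trans (ler_normD _ _))// !normrM -real_normK ?num_real//.
have HA' := HA r y t y rT tT; have HB' := HB (t + s) c t y tsT tT.
rewrite subrr normr0 addr0 in HA'.
rewrite addrAC subrr add0r in HB'.
have hA : `|dt f r y - dt f t y| <= `|A| * `|s|.
  apply: (le_trans HA'); apply: (@le_trans _ _ (`|A| * `|r - t|)).
    by rewrite ler_wpM2r// ler_norm.
  by rewrite ler_wpM2l.
have hB : `|dx f (t + s) c - dx f t y| <= `|B| * (1 + `|b|) * `|s|.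
  apply: (le_trans HB'); apply: (@le_trans _ _ (`|B| * (`|s| + `|c - y|))).
    by rewrite ler_wpM2r ?ler_norm// addr_ge0.
  by rewrite -mulrA ler_wpM2l// mulrDl mul1r lerD2l.
have h1 := ler_wpM2r (normr_ge0 s) hA.
have h2 := ler_wpM2r (mulr_ge0 (normr_ge0 b) (normr_ge0 s)) hB.
rewrite addrC; apply: (le_trans (lerD h1 h2)).
by rewrite le_eqVlt; apply/orP; left; apply/eqP; ring.
Qed.

(** One order of differentiability is lost because [hasD_frame] asks for two derivatives; for
    [snice] functions the loss is invisible. *)
Lemma nice_frame k n f (a b : R) : a != 0 -> nice k n.+1 f ->
  nice k n (fun t x => f t (a * x + b * t)).
Proof.
move=> a0.
have bnd f' : jap_bounded k f' -> jap_bounded k (fun t x => f' t (a * x + b * t)).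
  move=> bf T; have [C fC] := bf T.
  exists (`|C| * (1 + 2 * (1 + (b * T) ^+ 2) / a ^+ 2) ^+ k) => t x tT.
  have T0 := le_trans (normr_ge0 t) tT.
  apply: (le_trans (fC _ _ tT)); apply: (@le_trans _ _ (`|C| * jap (a * x + b * t) ^+ k)).
    by rewrite ler_wpM2r ?ler_norm// japX_ge0.
  rewrite -[leRHS]mulrA -exprMn ler_wpM2l// lerXn2r ?nnegrE ?jap_ge0//.
    apply: mulr_ge0 (jap_ge0 _).
    by rewrite addr_ge0// mulr_ge0 ?invr_ge0 ?sqr_ge0// mulr_ge0// addr_ge0 ?sqr_ge0.
  apply: (le_trans (jap_affine (b * t) x a0)); rewrite ler_wpM2r ?jap_ge0//.
  rewrite lerD2l ler_wpM2r ?invr_ge0 ?sqr_ge0// ler_wpM2l// lerD2l !exprMn.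
  rewrite ler_wpM2l ?sqr_ge0// -(real_normK (num_real t)) lerXn2r ?nnegrE//.
elim: n f => [|n IH] f nf; first by split=> //; apply: bnd; exact: nice_jap nf.
have nf1 := niceW nf.
apply: (@niceS _ _ _ _
   (fun t x => dt f t (a * x + b * t) + b * dx f t (a * x + b * t))
   (fun t x => a * dx f t (a * x + b * t))).
- by apply: bnd; exact: nice_jap nf.
- move=> t x; apply: hasD_frame; apply: (nice_weak (leq0n k)).
  by elim: n nf {IH nf1} => [//|n IH] /niceW /IH.
- move=> t x; apply: hasD_eq (hasD_comp (a := dx f t (a * x + b * t)) (b := a) _ _) _.
  + by apply: hasD_eq (hasDD (hasDZ a (hasD_id x)) (hasD_cst x (b * t))) _;
      rewrite addr0 mulr1.
  + by have := nice_dxD t (a * x + b * t) nf1.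
  + by rewrite mulrC.
- apply: niceD; first by apply: IH; exact: nice_dt.
  apply: (niceM (k := 0) (nice_cst n b)); apply: IH; exact: nice_dx.
- by apply: (niceM (k := 0) (nice_cst n a)); apply: IH; exact: nice_dx.
Qed.

Lemma snice_frame f (a b : R) : a != 0 -> snice f ->
  snice (fun t x => f t (a * x + b * t)).
Proof. by move=> a0 sf k n; exact: nice_frame. Qed.

Lemma dx_frame f (a b : R) : snice f -> dx (fun t x => f t (a * x + b * t)) =
  (fun t x => a * dx f t (a * x + b * t)).
Proof.
move=> sf; apply: dxE => t x.
apply: hasD_eq (hasD_comp (a := dx f t (a * x + b * t)) (b := a) _ _) _.
- by apply: hasD_eq (hasDD (hasDZ a (hasD_id x)) (hasD_cst x (b * t))) _;
    rewrite addr0 mulr1.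
- exact: snice_dxD.
- by rewrite mulrC.
Qed.

Lemma snice_cont f t : snice f -> continuous (f t).
Proof. by move=> sf x; exact: hasD_continuous (snice_dxD t x sf). Qed.

Lemma snice_bound f k T : snice f -> exists2 C, 0 <= C & forall t x, `|t| <= T ->
  `|f t x| <= C * jap x ^+ k.
Proof.
move=> sf; have [C fC] := nice_jap (sf k 0%N) T; exists `|C| => // t x tT.
by apply: (le_trans (fC t x tT)); rewrite ler_wpM2r ?japX_ge0// ler_norm.
Qed.

Lemma snice_decay f t : snice f -> decay (f t).
Proof.
move=> sf; split; first exact: snice_cont.
by have [C _ fC] := snice_bound 1 `|t| sf; exists C => x; exact: fC.
Qed.

Lemma snice_integ f t : snice f -> integ (f t).
Proof. by move=> sf; apply: decay_integ; exact: snice_decay. Qed.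

Lemma Int_dx0 f t : snice f -> Int (dx f t) = 0.
Proof.
move=> sf; have [C C0 fC] := snice_bound 2 `|t| (snice_dx sf).
have [D D0 fD] := snice_bound 1 `|t| sf.
apply: (@Int_deriv0 _ _ (f t) (C + D)).
- exact: snice_cont (snice_dx sf).
- by move=> x; apply: (le_trans (fC _ x (lexx _))); rewrite ler_wpM2r ?japX_ge0// lerDl.
- by move=> x; exact: snice_dxD.
- move=> x; apply: (le_trans (fD _ x (lexx _))).
  by rewrite expr1 ler_wpM2r ?jap_ge0// lerDr.
Qed.

Lemma hasD_Int_snice f t : snice f -> hasD (fun t => Int (f t)) t (Int (dt f t)).
Proof.
move=> sf; have [C C0 fC] := snice_bound 1 (`|t| + 1) (snice_dt sf).
apply: (@hasD_Int _ f (dt f) t C).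
- by move=> ?; exact: snice_integ.
- by move=> ? ?; exact: snice_dtD.
- move=> s x st; rewrite -[X in _ * X]expr1; apply: fC.
  by rewrite -(subrK t s) (le_trans (ler_normD _ _))// addrC lerD2l.
Qed.

Definition nrm (f : R -> R) : R := Num.sqrt (Int (fun x => f x ^+ 2)).

Lemma nrm_ge0 (f : R -> R) : 0 <= nrm f. Proof. exact: sqrtr_ge0. Qed.

Lemma nrm_sq (f : R -> R) : nrm f ^+ 2 = Int (fun x => f x ^+ 2).
Proof. by rewrite sqr_sqrtr//; apply: Int_ge0 => x; exact: sqr_ge0. Qed.

Lemma decay_norm (f : R -> R) : decay f -> decay (fun x => `|f x|).
Proof.
move=> [cf [C hC]]; split; last by exists C => x; rewrite normr_id.
by move=> x; apply: (@continuous_comp _ _ _ f Num.norm); [exact: cf|exact: norm_continuous].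
Qed.

Lemma nrm_norm (f : R -> R) : nrm (fun x => `|f x|) = nrm f.
Proof. by congr Num.sqrt; apply: eq_Int => x; rewrite real_normK ?num_real. Qed.

Lemma Int_norm_CS (f g : R -> R) : decay f -> decay g ->
  Int (fun x => `|f x * g x|) <= nrm f * nrm g.
Proof.
move=> df dg; rewrite -[nrm f]nrm_norm -[nrm g]nrm_norm.
rewrite -(@ler_pXn2r _ 2)// ?nnegrE ?mulr_ge0 ?nrm_ge0//; last first.
  by apply: Int_ge0 => x; exact: normr_ge0.
rewrite exprMn !nrm_sq (_ : (fun x => _) = (fun x => `|f x| * `|g x|)).
  exact: Int_CS (decay_norm df) (decay_norm dg).
by apply/funext => x; rewrite normrM.
Qed.

Lemma norm_Int_CS (f g : R -> R) : decay f -> decay g ->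
  `|Int (fun x => f x * g x)| <= nrm f * nrm g.
Proof.
move=> df dg; apply: le_trans (Int_norm_CS df dg).
by apply: Int_norm_le; apply: decay_integ; exact: decayMM.
Qed.

Lemma nrm_triangle (f g : R -> R) : decay f -> decay g ->
  nrm (fun x => f x + g x) <= nrm f + nrm g.
Proof.
move=> df dg; rewrite -(@ler_pXn2r _ 2)// ?nnegrE ?addr_ge0 ?nrm_ge0//.
rewrite nrm_sq sqrrD !nrm_sq.
have i h h' : decay h -> decay h' -> integ (fun x => h x * h' x).
  by move=> dh dh'; apply: decay_integ; exact: decayMM.
rewrite (@eq_Int _ _ (fun x => f x ^+ 2 + (2 * (f x * g x) + g x ^+ 2))); last first.
  by move=> x; ring.
have i1 : integ (fun x => f x ^+ 2) by exact: i.
have i2 : integ (fun x => g x ^+ 2) by exact: i.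
have i3 : integ (fun x => 2 * (f x * g x)) by apply: integZ; exact: i.
rewrite (IntD i1 (integD i3 i2)) (IntD i3 i2) IntZ; last exact: i.
have := le_trans (ler_norm _) (norm_Int_CS df dg); lra.
Qed.

Lemma nrm_jap (f : R -> R) C : decay f -> 0 <= C ->
  (forall x, `|f x| <= C * jap x) -> nrm f ^+ 2 <= C ^+ 2 * pi.
Proof.
move=> df C0 fC; rewrite nrm_sq.
have if2 : integ (fun x => f x ^+ 2) by apply: decay_integ; exact: (decayMM df df).
apply: (le_trans (ler_norm _)); apply: (Int_bound if2) => x.
rewrite normrX (@le_trans _ _ ((C * jap x) ^+ 2))//.
  by rewrite lerXn2r ?nnegrE ?mulr_ge0 ?jap_ge0.
by rewrite exprMn ler_wpM2l ?sqr_ge0// expr2 ler_piMr ?jap_ge0 ?jap_le1.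
Qed.

(** The square is the integral of its own derivative [2 f f'] from minus infinity; Cauchy--Schwarz
    does the rest. *)
Lemma snice_sup f t x : snice f ->
  f t x ^+ 2 <= 2 * (nrm (f t) * nrm (dx f t)).
Proof.
move=> sf; have s2 : snice (fun t x => f t x * f t x) by exact: sniceM.
have dE : dx (fun t x => f t x * f t x) = (fun t x => dx f t x * f t x + f t x * dx f t x).
  by apply: dxE => s y; apply: hasDM; exact: snice_dxD.
have [C C0 fC] := snice_bound 2 `|t| (snice_dx s2).
have [D D0 fD] := snice_bound 1 `|t| s2.
have := @norm_le_Int_deriv _ (dx (fun t x => f t x * f t x) t)
  (fun x => f t x * f t x) (C + D) x.
have cdx : continuous (dx (fun t x => f t x * f t x) t) by exact: snice_cont (snice_dx s2).
rewrite expr2 => H; apply: le_trans (ler_norm _) (le_trans (H _ _ _ _) _) => //.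
- by move=> y; apply: (le_trans (fC _ y (lexx _))); rewrite ler_wpM2r ?japX_ge0// lerDl.
- by move=> y; exact: (snice_dxD t y s2).
- move=> y; apply: (le_trans (fD _ y (lexx _))).
  by rewrite expr1 ler_wpM2r ?jap_ge0// lerDr.
rewrite dE (@eq_Int _ _ (fun y => 2 * `|f t y * dx f t y|)); last first.
  move=> y; have -> : dx f t y * f t y + f t y * dx f t y = 2 * (f t y * dx f t y) by ring.
  by rewrite normrM (@ger0_norm _ 2).
rewrite IntZ ?ler_wpM2l//.
  by apply: Int_norm_CS; apply: snice_decay => //; exact: snice_dx.
apply: decay_integ; apply: decay_norm; apply: decayMM; apply: snice_decay => //.
exact: snice_dx.
Qed.

Lemma snice_primE f t : snice f -> prim (dx f t) = f t.
Proof.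
move=> sf; have [C C0 fC] := snice_bound 2 `|t| (snice_dx sf).
have [D D0 fD] := snice_bound 1 `|t| sf.
apply: (@primE _ _ _ (C + D) 0).
- exact: snice_cont (snice_dx sf).
- by move=> x; apply: (le_trans (fC _ x (lexx _))); rewrite ler_wpM2r ?japX_ge0// lerDl.
- by move=> x; exact: snice_dxD.
- move=> x _; apply: (le_trans (fD _ x (lexx _))).
  by rewrite expr1 ler_wpM2r ?jap_ge0// lerDr.
Qed.

Lemma hasD_prim_time f t x : snice f ->
  hasD (fun t => prim (f t) x) t (prim (dt f t) x).
Proof.
move=> sf; have [C C0 fC] := snice_bound 1 (`|t| + 1) (snice_dt sf).
apply: (@hasD_set_Int _ f (dt f) _ t C) => //.
- by move=> ?; exact: snice_integ.
- by move=> ? ?; exact: snice_dtD.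
- move=> s y st; rewrite -[X in _ * X]expr1; apply: fC.
  by rewrite -(subrK t s) (le_trans (ler_normD _ _))// addrC lerD2l.
Qed.

(** Writing [f] as the primitive of [dx f] and differentiating under the integral sign exhibits
    [dt f] as the primitive of [dt (dx f)]. *)
Lemma dx_dt f : snice f -> dx (dt f) = dt (dx f).
Proof.
move=> sf; have -> : dt f = (fun t x => prim (dt (dx f) t) x).
  apply: dtE => t x; have := hasD_prim_time t x (snice_dx sf).
  by rewrite (_ : (fun t => prim (dx f t) x) = (fun t => f t x))//;
    apply/funext => s; rewrite snice_primE.
have s2 := snice_dt (snice_dx sf).
by apply: dxE => t x; apply: prim_hasD; [exact: snice_integ|exact: snice_cont].
Qed.

(** The conservation law provides the flux [g] as time derivative of the primitive, and the
    vanishing mean gives decay at plus infinity. *)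
Lemma snice_prim f g : snice f -> snice g -> dt f = dx g ->
  (forall t, Int (f t) = 0) ->
  let F := fun t x => prim (f t) x in [/\ snice F, dx F = f & dt F = g].
Proof.
move=> sf sg fg f0 F.
have Fx t x : hasD (F t) x (f t x).
  by apply: prim_hasD; [exact: snice_integ|exact: snice_cont].
have Ft t x : hasD (fun t => F t x) t (g t x).
  by have := hasD_prim_time t x sf; rewrite fg snice_primE.
split; [|exact: dxE|exact: dtE].
move=> k n.
have bF : jap_bounded k F.
  move=> T; have [C C0 fC] := snice_bound k.+1 T sf.
  exists (C * pi) => t x tT; have [x0|x0] := leP x 0.
    by apply: prim_jap => // [|y]; [exact: snice_integ|exact: fC].
  have -> : F t x = - (Int (f t) - prim (f t) x) by rewrite f0 sub0r opprK.
  rewrite normrN; apply: Int_prim_jap; [exact: snice_integ| |exact: ltW].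
  by move=> y; exact: fC.
by case: n => [|n]; [split|apply: niceS (sg k n) (sf k n)].
Qed.

End SNice.

(** * Schwartz-valued curves as functions of time and space *)

Section SchwartzNice.
Context {R : realType}.
Implicit Types (f g : R -> R -> R) (k m n : nat).

Lemma iter_dxE n f t : derive1n n (f t) = iter n (@dx R) f t.
Proof.
elim: n => [//|n IH]; rewrite derive1nS IH /=.
by apply/funext => x; rewrite dx.unlock.
Qed.

Lemma snice_iter_dx n f : snice f -> snice (iter n (@dx R) f).
Proof. by move=> sf; elim: n => [//|n IH]; exact: snice_dx. Qed.

Lemma norm_mul_jap (x : R) k : `|x| ^+ k * jap x ^+ k <= 1.
Proof.
rewrite -exprMn exprn_ile1 ?mulr_ge0 ?jap_ge0// /jap ler_pdivrMr ?ltr_pwDl ?sqr_ge0//.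
rewrite mul1r -(real_normK (num_real x)); have := sqr_ge0 (`|x| - 1).
by have := normr_ge0 x; nra.
Qed.

Lemma snice_schwartz_pred f t : snice f -> f t \in @schwartz_pred R.
Proof.
move=> sf; apply/asboolP; split=> [n x|k n].
  by rewrite iter_dxE; exact: hasD_derivable (snice_dxD t x (snice_iter_dx n sf)).
have [C C0 fC] := snice_bound k `|t| (snice_iter_dx n sf); exists C => x.
rewrite iter_dxE normrM normrX.
apply: (@le_trans _ _ (`|x| ^+ k * (C * jap x ^+ k))).
  by rewrite ler_wpM2l ?exprn_ge0//; exact: fC.
by rewrite mulrCA ler_piMr// norm_mul_jap.
Qed.

Lemma schwartz_smooth (f : schwartz R) : smooth f.
Proof. by case: f => f /= /asboolP[]. Qed.

Lemma schwartz_rapid (f : schwartz R) : rapidly_decreasing f.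
Proof. by case: f => f /= /asboolP[]. Qed.

Lemma le_schwartz_seminorm k n (f : schwartz R) x :
  `|x ^+ k * derive1n n f x| <= schwartz_seminorm k n f.
Proof.
apply: ub_le_sup; last by exists x.
by have [C fC] := schwartz_rapid f k n; exists C => _ [y _ <-].
Qed.

Lemma schwartz_seminorm_le k n (f : schwartz R) C :
  (forall x, `|x ^+ k * derive1n n f x| <= C) -> schwartz_seminorm k n f <= C.
Proof.
move=> fC; apply: ge_sup; last by move=> _ [x _ <-].
by exists `|0 ^+ k * derive1n n f 0|; exists 0.
Qed.

Lemma schwartz_seminorm_ge0 k n (f : schwartz R) : 0 <= schwartz_seminorm k n f.
Proof. exact: le_trans (normr_ge0 _) (le_schwartz_seminorm k n f 0). Qed.

Lemma derive1n_lin n (a : R) (f g : schwartz R) :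
  derive1n n (a *: f + g : schwartz R) = a *: derive1n n f + derive1n n g.
Proof. by rewrite -smooth_derive1nD//; exact: schwartz_smooth. Qed.

Lemma derive1nB n (f g : schwartz R) x :
  derive1n n (f - g : schwartz R) x = derive1n n f x - derive1n n g x.
Proof.
rewrite (_ : f - g = (-1) *: g + f); last by rewrite scaleN1r addrC.
by rewrite derive1n_lin !fctE scaleN1r addrC.
Qed.

Lemma derive1nZ n (a : R) (f : schwartz R) x :
  derive1n n (a *: f : schwartz R) x = a * derive1n n f x.
Proof.
rewrite (_ : a *: f = a *: f + 0); last by rewrite addr0.
rewrite derive1n_lin !fctE (_ : derive1n n (0 : schwartz R) = 0) ?addr0//.
exact: smooth0.
Qed.

Lemma schwartz_seminormB k n (f g : schwartz R) :
  schwartz_seminorm k n f <= schwartz_seminorm k n (f - g) + schwartz_seminorm k n g.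
Proof.
apply: schwartz_seminorm_le => x.
have -> : x ^+ k * derive1n n f x =
    x ^+ k * derive1n n (f - g) x + x ^+ k * derive1n n g x.
  by rewrite derive1nB; ring.
by rewrite (le_trans (ler_normD _ _))// lerD// le_schwartz_seminorm.
Qed.

Lemma schwartz_seminormZ k n (a : R) (f : schwartz R) : 
  schwartz_seminorm k n (a *: f) <= `|a| * schwartz_seminorm k n f.
Proof.
apply: schwartz_seminorm_le => x.
by rewrite derive1nZ mulrCA normrM ler_wpM2l// le_schwartz_seminorm.
Qed.

Lemma schwartz_derivative_hasD (u : R -> schwartz R) t v n x :
  is_schwartz_derivative u t v ->
  hasD (fun t' => derive1n n (u t') x) t (derive1n n v x).
Proof.
move=> /(_ 0%N n) uv.
have lim : (h^-1 * (derive1n n (u (h + t)) x - derive1n n (u t) x)) @[h --> 0^']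
    --> derive1n n v x.
  apply/cvgrPdist_lt => e e0.
  move/cvgrPdist_lt : uv => /(_ e e0); apply: filterS => h.
  rewrite sub0r normrN ger0_norm ?schwartz_seminorm_ge0// => he; rewrite distrC.
  apply: le_lt_trans he; rewrite (addrC h t).
  have := le_schwartz_seminorm 0 n (h^-1 *: (u (t + h) - u t) - v) x.
  by rewrite expr0 mul1r derive1nB derive1nZ derive1nB.
apply: DeriveDef.
  apply/cvg_ex; exists (derive1n n v x) => /=.
  by under eq_fun do rewrite scaler1; exact: lim.
by rewrite /derive; apply: cvg_lim => //; under eq_fun do rewrite scaler1; exact: lim.
Qed.

(** Differentiability in the Frechet topology makes each seminorm continuous along the curve, hence
    bounded on a compact interval of times. *)
Lemma schwartz_derivative_bounded (u v : R -> schwartz R) T k n :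
  (forall t, is_schwartz_derivative u t (v t)) ->
  exists C, forall t, `|t| <= T -> schwartz_seminorm k n (u t) <= C.
Proof.
move=> uv; have [T0|T0] := ltP T 0.
  by exists 0 => t tT; have := le_lt_trans (normr_ge0 t) (le_lt_trans tT T0); rewrite ltxx.
have cont : continuous (fun t => schwartz_seminorm k n (u t)).
  move=> t; apply/cvgrPdist_le => e e0.
  pose M := schwartz_seminorm k n (v t) + 1.
  have M0 : 0 < M by rewrite ltr_wpDl ?schwartz_seminorm_ge0.
  have bnd : \forall h \near 0^', schwartz_seminorm k n (u (t + h) - u t) <= `|h| * M.
    have /cvgrPdist_lt/(_ 1 ltr01) := uv t k n.
    move=> H; near=> h.
    have h0 : h != 0 by near: h; exact: nbhs_dnbhs_neq.
    have : `|0 - schwartz_seminorm k n (h^-1 *: (u (t + h) - u t) - v t)| < 1 by near: h.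
    rewrite sub0r normrN ger0_norm ?schwartz_seminorm_ge0// => h1.
    have -> : u (t + h) - u t = h *: (h^-1 *: (u (t + h) - u t)).
      by rewrite scalerA mulfV// scale1r.
    apply: (le_trans (schwartz_seminormZ _ _ _ _)); rewrite ler_wpM2l//.
    apply: (le_trans (schwartz_seminormB _ _ _ (v t))).
    by rewrite /M addrC lerD2l ltW.
  have {}bnd : \forall h \near 0, schwartz_seminorm k n (u (t + h) - u t) <= `|h| * M.
    move: bnd; rewrite near_withinE; apply: filterS => h hM.
    have [->|/hM//] := eqVneq h 0; rewrite addr0 subrr normr0 mul0r.
    have := schwartz_seminormZ k n 0 (u t).
    by rewrite scale0r normr0 mul0r.
  apply: (proj2 (nbhs0P (fun s => `|schwartz_seminorm k n (u t) -
    schwartz_seminorm k n (u s)| <= e) t)); near=> h.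
  have he : `|h| <= e / M.
    by near: h; exact: (@nbhs0_le R R _ (divr_gt0 e0 M0)).
  have hb : schwartz_seminorm k n (u (t + h) - u t) <= `|h| * M by near: h.
  have hb' : schwartz_seminorm k n (u t - u (t + h)) <= `|h| * M.
    have := schwartz_seminormZ k n (-1) (u (t + h) - u t).
    by rewrite scaleN1r opprB normrN1 mul1r => /le_trans; exact.
  have := schwartz_seminormB k n (u t) (u (t + h)).
  have := schwartz_seminormB k n (u (t + h)) (u t).
  move: he; rewrite ler_pdivlMr// ler_norml => he h1 h2.
  by apply/andP; split; lra.
have TT : - T <= T by lra.
have [c _ cmax] := EVT_max TT (continuous_subspaceT cont).
exists (schwartz_seminorm k n (u c)) => t tT; apply: cmax.
by rewrite in_itv/= -ler_norml.
Unshelve. all: by end_near. Qed.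

Lemma one_plus_expr_le (y : R) k : 0 <= y -> (1 + y) ^+ k <= 2 ^+ k * (1 + y ^+ k).
Proof.
move=> y0; have [y1|y1] := leP y 1.
  apply: (@le_trans _ _ (2 ^+ k)); first by rewrite lerXn2r ?nnegrE//; lra.
  by rewrite ler_peMr ?exprn_ge0// lerDl exprn_ge0.
apply: (@le_trans _ _ ((2 * y) ^+ k)).
  by rewrite lerXn2r ?nnegrE//; lra.
by rewrite exprMn ler_wpM2l ?exprn_ge0// lerDr.
Qed.

Lemma schwartz_jap k n (f : schwartz R) x : `|derive1n n f x| <=
  (2 ^+ k * (schwartz_seminorm 0 n f + schwartz_seminorm (2 * k) n f)) * jap x ^+ k.
Proof.
rewrite /jap exprVn ler_pdivlMr; last by rewrite exprn_gt0// ltr_pwDl ?sqr_ge0.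
rewrite mulrC; apply: le_trans (ler_wpM2r (normr_ge0 _) (one_plus_expr_le k (sqr_ge0 x))) _.
rewrite -mulrA ler_wpM2l ?exprn_ge0// mulrDl mul1r.
have := le_schwartz_seminorm 0 n f x; rewrite expr0 mul1r => h1.
have := le_schwartz_seminorm (2 * k) n f x.
by rewrite normrM exprM (ger0_norm (exprn_ge0 _ (sqr_ge0 _))) => h2; exact: lerD.
Qed.

(** The bridge from the abstract notion of solution to pointwise calculus. *)
Lemma smooth_curve_snice (u : R -> schwartz R) : smooth_curve u ->
  snice (fun t x => u t x).
Proof.
move=> [d d0 dD] k n; rewrite -d0.
(* The statement covers the time order [m] and the space order [i] at once: a time derivative raises
   [m], a space derivative raises [i]. *)
have gen m i : nice k n (fun t x => derive1n i (d m t) x).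
  elim: n m i => [|n IH] m i.
    split=> // T.
    have [A HA] := schwartz_derivative_bounded T 0 i (dD m).
    have [B HB] := schwartz_derivative_bounded T (2 * k) i (dD m).
    exists (2 ^+ k * (A + B)) => t x tT; apply: (le_trans (schwartz_jap k i (d m t) x)).
    by rewrite ler_wpM2r ?japX_ge0// ler_wpM2l ?exprn_ge0// lerD ?HA ?HB.
  apply: niceS (IH m.+1 i) (IH m i.+1).
  - exact: nice_jap (IH m i).
  - by move=> t x; apply: (@schwartz_derivative_hasD (d m)); exact: dD.
  - by move=> t x; apply: derivable_hasD; exact: schwartz_smooth.
exact: (gen 0%N 0%N).
Qed.

Lemma schwartz_snice (f : schwartz R) : snice (fun _ x => f x).
Proof.
apply: (@smooth_curve_snice (fun _ => f)).
exists (fun m _ => if m is 0%N then f else 0).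
  by [].
have cst_der (g : schwartz R) t : is_schwartz_derivative (fun _ => g) t 0.
  move=> k n; apply/cvgrPdist_le => e e0; near=> h.
  rewrite subrr scaler0 subr0.
  have := schwartz_seminormZ k n 0 g; rewrite scale0r normr0 mul0r => h0.
  by rewrite sub0r normrN ger0_norm ?schwartz_seminorm_ge0// (le_trans h0)// ltW.
by case=> [|m] t /=; exact: cst_der.
Unshelve. all: by end_near. Qed.

End SchwartzNice.

(** * KdV, mKdV and the Miura transform *)

Section Gronwall.
Context {R : realType}.

(** The differential inequality is only assumed as long as [y] stays below [B];
    the conclusion keeps it strictly below [B], which closes the bootstrap. *)
Lemma gronwall_bootstrap (y y' : R -> R) (T B K D : R) : 0 < K -> 0 <= D ->
  0 <= y 0 -> (forall t, hasD y t (y' t)) ->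
  (forall t, 0 <= t <= T -> y t <= B -> y' t <= K * y t + D) ->
  (y 0 + D / K) * expR (K * T) < B ->
  forall t, 0 <= t <= T -> y t <= (y 0 + D / K) * expR (K * T).
Proof.
move=> K0 D0 y00 yD ineq small.
have DK : 0 <= D / K by rewrite divr_ge0// ltW.
have cy t : {for t, continuous y} by exact: hasD_continuous (yD t).
(* The integrating factor makes [z] nonincreasing as long as the differential inequality is
   available. *)
pose z t := (y t + D / K) * expR (- (K * t)).
have zD t : hasD z t ((y' t - K * y t - D) * expR (- (K * t))).
  apply: hasD_eq (hasDM (hasDD (yD t) (hasD_cst t (D / K)))
    (hasD_expR (hasDN (hasDZ K (hasD_id t))))) _.
  by field; rewrite gt_eqF.
have cz : continuous z by move=> t; exact: hasD_continuous (zD t).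
have step t : 0 <= t <= T -> (forall s, 0 < s < t -> y s <= B) ->
    y t <= (y 0 + D / K) * expR (K * T).
  move=> /andP[t0 tT] sB.
  have zz : z t <= z 0.
    move: t0; rewrite le_eqVlt => /predU1P[<-//|t0].
    have [c /[!in_itv]/= /andP[c0 ct] zc] := MVT t0 (fun s _ => zD s)
      (continuous_subspaceT cz).
    rewrite -subr_le0 zc subr0 pmulr_lle0// pmulr_lle0 ?expR_gt0//.
    have := ineq c _ (sB c _); rewrite c0 ct (ltW c0) (ltW (lt_le_trans ct tT)).
    by move=> /(_ isT isT); lra.
  move: zz; rewrite /z mulr0 oppr0 expR0 mulr1 expRN ler_pdivrMr ?expR_gt0// => zz.
  apply: (@le_trans _ _ (y t + D / K)); first by rewrite lerDl.
  apply: (le_trans zz); rewrite ler_wpM2l ?addr_ge0// ler_expR.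
  by rewrite ler_pM2l.
have below t : 0 <= t <= T -> y t < B.
  move=> /andP[t0 tT]; rewrite ltNge; apply/negP => Bt.
  (* If [B] were reached, the infimum of [A] would be the first such time; [step] puts [y] strictly
     below [B] there, and by continuity slightly later too. *)
  pose A := [set s | 0 <= s <= t /\ B <= y s].
  have hA : has_inf A by split; [exists t; split; rewrite ?t0 ?lexx|exists 0 => s [/andP[]]].
  have iA0 : 0 <= inf A by apply: lb_le_inf; [case: hA|move=> s [/andP[]]].
  have iAt : inf A <= t by apply: ge_inf; [case: hA|split; rewrite ?t0 ?lexx].
  have := step (inf A); rewrite iA0 (le_trans iAt tT) => /(_ isT) H.
  have yi : y (inf A) < B.
    apply: le_lt_trans small; apply: H => s /andP[s0 si].
    rewrite leNgt; apply/negP => sB; have : inf A <= s.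
      apply: ge_inf; first by case: hA.
      by split; [rewrite (ltW s0) (le_trans (ltW si))|exact: ltW].
    by rewrite leNgt si.
  have := cy (inf A) => /cvgrPdist_lt /(_ (B - y (inf A))).
  rewrite subr_gt0 => /(_ yi) [e /= e0 eP].
  have [s [/andP[s0 st] sB] se] := inf_adherent e0 hA.
  have iAs : inf A <= s by apply: ge_inf; [case: hA|split=> //; rewrite s0].
  have := eP s; rewrite /= distrC ger0_norm ?subr_ge0// => /(_ _).
  rewrite ltrBlDl => /(_ se); rewrite ltr_norml => /andP[h _]; lra.
move=> t tT; apply: step => // s /andP[s0 st]; apply: ltW; apply: below.
by rewrite (ltW s0) (le_trans (ltW st))//; case/andP: tT.
Qed.

End Gronwall.


Ltac hasD_tac := lazymatch goal with
  | |- hasD (fun y => GRing.add (@?f y) (@?g y)) _ _ => eapply hasDD; hasD_tac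
  | |- hasD (fun y => GRing.opp (@?f y)) _ _ => eapply hasDN; hasD_tac
  | |- hasD (fun y => GRing.mul (@?f y) (@?g y)) _ _ => eapply hasDM; hasD_tac
  | |- hasD (fun _ => ?c) _ _ => eapply hasD_cst
  | |- hasD (fun y => ?f y) ?x _ =>
      match goal with H : hasD f x _ |- _ => exact H end
  | |- _ => eassumption
  end.

(** Values of unknown functions and of their derivatives become plain variables, so that a
    differential identity reaches [ring] as a polynomial one. *)
Ltac gen_atoms := cbv beta; repeat match goal with
  | |- context [@dx ?R ?f ?s ?x] => generalize (@dx R f s x)
  | |- context [@dt ?R ?f ?s ?x] => generalize (@dt R f s x)
  | |- context [?f ?s ?x] => is_var f; generalize (f s x)
  end; intros.

Ltac gring := gen_atoms; ring.
Ltac gfield := gen_atoms; field; try done.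

Ltac hasD_val := first [apply: dt_val | apply: dx_val].

Ltac hasD_ring := cbv beta; apply: hasD_eq; [by hasD_tac | gring].

(** * Conservation laws and the inversion of the Miura map *)

Section Flows.
Context {R : realType}.
Implicit Types (U w f g : R -> R -> R) (delta gam : R).

Lemma hasDX (f : R -> R) x a n : hasD f x a ->
  hasD (fun y => f y ^+ n.+1) x (n.+1%:R * f x ^+ n * a).
Proof.
move=> fa; elim: n => [|n IH].
  by rewrite expr0 !mul1r; apply: hasD_ext fa => y; rewrite expr1.
apply: (@hasD_ext _ (fun y => f y * f y ^+ n.+1)); first by move=> y; rewrite [RHS]exprS.
apply: hasD_eq (hasDM fa IH) _; rewrite exprS -[X in _ = X * _ * _]natr1; gring.
Qed.

Lemma Int_conserved f t : snice f -> (forall s, Int (dt f s) = 0) ->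
  Int (f t) = Int (f 0).
Proof.
move=> sf f0; apply: (@hasD0_const _ (fun t => Int (f t))) => s.
by rewrite -[X in hasD _ _ X](f0 s); exact: hasD_Int_snice.
Qed.

Lemma Int_exact F (f : R -> R) t : snice F -> (forall x, hasD (F t) x (f x)) ->
  Int f = 0.
Proof.
move=> sF Ff; rewrite (_ : f = dx F t); first exact: Int_dx0.
by apply/funext => x; rewrite (dx_val (Ff x)).
Qed.

(** KdV in a rescaled moving frame: the scaling contributes [delta], the velocity of the frame
    contributes [gam]. *)
Definition kdv delta gam U := forall t x, dt U t x =
  - (delta * (dx (dx (dx U)) t x + gam * dx U t x - 6 * U t x * dx U t x)).

Definition mkdv delta gam w := forall t x, dt w t x =
  - (delta * (dx (dx (dx w)) t x + gam * dx w t x - 6 * w t x ^+ 2 * dx w t x)).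

Lemma kdv_mass2 delta gam U t : snice U -> kdv delta gam U ->
  Int (fun x => U t x ^+ 2) = Int (fun x => U 0 x ^+ 2).
Proof.
move=> sU kU; have s1 := snice_dx sU; have s2 := snice_dx s1.
apply: (@Int_conserved (fun t x => U t x ^+ 2)); first exact: sniceXS.
move=> s; apply: (@Int_exact (fun t x => - (delta * (2 * (U t x * dx (dx U) t x)
  - dx U t x * dx U t x + gam * (U t x * U t x) - 4 * (U t x * (U t x * U t x))))) _ s).
  apply/sniceN/sniceZ; apply: sniceB; first apply: sniceD; first apply: sniceB.
  - by apply/sniceZ; exact: sniceM.
  - exact: sniceM.
  - by apply/sniceZ; exact: sniceM.
  - by apply/sniceZ; apply: sniceM => //; exact: sniceM.
move=> x.
have -> : dt (fun t x => U t x ^+ 2) s x = 2 * U s x * dt U s x.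
  by hasD_val; apply: hasD_eq (hasDX 1 (snice_dtD s x sU)) _; rewrite expr1.
rewrite kU.
have h0 := snice_dxD s x sU; have h1 := snice_dxD s x s1; have h2 := snice_dxD s x s2.
hasD_ring.
Qed.

Lemma kdv_energy delta gam U t : snice U -> kdv delta gam U ->
  Int (fun x => dx U t x ^+ 2 + 2 * U t x ^+ 3) =
  Int (fun x => dx U 0 x ^+ 2 + 2 * U 0 x ^+ 3).
Proof.
move=> sU kU; have s1 := snice_dx sU; have s2 := snice_dx s1.
have sV := snice_dt sU.
apply: (@Int_conserved (fun t x => dx U t x ^+ 2 + 2 * U t x ^+ 3)).
  by apply: sniceD; [exact: sniceXS|apply/sniceZ/sniceXS].
(* [M] is the variational derivative of the energy, and the equation reads [dt U = delta / 2 * dx M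
   - delta * gam * dx U]; hence the square of [M] in the flux below. *)
pose M t x := 6 * (U t x * U t x) - 2 * dx (dx U) t x.
have sM : snice M by apply: sniceB; [apply/sniceZ/sniceM|exact: sniceZ].
move=> s; apply: (@Int_exact (fun t x => 2 * (dx U t x * dt U t x) +
    delta / 4 * (M t x * M t x) -
    delta * gam * (2 * (U t x * (U t x * U t x)) - dx U t x * dx U t x)) _ s).
  apply: sniceB; first by apply: sniceD; apply: sniceZ; exact: sniceM.
  apply: sniceZ; apply: sniceB; last exact: sniceM.
  by apply: sniceZ; apply: sniceM => //; exact: sniceM.
move=> x.
have -> : dt (fun t x => dx U t x ^+ 2 + 2 * U t x ^+ 3) s x =
    2 * dx U s x * dx (dt U) s x + 6 * U s x ^+ 2 * dt U s x.
  hasD_val; rewrite dx_dt//.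
  apply: hasD_eq (hasDD (hasDX 1 (snice_dtD s x s1)) (hasDZ 2 (hasDX 2 (snice_dtD s x sU)))) _.
  gring.
have h0 := snice_dxD s x sU; have h1 := snice_dxD s x s1; have h2 := snice_dxD s x s2.
have hV := snice_dxD s x sV.
have hM : hasD (M s) x (12 * U s x * dx U s x - 2 * dx (dx (dx U)) s x).
  by rewrite /M; hasD_ring.
have VE := kU s x.
cbv beta; apply: hasD_eq; first by hasD_tac.
rewrite VE /M; gfield.
Qed.

Lemma mkdv_mass delta gam w t : snice w -> mkdv delta gam w ->
  Int (fun x => w t x ^+ 2) = Int (fun x => w 0 x ^+ 2).
Proof.
move=> sU kU; have s1 := snice_dx sU; have s2 := snice_dx s1.
apply: (@Int_conserved (fun t x => w t x ^+ 2)); first exact: sniceXS.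
have s22 : snice (fun t x => w t x * w t x) by exact: sniceM.
move=> s; apply: (@Int_exact (fun t x => - (delta * (2 * (w t x * dx (dx w) t x)
  - dx w t x * dx w t x + gam * (w t x * w t x) -
  3 * ((w t x * w t x) * (w t x * w t x))))) _ s).
  apply/sniceN/sniceZ; apply: sniceB; first apply: sniceD; first apply: sniceB.
  - by apply/sniceZ; exact: sniceM.
  - exact: sniceM.
  - exact: sniceZ.
  - by apply/sniceZ; exact: sniceM.
move=> x.
have -> : dt (fun t x => w t x ^+ 2) s x = 2 * w s x * dt w s x.
  by hasD_val; apply: hasD_eq (hasDX 1 (snice_dtD s x sU)) _; rewrite expr1.
rewrite kU.
have h0 := snice_dxD s x sU; have h1 := snice_dxD s x s1; have h2 := snice_dxD s x s2.
hasD_ring.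
Qed.

(** Both signs of the Miura transform of one datum are evolved by KdV; half
    their difference is the derivative of a function [w], and [e], the failure
    of [w ^ 2] to be half their sum, solves a linear equation. *)
Lemma inverse_miura delta gam (Up Um : R -> R -> R) (w0 : R -> R) :
  0 <= delta ->
  snice Up -> snice Um -> kdv delta gam Up -> kdv delta gam Um ->
  snice (fun _ => w0) ->
  (forall x, Up 0 x = w0 x ^+ 2 + derive1 w0 x) ->
  (forall x, Um 0 x = w0 x ^+ 2 - derive1 w0 x) ->
  exists w, [/\ snice w, w 0 = w0, mkdv delta gam w &
    forall t x, Up t x = dx w t x + w t x ^+ 2].
Proof.
move=> delta0 sp sm kp km sw0 p0 m0.
pose d t x := 2^-1 * (Up t x - Um t x); pose m t x := 2^-1 * (Up t x + Um t x).
have sd : snice d by apply: sniceZ; exact: sniceB.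
have sM : snice m by apply: sniceZ; exact: sniceD.
have dxd : dx d = fun t x => 2^-1 * (dx Up t x - dx Um t x).
  by apply: dxE => t x; apply/hasDZ/hasDB; exact: snice_dxD.
have dxm : dx m = fun t x => 2^-1 * (dx Up t x + dx Um t x).
  by apply: dxE => t x; apply/hasDZ/hasDD; exact: snice_dxD.
have s1p := snice_dx sp; have s1m := snice_dx sm.
have dxxd : dx (dx d) = fun t x => 2^-1 * (dx (dx Up) t x - dx (dx Um) t x).
  by rewrite dxd; apply: dxE => t x; apply/hasDZ/hasDB; exact: snice_dxD.
have dxxm : dx (dx m) = fun t x => 2^-1 * (dx (dx Up) t x + dx (dx Um) t x).
  by rewrite dxm; apply: dxE => t x; apply/hasDZ/hasDD; exact: snice_dxD.
have s2p := snice_dx s1p; have s2m := snice_dx s1m.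
have dxxxd : dx (dx (dx d)) = fun t x => 2^-1 * (dx (dx (dx Up)) t x - dx (dx (dx Um)) t x).
  by rewrite dxxd; apply: dxE => t x; apply/hasDZ/hasDB; exact: snice_dxD.
have dxxxm : dx (dx (dx m)) = fun t x => 2^-1 * (dx (dx (dx Up)) t x + dx (dx (dx Um)) t x).
  by rewrite dxxm; apply: dxE => t x; apply/hasDZ/hasDD; exact: snice_dxD.
have dtd t x : dt d t x = - (delta * (dx (dx (dx d)) t x + gam * dx d t x -
    6 * (dx m t x * d t x + m t x * dx d t x))).
  have -> : dt d t x = 2^-1 * (dt Up t x - dt Um t x).
    by hasD_val; apply/hasDZ/hasDB; exact: snice_dtD.
  rewrite kp km dxxxd dxd dxm /d /m; gfield.
have dtm t x : dt m t x = - (delta * (dx (dx (dx m)) t x + gam * dx m t x -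
    6 * (m t x * dx m t x + d t x * dx d t x))).
  have -> : dt m t x = 2^-1 * (dt Up t x + dt Um t x).
    by hasD_val; apply/hasDZ/hasDD; exact: snice_dtD.
  rewrite kp km dxxxm dxd dxm /d /m; gfield.
(* The flux of [d]: it will be the time derivative of [w], the primitive of [d] in space. *)
pose G t x := - (delta * (dx (dx d) t x + gam * d t x - 6 * (m t x * d t x))).
have sd1 := snice_dx sd; have sd2 := snice_dx sd1.
have sG : snice G.
  apply/sniceN/sniceZ; apply: sniceB; first by apply: sniceD => //; exact: sniceZ.
  by apply/sniceZ; exact: sniceM.
have dG : dt d = dx G.
  apply/esym/dxE => t x; rewrite dtd.
  have h0 := snice_dxD t x sd; have h1 := snice_dxD t x sd1; have h2 := snice_dxD t x sd2.
  have hm := snice_dxD t x sM.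
  by rewrite /G; hasD_ring.
have d0E : d 0 = derive1 w0 by apply/funext => x; rewrite /d p0 m0; gfield.
have d_int t : Int (d t) = 0.
  rewrite (Int_conserved t sd) => [|s]; last by rewrite dG Int_dx0.
  by rewrite d0E -[RHS](Int_dx0 0 sw0) dx.unlock.
have [sw wx wt] := snice_prim sd sG dG d_int.
set w := fun t x => prim (d t) x in sw wx wt.
pose e t x := m t x - w t x * w t x.
have se : snice e by apply: sniceB => //; exact: sniceM.
have w00 : w 0 = w0.
  by rewrite /w d0E -[RHS](snice_primE 0 sw0) dx.unlock.
have sw1 := snice_dx sw.
have dxe : dx e = fun t x => dx m t x - 2 * (w t x * d t x).
  apply: dxE => t x; have h0 := snice_dxD t x sw; have hm := snice_dxD t x sM.
  by rewrite /e; cbv beta; apply: hasD_eq; [by hasD_tac|rewrite wx; gring].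
have dxxe : dx (dx e) = fun t x => dx (dx m) t x - 2 * (d t x * d t x + w t x * dx d t x).
  have sm1 := snice_dx sM.
  rewrite dxe; apply: dxE => t x; have h0 := snice_dxD t x sw.
  have hm := snice_dxD t x sm1; have hd := snice_dxD t x sd.
  by cbv beta; apply: hasD_eq; [by hasD_tac|rewrite wx; gring].
have dxxxe : dx (dx (dx e)) = fun t x => dx (dx (dx m)) t x -
    2 * (3 * (d t x * dx d t x) + w t x * dx (dx d) t x).
  have sm2 := snice_dx (snice_dx sM).
  rewrite dxxe; apply: dxE => t x; have h0 := snice_dxD t x sw.
  have hm := snice_dxD t x sm2; have hd := snice_dxD t x sd.
  have hd1 := snice_dxD t x sd1.
  by cbv beta; apply: hasD_eq; [by hasD_tac|rewrite wx; gring].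
(* All source terms cancel, so [e] solves a homogeneous linear equation with coefficient [m]; it
   starts from [0]. *)
have dte t x : dt e t x = - (delta * (dx (dx (dx e)) t x + gam * dx e t x -
    6 * m t x * dx e t x)).
  have -> : dt e t x = dt m t x - (dt w t x * w t x + w t x * dt w t x).
    by hasD_val; apply: hasDB; [|apply: hasDM]; exact: snice_dtD.
  by rewrite dtm wt /G dxxxe dxe; gring.
have e00 x : e 0 x = 0 by rewrite /e w00 /m p0 m0; gfield.
have e0 t x : e t x = 0.
  have [C C0 mC] := snice_bound 0 `|t| (snice_dx sM).
  have s2e : snice (fun t x => e t x * e t x) by exact: sniceM.
  pose y t := Int (fun x => e t x * e t x).
  pose K := 6 * delta * C + 1.
  have K0 : 0 < K by rewrite ltr_wpDl// !mulr_ge0.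
  have yD s : hasD y s (Int (dt (fun t x => e t x * e t x) s)).
    exact: hasD_Int_snice s2e.
  have y0 : y 0 = 0.
    rewrite /y (_ : (fun x => _) = fun x => 0 * e 0 x); last first.
      by apply/funext => z; rewrite e00 mulr0.
    by rewrite IntZ ?mul0r//; exact: snice_integ.
  have yge s : 0 <= y s by apply: Int_ge0 => z; rewrite -expr2 sqr_ge0.
  have ineq s : `|s| <= `|t| ->
      `|Int (dt (fun t x => e t x * e t x) s)| <= K * y s.
    move=> st.
    have se1 := snice_dx se; have se2 := snice_dx se1.
    (* Up to the exact derivative [dx F], only [dx m * e ^ 2] survives in the derivative of [e ^ 2],
       and [dx m] is bounded on the time interval. *)
    pose F t x := - (delta * (2 * (e t x * dx (dx e) t x) - dx e t x * dx e t x
      + gam * (e t x * e t x) - 6 * (m t x * (e t x * e t x)))).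
    have sF : snice F.
      apply/sniceN/sniceZ; apply: sniceB; first apply: sniceD; first apply: sniceB.
      - by apply/sniceZ; exact: sniceM.
      - exact: sniceM.
      - by apply/sniceZ.
      - by apply/sniceZ; exact: sniceM.
    have sr : snice (fun t x => - (6 * delta) * (dx m t x * (e t x * e t x))).
      by apply/sniceZ; apply: sniceM => //; exact: snice_dx.
    have -> : dt (fun t x => e t x * e t x) s = fun x =>
        dx F s x + (- (6 * delta) * (dx m s x * (e s x * e s x))).
      apply/funext => z.
      have -> : dt (fun t x => e t x * e t x) s z = dt e s z * e s z + e s z * dt e s z.
        by hasD_val; apply: hasDM; exact: snice_dtD.
      have -> : dx F s z = - (delta * (2 * (e s z * dx (dx (dx e)) s z)
          + gam * (2 * e s z * dx e s z) -
          6 * (dx m s z * (e s z * e s z) + m s z * (2 * e s z * dx e s z)))).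
        hasD_val.
        have h0 := snice_dxD s z se; have h1 := snice_dxD s z se1.
        have h2 := snice_dxD s z se2; have hm := snice_dxD s z sM.
        by rewrite /F; hasD_ring.
      by rewrite dte; gring.
    rewrite IntD; [|exact: snice_integ (snice_dx sF)|exact: snice_integ sr].
    rewrite Int_dx0// add0r /y -IntZ; last exact: snice_integ s2e.
    apply: (le_trans (Int_norm_le (snice_integ s sr))).
    apply: Int_le; [exact: integ_norm (snice_integ s sr)|exact: (snice_integ s (sniceZ K s2e))|].
    move=> z; rewrite mulrA normrM (@ger0_norm _ (e s z * e s z)); last first.
      by rewrite -expr2 sqr_ge0.
    rewrite ler_wpM2r -?expr2 ?sqr_ge0// normrM normrN (@ger0_norm _ (6 * delta)) ?mulr_ge0//.
    apply: (@le_trans _ _ (6 * delta * C)); last by rewrite /K lerDl.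
    rewrite ler_wpM2l ?mulr_ge0//.
    by have := mC s z st; rewrite expr0 mulr1.
  (* [c] is the sign of [t]: reversing time lets the forward Gronwall inequality serve both
     directions. *)
  have key (c : R) : `|c| = 1 -> c * `|t| = t -> y t <= 0.
    move=> c1 ct.
    have YD s : hasD (fun s => y (c * s)) s (Int (dt (fun t x => e t x * e t x) (c * s)) * c).
      apply: hasD_comp (yD (c * s)).
      by apply: hasD_eq (hasDZ c (hasD_id s)) _; rewrite mulr1.
    have Yineq s : 0 <= s <= `|t| -> y (c * s) <= 1 ->
        Int (dt (fun t x => e t x * e t x) (c * s)) * c <= K * y (c * s) + 0.
      move=> /andP[s0 st] _; rewrite addr0; apply: (le_trans (ler_norm _)).
      rewrite normrM c1 mulr1; apply: ineq.
      by rewrite normrM c1 mul1r (ger0_norm s0).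
    have := @gronwall_bootstrap _ (fun s => y (c * s)) _ `|t| 1 K 0 K0 (lexx _) _ YD Yineq.
    rewrite mulr0 y0 mul0r add0r mul0r ltr01 lexx => /(_ isT isT `|t|).
    by rewrite normr_ge0 lexx ct => /(_ isT).
  have yt : y t <= 0.
    have [t0|t0] := leP 0 t; first by apply: (key 1); rewrite ?normr1// mul1r ger0_norm.
    by apply: (key (-1)); rewrite ?normrN1// mulN1r ltr0_norm// opprK.
  have yt0 : y t = 0 by apply/eqP; rewrite eq_le yt yge.
  have n0 : nrm (e t) = 0.
    by rewrite /nrm (_ : Int _ = 0) ?sqrtr0// -[RHS]yt0; apply: eq_Int => z; rewrite expr2.
  have := snice_sup t x se; rewrite n0 mul0r mulr0 => h.
  by apply/eqP; rewrite -sqrf_eq0 eq_le h sqr_ge0.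
have mw t x : m t x = w t x ^+ 2.
  by have := e0 t x; rewrite /e expr2 => /eqP; rewrite subr_eq0 => /eqP.
exists w; split=> // t x; first by rewrite wt wx /G mw; gring.
by rewrite wx -mw /d /m; gfield.
Qed.

End Flows.

Ltac snice_tac := repeat first
  [ eassumption | apply: snice_dx | apply: sniceD | apply: sniceB | apply: sniceN
  | apply: sniceZ | apply: sniceXS | apply: sniceM ].

(** * Energy bounds and stability of the modulated wave *)

Section Stability.
Context {R : realType}.
Implicit Types (U w f g z V : R -> R -> R) (delta gam kap : R).

(** The part of [f] that is not a wave of wave number [kap]. *)
Definition osc kap f t x := dx (dx f) t x + kap ^+ 2 * f t x.

Lemma snice_osc kap f : snice f -> snice (osc kap f).
Proof. by move=> sf; rewrite /osc; snice_tac. Qed.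

Lemma oscB kap f g : snice f -> snice g ->
  osc kap (fun t x => f t x - g t x) = fun t x => osc kap f t x - osc kap g t x.
Proof.
move=> sf sg; have sf1 := snice_dx sf; have sg1 := snice_dx sg.
have d1 : dx (fun t x => f t x - g t x) = fun t x => dx f t x - dx g t x.
  by apply: dxE => t x; apply: hasDB; exact: snice_dxD.
have d2 : dx (fun t x => dx f t x - dx g t x) = fun t x => dx (dx f) t x - dx (dx g) t x.
  by apply: dxE => t x; apply: hasDB; exact: snice_dxD.
by rewrite /osc d1 d2; apply/funext => t; apply/funext => x; gring.
Qed.

Lemma oscZ kap (c : R) f : snice f ->
  osc kap (fun t x => c * f t x) = fun t x => c * osc kap f t x.
Proof.
move=> sf; have sf1 := snice_dx sf.
have d1 : dx (fun t x => c * f t x) = fun t x => c * dx f t x.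
  by apply: dxE => t x; apply: hasDZ; exact: snice_dxD.
have d2 : dx (fun t x => c * dx f t x) = fun t x => c * dx (dx f) t x.
  by apply: dxE => t x; apply: hasDZ; exact: snice_dxD.
by rewrite /osc d1 d2; apply/funext => t; apply/funext => x; gring.
Qed.

(** The derivative of the wave energy [z' ^ 2 + kap ^ 2 z ^ 2] is [2 z' (z'' + kap ^ 2 z)]. For a
    wave of number [kap] with a slow envelope this improves on [snice_sup] by about one factor
    [kap]. *)
Lemma osc_sup kap z t x : snice z ->
  kap ^+ 2 * z t x ^+ 2 <= 2 * (nrm (dx z t) * nrm (osc kap z t)).
Proof.
move=> sz; have sz1 := snice_dx sz; have so := snice_osc kap sz.
pose e t x := dx z t x * dx z t x + kap ^+ 2 * (z t x * z t x).
have se : snice e by rewrite /e; snice_tac.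
have eE : dx e = fun t x => 2 * (dx z t x * osc kap z t x).
  apply: dxE => s y; have h0 := snice_dxD s y sz; have h1 := snice_dxD s y sz1.
  by rewrite /e /osc; hasD_ring.
have [C C0 fC] := snice_bound 2 `|t| (snice_dx se).
have [D D0 fD] := snice_bound 1 `|t| se.
have H := @norm_le_Int_deriv _ (dx e t) (e t) (C + D) x.
apply: (@le_trans _ _ `|e t x|).
  rewrite /e -!expr2; apply: le_trans (ler_norm _).
  by rewrite lerDr sqr_ge0.
apply: (le_trans (H _ _ _ _)).
- exact: snice_cont (snice_dx se).
- by move=> y; apply: (le_trans (fC _ y (lexx _))); rewrite ler_wpM2r ?japX_ge0// lerDl.
- by move=> y; exact: snice_dxD.
- move=> y; apply: (le_trans (fD _ y (lexx _))).
  by rewrite expr1 ler_wpM2r ?jap_ge0// lerDr.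
have dz : decay (dx z t) by exact: snice_decay.
have do' : decay (osc kap z t) by exact: snice_decay.
rewrite eE (@eq_Int _ _ (fun y => 2 * `|dx z t y * osc kap z t y|)); last first.
  by move=> y; rewrite normrM (@ger0_norm _ 2).
rewrite IntZ ?ler_wpM2l//; first exact: Int_norm_CS.
by apply: decay_integ; apply: decay_norm; exact: decayMM.
Qed.

(** By parts, the square of the left side is [kap ^ 2 * nrm z ^ 2] minus the integral of
    [z * osc kap z], which Cauchy--Schwarz controls. *)
Lemma nrm_dx_osc kap z t : snice z -> 0 <= kap ->
  nrm (dx z t) <= kap * nrm (z t) + Num.sqrt (nrm (z t) * nrm (osc kap z t)).
Proof.
move=> sz k0; have sz1 := snice_dx sz; have so := snice_osc kap sz.
have dz : decay (z t) by exact: snice_decay.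
have do' : decay (osc kap z t) by exact: snice_decay.
have szz : snice (fun t x => z t x * dx z t x) by snice_tac.
have szo : snice (fun t x => z t x * osc kap z t x) by snice_tac.
have sz2 : snice (fun t x => z t x ^+ 2) by snice_tac.
have E : Int (fun x => dx z t x ^+ 2) =
    kap ^+ 2 * nrm (z t) ^+ 2 - Int (fun x => z t x * osc kap z t x).
  rewrite nrm_sq -IntZ; last exact: (snice_integ t sz2).
  rewrite -IntB; [|exact: (snice_integ t (sniceZ _ sz2))|exact: (snice_integ t szo)].
  rewrite -[RHS]addr0 -[X in _ = _ + X](Int_dx0 t szz) -IntD; first last.
  - exact: snice_integ (snice_dx szz).
  - exact: (snice_integ t (sniceB (sniceZ _ sz2) szo)).
  apply: eq_Int => x.
  have h0 := snice_dxD t x sz; have h1 := snice_dxD t x sz1.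
  have -> : dx (fun t x => z t x * dx z t x) t x = dx z t x ^+ 2 + z t x * dx (dx z) t x.
    by hasD_val; hasD_ring.
  by rewrite /osc; gring.
have n0 := nrm_ge0 (z t); have m0 := nrm_ge0 (osc kap z t).
rewrite -(@ler_pXn2r _ 2)// ?nnegrE ?nrm_ge0 ?addr_ge0 ?sqrtr_ge0 ?mulr_ge0//.
rewrite nrm_sq E sqrrD exprMn (sqr_sqrtr (mulr_ge0 n0 m0)).
have := norm_Int_CS dz do'; rewrite ler_norml => /andP[lo _].
have : 0 <= kap * nrm (z t) * Num.sqrt (nrm (z t) * nrm (osc kap z t)).
  by rewrite !mulr_ge0// sqrtr_ge0.
by lra.
Qed.

(** The conserved quantity is the KdV energy, minus [2 kap ^ 2] times the integral of [U ^ 2], plus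
    [kap ^ 4] times the integral of [w ^ 2]. Its quadratic part is the square of [osc kap w], and
    the smallness of [w] makes the remaining negative quartic term harmless. *)
Lemma miura_osc_bound delta gam kap U w t : snice w -> snice U ->
  mkdv delta gam w -> kdv delta gam U ->
  (forall t x, U t x = dx w t x + w t x ^+ 2) ->
  (forall x, w t x ^+ 2 <= kap ^+ 2 / 4) ->
  nrm (osc kap w t) ^+ 2 <= 2 * Int (fun x => osc kap w 0 x ^+ 2 +
    10 * (w 0 x ^+ 2 * dx w 0 x ^+ 2) + 2 * w 0 x ^+ 6).
Proof.
move=> sw sU kw kU UE small.
have sw1 := snice_dx sw; have sw2 := snice_dx sw1; have so := snice_osc kap sw.
have sU1 := snice_dx sU.
have U1 : dx U = fun t x => dx (dx w) t x + 2 * (w t x * dx w t x).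
  have -> : U = fun t x => dx w t x + w t x * w t x.
    by apply/funext => s; apply/funext => x; rewrite UE expr2.
  apply: dxE => s x; have h0 := snice_dxD s x sw; have h1 := snice_dxD s x sw1.
  by hasD_ring.
pose j t x := osc kap w t x ^+ 2 + 10 * (w t x ^+ 2 * dx w t x ^+ 2) +
  2 * w t x ^+ 6 - 2 * kap ^+ 2 * w t x ^+ 4.
have sj : snice j by rewrite /j; snice_tac.
have s5 (c : R) n : snice (fun t x => c * w t x ^+ n.+1) by snice_tac.
have jE s : Int (j s) = Int (fun x => dx U s x ^+ 2 + 2 * U s x ^+ 3)
   - 2 * kap ^+ 2 * Int (fun x => U s x ^+ 2) + kap ^+ 4 * Int (fun x => w s x ^+ 2).
  have i1 : snice (fun t x => dx U t x ^+ 2 + 2 * U t x ^+ 3) by snice_tac.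
  have i2 : snice (fun t x => U t x ^+ 2) by snice_tac.
  have i3 : snice (fun t x => w t x ^+ 2) by snice_tac.
  rewrite -!IntZ; [|exact: (snice_integ s i3)|exact: (snice_integ s i2)].
  have i4 := sniceZ (2 * kap ^+ 2) i2; have i5 := sniceZ (kap ^+ 4) i3.
  rewrite -IntB; [|exact: (snice_integ s i1)|exact: (snice_integ s i4)].
  rewrite -IntD; [|exact: (snice_integ s (sniceB i1 i4))|exact: (snice_integ s i5)].
  pose F t x := - (2 * (w t x * (dx w t x * dx w t x)) + 6 / 5 * w t x ^+ 5)
     + 2 * kap ^+ 2 * (2 / 3 * w t x ^+ 3) + 2 * kap ^+ 2 * (w t x * dx w t x).
  have sF : snice F by rewrite /F; snice_tac.
  rewrite -[RHS]addr0 -[X in _ = _ + X](Int_dx0 s sF) -IntD; first last.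
  - exact: snice_integ (snice_dx sF).
  - exact: (snice_integ s (sniceD (sniceB i1 i4) i5)).
  apply: eq_Int => x.
  have h0 := snice_dxD s x sw; have h1 := snice_dxD s x sw1.
  have h5 := hasDX 4 h0; have h3 := hasDX 2 h0.
  have -> : dx F s x = - (2 * (dx w s x ^+ 3 + 2 * (w s x * dx w s x * dx (dx w) s x))
     + 6 * w s x ^+ 4 * dx w s x) + 4 * kap ^+ 2 * w s x ^+ 2 * dx w s x
     + 2 * kap ^+ 2 * (dx w s x ^+ 2 + w s x * dx (dx w) s x).
    by hasD_val; rewrite /F; apply: hasD_eq; [by hasD_tac|cbv beta; gfield].
  by rewrite U1 UE /j /osc; gring.
have jc : Int (j t) = Int (j 0).
  by rewrite !jE (kdv_energy t sU kU) (kdv_mass2 t sU kU) (mkdv_mass t sw kw).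
have sF : snice (fun t x => w t x ^+ 3 * dx w t x) by snice_tac.
have sg2 : snice (fun t x => osc kap w t x ^+ 2) by snice_tac.
have lower : nrm (osc kap w t) ^+ 2 <= 2 * Int (j t).
  (* The coefficient [10 / 3] trades [10 w ^ 2 w' ^ 2] for a multiple of [w ^ 3 w'']. The latter
     contains [10 / 3 * kap ^ 2 * w ^ 4], which outweighs the term [- 2 kap ^ 2 w ^ 4] of [j]. *)
  have -> : Int (j t) = Int (fun x => j t x - 10 / 3 * dx (fun t x => w t x ^+ 3 * dx w t x) t x).
    have sF' := sniceZ (10 / 3) (snice_dx sF).
    rewrite [RHS]IntB; [|exact: (snice_integ t sj)|exact: (snice_integ t sF')].
    rewrite IntZ; last exact: (snice_integ t (snice_dx sF)).
    by rewrite Int_dx0// mulr0 subr0.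
  have sj' : snice (fun t x => j t x - 10 / 3 * dx (fun t x => w t x ^+ 3 * dx w t x) t x).
    by snice_tac.
  rewrite nrm_sq -IntZ; last exact: (snice_integ t sj').
  apply: Int_le; [exact: (snice_integ t sg2)|exact: (snice_integ t (sniceZ 2 sj'))|].
  move=> x; have h0 := snice_dxD t x sw; have h1 := snice_dxD t x sw1.
  have h3 := hasDX 2 h0.
  have -> : dx (fun t x => w t x ^+ 3 * dx w t x) t x =
      3 * w t x ^+ 2 * dx w t x ^+ 2 + w t x ^+ 3 * (osc kap w t x - kap ^+ 2 * w t x).
    by hasD_val; rewrite /osc; hasD_ring.
  rewrite /j; set g := osc kap w t x; set a := w t x; set b := dx w t x.
  have sm := small x; rewrite -/a in sm.
  (* Completion of the square in [g]; the rest is nonnegative because [a ^ 2 <= kap ^ 2 / 4]. *)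
  rewrite -subr_ge0 (_ : _ - _ = (g - 20 / 3 * a ^+ 3 / 2 * 1) ^+ 2 * 1 +
    a ^+ 4 * (8 / 3 * kap ^+ 2 - (100 / 9 - 4) * a ^+ 2)); last by gfield.
  rewrite addr_ge0// ?mulr1 ?sqr_ge0// mulr_ge0//.
    by rewrite (_ : a ^+ 4 = (a ^+ 2) ^+ 2) ?sqr_ge0// -exprM.
  by have := sqr_ge0 kap; have := sqr_ge0 a; lra.
apply: (le_trans lower); rewrite jc ler_wpM2l//.
have sj0 : snice (fun t x => osc kap w t x ^+ 2 +
    10 * (w t x ^+ 2 * dx w t x ^+ 2) + 2 * w t x ^+ 6) by snice_tac.
apply: Int_le; [exact: (snice_integ 0 sj)|exact: (snice_integ 0 sj0)|].
move=> x; rewrite /j gerBl -mulrA mulr_ge0// mulr_ge0 ?sqr_ge0//.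
by rewrite (_ : w 0 x ^+ 4 = (w 0 x ^+ 2) ^+ 2) ?sqr_ge0// -exprM.
Qed.

(** The cross term [2 w ^ 2 w'] of [U ^ 2] is an exact derivative, so conservation of the integral
    of [U ^ 2] controls [w']. *)
Lemma miura_dx_bound delta gam U w t : snice w -> snice U -> kdv delta gam U ->
  (forall t x, U t x = dx w t x + w t x ^+ 2) ->
  nrm (dx w t) ^+ 2 <= Int (fun x => dx w 0 x ^+ 2 + w 0 x ^+ 4).
Proof.
move=> sw sU kU UE; have sw1 := snice_dx sw.
have s2 : snice (fun t x => dx w t x ^+ 2 + w t x ^+ 4) by snice_tac.
have sd : snice (fun t x => dx w t x ^+ 2) by snice_tac.
have E s : Int (fun x => U s x ^+ 2) = Int (fun x => dx w s x ^+ 2 + w s x ^+ 4).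
  have sF : snice (fun t x => 2 / 3 * w t x ^+ 3) by snice_tac.
  rewrite -[RHS]addr0 -[X in _ = _ + X](Int_dx0 s sF) -IntD; first last.
  - exact: snice_integ (snice_dx sF).
  - exact: (snice_integ s s2).
  apply: eq_Int => x; have h3 := hasDX 2 (snice_dxD s x sw).
  have -> : dx (fun t x => 2 / 3 * w t x ^+ 3) s x = 2 * w s x ^+ 2 * dx w s x.
    by hasD_val; apply: hasD_eq (hasDZ (2 / 3) h3) _; gfield.
  by rewrite UE; gring.
rewrite -E -(kdv_mass2 t sU kU) E nrm_sq.
apply: Int_le; [exact: (snice_integ t sd)|exact: (snice_integ t s2)|].
move=> x; rewrite lerDl (_ : w t x ^+ 4 = (w t x ^+ 2) ^+ 2) ?sqr_ge0// -exprM//.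
Qed.

(** [E] is the error with which [Va] solves the equation of [V].  The last
    hypothesis closes the bootstrap that keeps the sup norm of [V - Va] below
    [1], so that the cubic term costs no more than the quadratic one. *)
Lemma stability delta gam kap beta C e G V Va E : 0 < kap -> 0 < beta -> 0 < e ->
  0 <= C -> 0 <= G ->
  snice V -> snice Va -> snice E ->
  (forall t x, dt V t x = - (delta * (dx (dx (dx V)) t x + gam * dx V t x)) +
     4 * beta / kap * (V t x ^+ 2 * dx V t x)) ->
  (forall t x, dt Va t x = - (delta * (dx (dx (dx Va)) t x + gam * dx Va t x)) +
     4 * beta / kap * (Va t x ^+ 2 * dx Va t x) + E t x) ->
  (forall x, V 0 x = Va 0 x) ->
  (forall t x, 0 <= t <= 1 -> `|Va t x| <= C) ->
  (forall t x, 0 <= t <= 1 -> `|dx Va t x| <= C * kap) ->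
  (forall t, 0 <= t <= 1 -> nrm (E t) <= e) ->
  (forall t, 0 <= t <= 1 -> nrm (osc kap (fun t x => V t x - Va t x) t) <= G) ->
  let K := 8 * beta * (C ^+ 2 + C) + 2 in
  let zeta := e * expR (K / 2) in
  2 * ((kap * zeta + Num.sqrt (zeta * G)) * G) <= kap ^+ 2 ->
  forall t, 0 <= t <= 1 -> nrm (fun x => V t x - Va t x) <= zeta.
Proof.
move=> k0 b0 e0 C0 G0 sV sVa sE eV eVa V0 bVa bVa1 bE bG K zeta small.
pose z t x := V t x - Va t x.
have sz : snice z by exact: sniceB.
have szz : snice (fun t x => z t x * z t x) by exact: sniceM.
have sV1 := snice_dx sV; have sa1 := snice_dx sVa.
have sV2 := snice_dx sV1; have sa2 := snice_dx sa1.
have sV3 := snice_dx sV2; have sa3 := snice_dx sa2.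
have sz1 := snice_dx sz; have sz2 := snice_dx sz1.
have z1 : dx z = fun t x => dx V t x - dx Va t x.
  by apply: dxE => t x; apply: hasDB; exact: snice_dxD.
have z2 : dx (dx z) = fun t x => dx (dx V) t x - dx (dx Va) t x.
  by rewrite z1; apply: dxE => t x; apply: hasDB; exact: snice_dxD.
have z3 : dx (dx (dx z)) = fun t x => dx (dx (dx V)) t x - dx (dx (dx Va)) t x.
  by rewrite z2; apply: dxE => t x; apply: hasDB; exact: snice_dxD.
have dtz t x : dt z t x = dt V t x - dt Va t x.
  by hasD_val; apply: hasDB; exact: snice_dtD.
have K0 : 0 < K by rewrite /K; have := mulr_ge0 (ltW b0) (addr_ge0 (sqr_ge0 C) C0); lra.
(* With [K > 1] the outcome of Gronwall is strictly below [zeta ^ 2], as the bootstrap requires. *)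
have K1 : 1 < K by rewrite /K; have := mulr_ge0 (ltW b0) (addr_ge0 (sqr_ge0 C) C0); lra.
pose y t := Int (fun x => z t x * z t x).
have yE t : y t = nrm (z t) ^+ 2 by rewrite nrm_sq; apply: eq_Int => x; rewrite expr2.
have yD t : hasD y t (Int (dt (fun t x => z t x * z t x) t)).
  exact: hasD_Int_snice szz.
have y0 : y 0 = 0.
  rewrite /y (_ : (fun x => _) = fun x => 0 * z 0 x); last first.
    by apply/funext => x; rewrite /z V0 subrr mulr0.
  by rewrite IntZ ?mul0r//; exact: (snice_integ 0 sz).
have zeta0 : 0 < zeta by rewrite mulr_gt0 ?expR_gt0.
have zeta2 : zeta ^+ 2 = e ^+ 2 * expR (K * 1).
  by rewrite /zeta exprMn -expRM_natl; congr (_ * expR _); gfield.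
(* While [z] is small in [L ^ 2], the bound [G] on its [osc] part and the hypothesis [small] turn
   this into a sup bound. *)
have zsup t x : 0 <= t <= 1 -> y t <= zeta ^+ 2 -> `|z t x| <= 1.
  move=> t01; rewrite yE => zn2.
  have zn : nrm (z t) <= zeta.
    by rewrite -(@ler_pXn2r _ 2)// ?nnegrE ?nrm_ge0// ltW.
  have zG : nrm (osc kap z t) <= G by exact: bG.
  suff : z t x ^+ 2 <= 1.
    rewrite -(real_normK (num_real (z t x))) => zsq.
    by have := normr_ge0 (z t x); nra.
  rewrite -(ler_pM2l (exprn_gt0 2 k0)) mulr1.
  apply: (le_trans (osc_sup kap t x sz)); apply: le_trans small.
  rewrite ler_wpM2l//; apply: ler_pM => //; rewrite ?nrm_ge0//.
  apply: (le_trans (nrm_dx_osc t sz (ltW k0))); apply: lerD.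
    by rewrite ler_wpM2l// ltW.
  by apply: ler_wsqrtr; apply: ler_pM => //; exact: nrm_ge0.
have ineq t : 0 <= t <= 1 -> y t <= zeta ^+ 2 ->
    Int (dt (fun t x => z t x * z t x) t) <= K * y t + e ^+ 2.
  move=> t01 yt; have zs x := zsup t x t01 yt.
  pose c := 4 * beta / kap.
  have c0 : 0 <= c by rewrite /c divr_ge0 ?mulr_ge0 ?ltW.
  pose F t x := - (delta * (2 * (z t x * dx (dx z) t x) - dx z t x * dx z t x +
      gam * (z t x * z t x))) + 2 * c * (2^-1 * (Va t x * Va t x * (z t x * z t x)) +
      2 / 3 * (Va t x * (z t x * (z t x * z t x))) +
      4^-1 * (z t x * z t x * (z t x * z t x))).
  have sF : snice F by rewrite /F; snice_tac.
  (* All terms with a derivative of [z] are absorbed in [dx F]. What is left differentiates [Va]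
     only, and the factor [kap] this costs is cancelled by [c]. *)
  pose r t x := 2 * c * (Va t x * dx Va t x + 3^-1 * (dx Va t x * z t x)) * (z t x * z t x).
  have sr : snice r.
    rewrite /r; apply: sniceM => //; apply: sniceZ; apply: sniceD; first exact: sniceM.
    by apply: sniceZ; exact: sniceM.
  have szE : snice (fun t x => z t x * E t x) by exact: sniceM.
  have szE2 := sniceZ 2 szE.
  have -> : dt (fun t x => z t x * z t x) t = fun x =>
      dx F t x + r t x - 2 * (z t x * E t x).
    apply/funext => x.
    have -> : dt (fun t x => z t x * z t x) t x = dt z t x * z t x + z t x * dt z t x.
      by hasD_val; apply: hasDM; exact: snice_dtD.
    have h0 := snice_dxD t x sz; have h1 := snice_dxD t x sz1.
    have h2 := snice_dxD t x sz2; have ha := snice_dxD t x sVa.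
    have -> : dx F t x = - (delta * (2 * (z t x * dx (dx (dx z)) t x) +
        gam * (2 * z t x * dx z t x))) + 2 * c * (Va t x * dx Va t x * z t x ^+ 2
        + Va t x ^+ 2 * z t x * dx z t x
        + 2 / 3 * (dx Va t x * z t x ^+ 3 + 3 * Va t x * z t x ^+ 2 * dx z t x)
        + z t x ^+ 3 * dx z t x).
      by hasD_val; rewrite /F; apply: hasD_eq; [by hasD_tac|gfield].
    rewrite dtz eV eVa -/c /r z3 z1 /z; gfield.
  rewrite IntB; [|exact: (snice_integ t (sniceD (snice_dx sF) sr))|exact: (snice_integ t szE2)].
  rewrite IntD; [|exact: (snice_integ t (snice_dx sF))|exact: (snice_integ t sr)].
  rewrite Int_dx0// add0r IntZ; last exact: (snice_integ t szE).
  have rb : Int (r t) <= 8 * beta * (C ^+ 2 + C) * y t.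
    rewrite /y -IntZ; last exact: (snice_integ t szz).
    apply: Int_le; [exact: (snice_integ t sr)|exact: (snice_integ t (sniceZ _ szz))|].
    move=> x; rewrite /r ler_wpM2r -?expr2 ?sqr_ge0//.
    apply: (le_trans (ler_norm _)); rewrite normrM (ger0_norm (mulr_ge0 (ler0n R 2) c0)).
    have -> : 8 * beta * (C ^+ 2 + C) = 2 * c * (C * (C * kap) + C * kap).
      by rewrite /c; field; rewrite gt_eqF.
    apply: ler_wpM2l; first by rewrite mulr_ge0.
    apply: (le_trans (ler_normD _ _)).
    have Ck : 0 <= C * kap by rewrite mulr_ge0// ltW.
    rewrite lerD// normrM; first by rewrite ler_pM ?bVa ?bVa1.
    rewrite ger0_norm ?invr_ge0//; apply: (@le_trans _ _ (`|dx Va t x * z t x|)).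
      by rewrite ler_piMl// invf_le1// ler1n.
    by rewrite normrM -[leRHS]mulr1 ler_pM ?bVa1.
  have Eb : - (2 * Int (fun x => z t x * E t x)) <= y t + e ^+ 2.
    have dz : decay (z t) by exact: snice_decay.
    have dE : decay (E t) by exact: snice_decay.
    have := norm_Int_CS dz dE; rewrite ler_norml => /andP[lo _].
    have := ler_wpM2l (nrm_ge0 (z t)) (bE t t01).
    by rewrite yE; have := sqr_ge0 (nrm (z t) - e); nra.
  apply: (le_trans (lerD rb Eb)); rewrite addrA lerD2r /K.
  have y_ge0 : 0 <= y t by rewrite yE sqr_ge0.
  by rewrite -[X in _ + X]mul1r -mulrDl ler_wpM2r//; lra.
have e2 : 0 < e ^+ 2 by rewrite exprn_gt0.
have key : (y 0 + e ^+ 2 / K) * expR (K * 1) < zeta ^+ 2.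
  rewrite y0 add0r zeta2 ltr_pM2r ?expR_gt0// ltr_pdivrMr// -[ltLHS]mulr1.
  by rewrite ltr_pM2l.
move=> t t01.
have y00 : 0 <= y 0 by rewrite y0.
have := gronwall_bootstrap K0 (ltW e2) y00 yD ineq key t01 => yt.
have := le_trans yt (ltW key); rewrite yE => zn2.
by rewrite -(@ler_pXn2r _ 2)// ?nnegrE ?nrm_ge0// ltW.
Qed.

End Stability.

(** * Modulated waves *)

Section Wave.
Context {R : realType}.
Variables (kap A m : R) (c s : R -> R -> R).
Hypotheses (bc : bnice c) (bs : bnice s).
Hypothesis c_x : forall t x, hasD (c t) x (- (m * kap) * s t x).
Hypothesis s_x : forall t x, hasD (s t) x (m * kap * c t x).
Hypothesis c_t : forall t x, hasD (fun t => c t x) t (2 * A * m * s t x).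
Hypothesis s_t : forall t x, hasD (fun t => s t x) t (- (2 * A * m) * c t x).
Implicit Types (p q : R -> R -> R).

(** The real part of [(p + i q) (c + i s)]. *)
Definition wave p q (t x : R) := p t x * c t x - q t x * s t x.

Lemma snice_wave p q : snice p -> snice q -> snice (wave p q).
Proof. by move=> sp sq; apply: sniceB; exact: sniceMb. Qed.

Lemma dx_wave p q : snice p -> snice q -> dx (wave p q) =
  wave (fun t x => dx p t x - m * kap * q t x) (fun t x => dx q t x + m * kap * p t x).
Proof.
move=> sp sq; apply: dxE => t x; rewrite /wave.
have h0 := snice_dxD t x sp; have h1 := snice_dxD t x sq.
have h2 := c_x t x; have h3 := s_x t x.
by hasD_ring.
Qed.

Lemma dt_wave p q : snice p -> snice q -> dt (wave p q) =
  wave (fun t x => dt p t x + 2 * A * m * q t x) (fun t x => dt q t x - 2 * A * m * p t x).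
Proof.
move=> sp sq; apply: dtE => t x; rewrite /wave.
have h0 := snice_dtD t x sp; have h1 := snice_dtD t x sq.
have h2 := c_t t x; have h3 := s_t t x.
by apply: hasD_eq (hasDB (hasDM h0 h2) (hasDM h1 h3)) _; gring.
Qed.

Let dxL f g (a : R) : snice f -> snice g ->
  dx (fun t x => f t x + a * g t x) = fun t x => dx f t x + a * dx g t x.
Proof.
by move=> sf sg; apply: dxE => t x; apply: hasDD; [|apply: hasDZ]; exact: snice_dxD.
Qed.

Let dxLB f g (a : R) : snice f -> snice g ->
  dx (fun t x => f t x - a * g t x) = fun t x => dx f t x - a * dx g t x.
Proof.
by move=> sf sg; apply: dxE => t x; apply: hasDB; [|apply: hasDZ]; exact: snice_dxD.
Qed.

Lemma dx2_wave p q : snice p -> snice q -> dx (dx (wave p q)) =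
  wave (fun t x => dx (dx p) t x - 2 * m * kap * dx q t x - m ^+ 2 * kap ^+ 2 * p t x)
       (fun t x => dx (dx q) t x + 2 * m * kap * dx p t x - m ^+ 2 * kap ^+ 2 * q t x).
Proof.
move=> sp sq; have sp1 := snice_dx sp; have sq1 := snice_dx sq.
rewrite dx_wave// dx_wave; [|by snice_tac..].
rewrite dxL// dxLB//; apply/funext => t; apply/funext => x; rewrite /wave.
gring.
Qed.

Lemma osc_wave p q : snice p -> snice q -> osc kap (wave p q) =
  wave (fun t x => dx (dx p) t x - 2 * m * kap * dx q t x + (1 - m ^+ 2) * kap ^+ 2 * p t x)
       (fun t x => dx (dx q) t x + 2 * m * kap * dx p t x + (1 - m ^+ 2) * kap ^+ 2 * q t x).
Proof.
move=> sp sq; rewrite /osc dx2_wave//; apply/funext => t; apply/funext => x.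
rewrite /wave; gring.
Qed.

Lemma dx3_wave p q : snice p -> snice q -> dx (dx (dx (wave p q))) =
  wave (fun t x => dx (dx (dx p)) t x - 3 * m * kap * dx (dx q) t x
          - 3 * m ^+ 2 * kap ^+ 2 * dx p t x + m ^+ 3 * kap ^+ 3 * q t x)
       (fun t x => dx (dx (dx q)) t x + 3 * m * kap * dx (dx p) t x
          - 3 * m ^+ 2 * kap ^+ 2 * dx q t x - m ^+ 3 * kap ^+ 3 * p t x).
Proof.
move=> sp sq; have sp1 := snice_dx sp; have sq1 := snice_dx sq.
have sp2 := snice_dx sp1; have sq2 := snice_dx sq1.
rewrite dx2_wave// dx_wave; [|by snice_tac..].
rewrite !dxLB ?dxL; [|by snice_tac..].
apply/funext => t; apply/funext => x; rewrite /wave.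
gring.
Qed.

(** The coefficients [A / kap ^ 3] and [3 kap ^ 2] are those of the frame moving with the group
    velocity. For [m = 1] the transport and zero order terms drop out; for [m = 3] the zero order
    coefficient is [24 A]. *)
Lemma airy_wave p q t x : snice p -> snice q -> kap != 0 ->
  dt (wave p q) t x + A / kap ^+ 3 * (dx (dx (dx (wave p q))) t x +
     3 * kap ^+ 2 * dx (wave p q) t x) =
  wave (fun t x => dt p t x + A / kap ^+ 3 * (dx (dx (dx p)) t x -
          3 * m * kap * dx (dx q) t x + 3 * (1 - m ^+ 2) * kap ^+ 2 * dx p t x)
          + A * (m ^+ 3 - m) * q t x)
       (fun t x => dt q t x + A / kap ^+ 3 * (dx (dx (dx q)) t x +
          3 * m * kap * dx (dx p) t x + 3 * (1 - m ^+ 2) * kap ^+ 2 * dx q t x)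
          - A * (m ^+ 3 - m) * p t x) t x.
Proof.
move=> sp sq k0; rewrite dt_wave// dx3_wave// dx_wave// /wave.
by gen_atoms; field.
Qed.

Lemma norm_wave p q t x a e : `|c t x| <= a -> `|s t x| <= a ->
  `|p t x| <= e -> `|q t x| <= e -> `|wave p q t x| <= 2 * a * e.
Proof.
move=> ca sa pe qe; rewrite /wave (le_trans (ler_normB _ _))// !normrM.
have h1 : `|p t x| * `|c t x| <= e * a by rewrite ler_pM.
have h2 : `|q t x| * `|s t x| <= e * a by rewrite ler_pM.
by apply: (le_trans (lerD h1 h2)); rewrite le_eqVlt; apply/orP; left; apply/eqP; ring.
Qed.

End Wave.

(** * The carrier wave and its third harmonic *)

Section Carrier.
Context {R : realType}.
Variables (kap A : R).

(** The frequency [2 A] is what the motion of the frame leaves of the linear dispersion. *)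
Definition carrier_cos (t x : R) := cos (kap * x - 2 * A * t).
Definition carrier_sin (t x : R) := sin (kap * x - 2 * A * t).
(** Cosine and sine of three times the phase, as polynomials, so that relations between harmonics
    follow by [ring] from [carrier_sq]. *)
Definition carrier_cos3 t x :=
  carrier_cos t x ^+ 3 - 3 * (carrier_cos t x * carrier_sin t x ^+ 2).
Definition carrier_sin3 t x :=
  3 * (carrier_cos t x ^+ 2 * carrier_sin t x) - carrier_sin t x ^+ 3.

Let phase_x t x : hasD (fun y => kap * y - 2 * A * t) x kap.
Proof.
by apply: hasD_eq (hasDB (hasDZ kap (hasD_id x)) (hasD_cst x (2 * A * t))) _; ring.
Qed.

Let phase_t t x : hasD (fun t => kap * x - 2 * A * t) t (- (2 * A)).
Proof.
by apply: hasD_eq (hasDB (hasD_cst t (kap * x)) (hasDZ (2 * A) (hasD_id t))) _; ring.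
Qed.

Lemma carrier_cos_x t x : hasD (carrier_cos t) x (- (1 * kap) * carrier_sin t x).
Proof. by apply: hasD_eq (hasD_cos (phase_x t x)) _; rewrite /carrier_sin; ring. Qed.

Lemma carrier_sin_x t x : hasD (carrier_sin t) x (1 * kap * carrier_cos t x).
Proof. by apply: hasD_eq (hasD_sin (phase_x t x)) _; rewrite /carrier_cos; ring. Qed.

Lemma carrier_cos_t t x :
  hasD (fun t => carrier_cos t x) t (2 * A * 1 * carrier_sin t x).
Proof. by apply: hasD_eq (hasD_cos (phase_t t x)) _; rewrite /carrier_sin; ring. Qed.

Lemma carrier_sin_t t x :
  hasD (fun t => carrier_sin t x) t (- (2 * A * 1) * carrier_cos t x).
Proof. by apply: hasD_eq (hasD_sin (phase_t t x)) _; rewrite /carrier_cos; ring. Qed.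

Lemma carrier_sq t x : carrier_cos t x ^+ 2 + carrier_sin t x ^+ 2 = 1.
Proof. exact: cos2Dsin2. Qed.

Lemma carrier_cos_le1 t x : `|carrier_cos t x| <= 1.
Proof. by rewrite ler_norml cos_geN1 cos_le1. Qed.

Lemma carrier_sin_le1 t x : `|carrier_sin t x| <= 1.
Proof. by rewrite ler_norml sin_geN1 sin_le1. Qed.

(** The phase grows with [x], so [nice_cos_sin] does not apply; instead, both derivatives of each
    function are constant multiples of the other one. *)
Lemma bnice_carrier : bnice carrier_cos /\ bnice carrier_sin.
Proof.
have bnd (h : R -> R -> R) : (forall t x, `|h t x| <= 1) -> jap_bounded 0 h.
  by move=> h1 T; exists 1 => t x _; rewrite expr0 mulr1.
have nZ n (a : R) f : nice 0 n f -> nice 0 n (fun t x => a * f t x).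
  by move=> nf; exact: (niceM (nice_cst n a) nf).
suff H n : nice 0 n carrier_cos /\ nice 0 n carrier_sin.
  by split=> n; have [] := H n.
elim: n => [|n [nc ns]].
  by split; split=> //; apply: bnd; [exact: carrier_cos_le1|exact: carrier_sin_le1].
split.
- apply: niceS (nZ n _ _ ns) (nZ n _ _ ns); [apply: bnd; exact: carrier_cos_le1
    |exact: carrier_cos_t|exact: carrier_cos_x].
- apply: niceS (nZ n _ _ nc) (nZ n _ _ nc); [apply: bnd; exact: carrier_sin_le1
    |exact: carrier_sin_t|exact: carrier_sin_x].
Qed.

Lemma bnice_carrier3 : bnice carrier_cos3 /\ bnice carrier_sin3.
Proof.
have [bc bs] := bnice_carrier.
have E1 : carrier_cos3 = fun t x => carrier_cos t x * (carrier_cos t x * carrier_cos t x) +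
    (- 3) * (carrier_cos t x * (carrier_sin t x * carrier_sin t x)).
  by apply/funext => t; apply/funext => x; rewrite /carrier_cos3; ring.
have E2 : carrier_sin3 = fun t x => 3 * (carrier_cos t x * (carrier_cos t x * carrier_sin t x)) +
    (- 1) * (carrier_sin t x * (carrier_sin t x * carrier_sin t x)).
  by apply/funext => t; apply/funext => x; rewrite /carrier_sin3; ring.
split; rewrite ?E1 ?E2; repeat first [apply: bniceD|apply: bniceZ|apply: bniceM|by []].
Qed.

Lemma carrier_cos3_x t x : hasD (carrier_cos3 t) x (- (3 * kap) * carrier_sin3 t x).
Proof.
have h0 := carrier_cos_x t x; have h1 := carrier_sin_x t x.
have h2 := hasDX 2 h0; have h3 := hasDX 1 h1.
apply: hasD_eq (hasDB h2 (hasDZ 3 (hasDM h0 h3))) _; rewrite /carrier_sin3; gring.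
Qed.

Lemma carrier_sin3_x t x : hasD (carrier_sin3 t) x (3 * kap * carrier_cos3 t x).
Proof.
have h0 := carrier_cos_x t x; have h1 := carrier_sin_x t x.
have h2 := hasDX 1 h0; have h3 := hasDX 2 h1.
apply: hasD_eq (hasDB (hasDZ 3 (hasDM h2 h1)) h3) _; rewrite /carrier_cos3; gring.
Qed.

Lemma carrier_cos3_t t x :
  hasD (fun t => carrier_cos3 t x) t (2 * A * 3 * carrier_sin3 t x).
Proof.
have h0 := carrier_cos_t t x; have h1 := carrier_sin_t t x.
have h2 := hasDX 2 h0; have h3 := hasDX 1 h1.
apply: hasD_eq (hasDB h2 (hasDZ 3 (hasDM h0 h3))) _; rewrite /carrier_sin3; gring.
Qed.

Lemma carrier_sin3_t t x :
  hasD (fun t => carrier_sin3 t x) t (- (2 * A * 3) * carrier_cos3 t x).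
Proof.
have h0 := carrier_cos_t t x; have h1 := carrier_sin_t t x.
have h2 := hasDX 1 h0; have h3 := hasDX 2 h1.
apply: hasD_eq (hasDB (hasDZ 3 (hasDM h2 h1)) h3) _; rewrite /carrier_cos3; gring.
Qed.

Let cube_bound (a b : R) : `|a| <= 1 -> `|b| <= 1 -> `|a ^+ 3 - 3 * (a * b ^+ 2)| <= 4.
Proof.
move=> a1 b1; rewrite (le_trans (ler_normB _ _))// (_ : (4 : R) = 1 + 3); last by ring.
have p1 n (y : R) : `|y| <= 1 -> `|y ^+ n| <= 1 by move=> y1; rewrite normrX exprn_ile1.
rewrite lerD ?p1// normrM ger0_norm// -[leRHS]mulr1 ler_wpM2l// normrM.
by rewrite -[leRHS]mulr1 ler_pM// p1.
Qed.

Lemma carrier_cos3_le4 t x : `|carrier_cos3 t x| <= 4.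
Proof. by apply: cube_bound; [exact: carrier_cos_le1|exact: carrier_sin_le1]. Qed.

Lemma carrier_sin3_le4 t x : `|carrier_sin3 t x| <= 4.
Proof.
rewrite -normrN; have := cube_bound (carrier_sin_le1 t x) (carrier_cos_le1 t x).
by congr (`| _ | <= 4); rewrite /carrier_sin3; ring.
Qed.

End Carrier.

(** * Uniform bounds for finitely many envelopes *)

Section CommonBound.
Context {R : realType}.

Fixpoint all_snice (l : seq (R -> R -> R)) : Prop :=
  if l is f :: l' then snice f /\ all_snice l' else True.

Definition unit_bound K (f : R -> R -> R) := forall t x, `|t| <= 1 ->
  `|f t x| <= K * jap x.

Fixpoint all_unit_bound K (l : seq (R -> R -> R)) : Prop :=
  if l is f :: l' then unit_bound K f /\ all_unit_bound K l' else True.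

(** It will be applied to envelopes that do not involve the wave number, so that one constant serves
    for all [kap] and [A]. *)
Lemma common_bound l : all_snice l -> exists2 K, 1 <= K & all_unit_bound K l.
Proof.
elim: l => [_|f l IH [sf /IH[K K1 lK]]]; first by exists 1.
have [C C0 fC] := snice_bound 1 1 sf; exists (C + K).
  by rewrite (le_trans K1)// lerDr.
split=> [t x t1|].
  by apply: (le_trans (fC t x t1)); rewrite expr1 ler_wpM2r ?jap_ge0// lerDl (le_trans ler01).
elim: l lK {IH} => [//|g l IHl [gK lK]]; split; last exact: IHl.
by move=> t x t1; apply: (le_trans (gK t x t1)); rewrite ler_wpM2r ?jap_ge0// lerDr.
Qed.

Lemma norm_leD (a b A B : R) : `|a| <= A -> `|b| <= B -> `|a + b| <= A + B.
Proof. by move=> aA bB; apply: (le_trans (ler_normD _ _)); exact: lerD. Qed.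

Lemma norm_leB (a b A B : R) : `|a| <= A -> `|b| <= B -> `|a - b| <= A + B.
Proof. by move=> aA bB; apply: norm_leD => //; rewrite normrN. Qed.

Lemma norm_leM (a b A B : R) : `|a| <= A -> `|b| <= B -> `|a * b| <= A * B.
Proof. by move=> aA bB; rewrite normrM ler_pM. Qed.

Lemma norm_leZ (c b B : R) : 0 <= c -> `|b| <= B -> `|c * b| <= c * B.
Proof. by move=> c0 bB; rewrite normrM ger0_norm// ler_wpM2l. Qed.

End CommonBound.

(** * The approximate solution and its residual *)

Section Approximation.
Context {R : realType}.
Variables (phi : R -> R) (beta : R).
Hypothesis sphi : snice (fun _ => phi).
Hypothesis beta0 : 0 < beta.

Let bphase : bnice (fun t x => beta * t * (phi x * phi x)).
Proof.
apply: bniceM; first by apply: bniceZ; exact: bnice_time.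
by apply: snice_bnice; exact: (sniceM sphi sphi).
Qed.

(** With [env_sin], the real and imaginary parts of [P = phi exp (i beta t phi ^ 2)], which at each
    point solves the resonant equation [P' = i beta |P| ^ 2 P]. *)
Definition env_cos t x := phi x * cos (beta * t * (phi x * phi x)).
Definition env_sin t x := phi x * sin (beta * t * (phi x * phi x)).
(** With [env_sin3], the real and imaginary parts of [P ^ 3], the envelope of the harmonic that the
    cubic term creates. *)
Definition env_cos3 t x := env_cos t x ^+ 3 - 3 * (env_cos t x * env_sin t x ^+ 2).
Definition env_sin3 t x := 3 * (env_cos t x ^+ 2 * env_sin t x) - env_sin t x ^+ 3.

Lemma snice_env_cos : snice env_cos.
Proof. exact: (sniceMb sphi (bnice_cos bphase)). Qed.

Lemma snice_env_sin : snice env_sin.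
Proof. exact: (sniceMb sphi (bnice_sin bphase)). Qed.

Lemma snice_env_cos3 : snice env_cos3.
Proof.
have sc := snice_env_cos; have ss := snice_env_sin.
by rewrite /env_cos3; snice_tac.
Qed.

Lemma snice_env_sin3 : snice env_sin3.
Proof.
have sc := snice_env_cos; have ss := snice_env_sin.
by rewrite /env_sin3; snice_tac.
Qed.

Lemma env_sq t x : env_cos t x ^+ 2 + env_sin t x ^+ 2 = phi x ^+ 2.
Proof. by rewrite !exprMn -mulrDr cos2Dsin2 mulr1. Qed.

Let phase_t t x : hasD (fun t => beta * t * (phi x * phi x)) t (beta * phi x ^+ 2).
Proof.
by apply: hasD_eq (hasDM (hasDZ beta (hasD_id t)) (hasD_cst t (phi x * phi x))) _; ring.
Qed.

Lemma dt_env_cos t x :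
  dt env_cos t x = - (beta * (env_cos t x ^+ 2 + env_sin t x ^+ 2) * env_sin t x).
Proof.
apply: dt_val; apply: hasD_eq (hasDZ (phi x) (hasD_cos (phase_t t x))) _.
by rewrite env_sq /env_sin; ring.
Qed.

Lemma dt_env_sin t x :
  dt env_sin t x = beta * (env_cos t x ^+ 2 + env_sin t x ^+ 2) * env_cos t x.
Proof.
apply: dt_val; apply: hasD_eq (hasDZ (phi x) (hasD_sin (phase_t t x))) _.
by rewrite env_sq /env_cos; ring.
Qed.

Variables (kap A : R).

Let w1 := wave (carrier_cos kap A) (carrier_sin kap A).
Let w3 := wave (carrier_cos3 kap A) (carrier_sin3 kap A).

(** A wave train whose phase advances by [beta t phi ^ 2], with the third
    harmonic forced by the cubic term. *)
Definition approx t x :=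
  w1 env_cos env_sin t x + - (beta / (24 * A)) * w3 env_cos3 env_sin3 t x.

Definition residual t x := dt approx t x +
  A / kap ^+ 3 * (dx (dx (dx approx)) t x + 3 * kap ^+ 2 * dx approx t x) -
  4 * beta / kap * (approx t x ^+ 2 * dx approx t x).

Let sw1 p q : snice p -> snice q -> snice (w1 p q).
Proof. by have [bc bs] := bnice_carrier kap A; exact: snice_wave. Qed.

Let sw3 p q : snice p -> snice q -> snice (w3 p q).
Proof. by have [bc bs] := bnice_carrier3 kap A; exact: snice_wave. Qed.

Let s1 : snice (w1 env_cos env_sin).
Proof. exact: sw1 snice_env_cos snice_env_sin. Qed.

Let s3 : snice (w3 env_cos3 env_sin3).
Proof. exact: sw3 snice_env_cos3 snice_env_sin3. Qed.

Lemma snice_approx : snice approx.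
Proof. by apply: sniceD => //; exact: sniceZ. Qed.

Lemma snice_residual : snice residual.
Proof.
have sa := snice_approx; have st := snice_dt sa.
by rewrite /residual; snice_tac.
Qed.

Let dxa f g (c : R) : snice f -> snice g ->
  dx (fun t x => f t x + c * g t x) = fun t x => dx f t x + c * dx g t x.
Proof.
by move=> sf sg; apply: dxE => t x; apply: hasDD; [|apply: hasDZ]; exact: snice_dxD.
Qed.

Let dta f g (c : R) : snice f -> snice g ->
  dt (fun t x => f t x + c * g t x) = fun t x => dt f t x + c * dt g t x.
Proof.
move=> sf sg; apply: dtE => t x.
exact: hasDD (snice_dtD t x sf) (hasDZ c (snice_dtD t x sg)).
Qed.

Lemma dx_approx : dx approx =
  fun t x => dx (w1 env_cos env_sin) t x + - (beta / (24 * A)) * dx (w3 env_cos3 env_sin3) t x.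
Proof. exact: dxa. Qed.

Lemma dx_w1 : dx (w1 env_cos env_sin) =
  w1 (fun t x => dx env_cos t x - 1 * kap * env_sin t x)
     (fun t x => dx env_sin t x + 1 * kap * env_cos t x).
Proof.
have [bc bs] := bnice_carrier kap A.
apply: (dx_wave (carrier_cos_x kap A) (carrier_sin_x kap A)).
- exact: snice_env_cos.
- exact: snice_env_sin.
Qed.

Lemma dx_w3 : dx (w3 env_cos3 env_sin3) =
  w3 (fun t x => dx env_cos3 t x - 3 * kap * env_sin3 t x)
     (fun t x => dx env_sin3 t x + 3 * kap * env_cos3 t x).
Proof.
have [bc bs] := bnice_carrier3 kap A.
apply: (dx_wave (carrier_cos3_x kap A) (carrier_sin3_x kap A)).
- exact: snice_env_cos3.
- exact: snice_env_sin3.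
Qed.

(** The terms of order one have cancelled: the resonant part of the cubic term against the rotation
    of the envelopes, its third harmonic against the [24 A] of [airy_wave]. What remains is small
    with [A / kap ^ 2], [1 / kap] and [1 / A]. *)
Lemma residualE t x : kap != 0 -> A != 0 -> residual t x =
  w1 (fun t x => A / kap ^+ 3 * (dx (dx (dx env_cos)) t x - 3 * kap * dx (dx env_sin) t x))
     (fun t x => A / kap ^+ 3 * (dx (dx (dx env_sin)) t x + 3 * kap * dx (dx env_cos) t x)) t x
  - beta / (24 * A) *
  w3 (fun t x => dt env_cos3 t x + A / kap ^+ 3 * (dx (dx (dx env_cos3)) t x -
        9 * kap * dx (dx env_sin3) t x - 24 * kap ^+ 2 * dx env_cos3 t x))
     (fun t x => dt env_sin3 t x + A / kap ^+ 3 * (dx (dx (dx env_sin3)) t x +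
        9 * kap * dx (dx env_cos3) t x - 24 * kap ^+ 2 * dx env_sin3 t x)) t x
  - 4 * beta / kap * (w1 env_cos env_sin t x ^+ 2 * w1 (dx env_cos) (dx env_sin) t x)
  - 4 * beta / kap * (- (beta / (24 * A)) * (dx (w1 env_cos env_sin) t x *
       (2 * w1 env_cos env_sin t x * w3 env_cos3 env_sin3 t x +
        - (beta / (24 * A)) * w3 env_cos3 env_sin3 t x ^+ 2)
     + dx (w3 env_cos3 env_sin3) t x * approx t x ^+ 2)).
Proof.
move=> k0 A0; have sc := snice_env_cos; have ss := snice_env_sin.
have sc3 := snice_env_cos3; have ss3 := snice_env_sin3.
have [bc bs] := bnice_carrier kap A; have [bc3 bs3] := bnice_carrier3 kap A.
have airy1 := airy_wave (carrier_cos_x kap A) (carrier_sin_x kap A)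
  (carrier_cos_t kap A) (carrier_sin_t kap A) t x sc ss k0.
have airy3 := airy_wave (carrier_cos3_x kap A) (carrier_sin3_x kap A)
  (carrier_cos3_t kap A) (carrier_sin3_t kap A) t x sc3 ss3 k0.
have s1x := snice_dx s1; have s3x := snice_dx s3.
have s1xx := snice_dx s1x; have s3xx := snice_dx s3x.
have -> : residual t x =
  (dt (w1 env_cos env_sin) t x + A / kap ^+ 3 * (dx (dx (dx (w1 env_cos env_sin))) t x +
     3 * kap ^+ 2 * dx (w1 env_cos env_sin) t x)) +
  - (beta / (24 * A)) * (dt (w3 env_cos3 env_sin3) t x +
     A / kap ^+ 3 * (dx (dx (dx (w3 env_cos3 env_sin3))) t x +
     3 * kap ^+ 2 * dx (w3 env_cos3 env_sin3) t x)) -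
  4 * beta / kap * (approx t x ^+ 2 * dx approx t x).
  rewrite /residual; congr (_ - _).
  rewrite dx_approx {1}/approx dta// dxa// dxa//; gring.
rewrite airy1 airy3 dx_approx dx_w1 /approx.
have cs := carrier_sq kap A t x.
set W3 := dx (w3 _ _) t x.
rewrite /w1 /w3 /wave !dt_env_cos !dt_env_sin.
set c3 := carrier_cos3 kap A t x; set s3' := carrier_sin3 kap A t x.
set p3 := env_cos3 t x; set q3 := env_sin3 t x.
set c := carrier_cos kap A t x; set s := carrier_sin kap A t x.
set p := env_cos t x; set q := env_sin t x.
(* This is [4 cos ^ 2 sin = sin + sin 3] for the argument of [(p + i q) (c + i s)], multiplied by
   the cube of its modulus. *)
have key : 4 * (p * c - q * s) ^+ 2 * (q * c + p * s) =
    (p ^+ 2 + q ^+ 2) * (q * c + p * s) + q3 * c3 + p3 * s3'.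
  have -> : (p ^+ 2 + q ^+ 2) * (q * c + p * s) =
      (p ^+ 2 + q ^+ 2) * (q * c + p * s) * (c ^+ 2 + s ^+ 2) by rewrite cs mulr1.
  by rewrite /q3 /p3 /c3 /s3' /env_cos3 /env_sin3 /carrier_cos3 /carrier_sin3
       -/c -/s -/p -/q; ring.
(* Solved for one monomial, the form in which [field] can use it as a rewriting rule. *)
have {}key : q3 * c3 = 4 * (p * c - q * s) ^+ 2 * (q * c + p * s) -
    (p ^+ 2 + q ^+ 2) * (q * c + p * s) - p3 * s3' by rewrite key; ring.
move: key; rewrite -/p -/q; clearbody c3 s3' p3 q3 c s p q W3.
move=> key; gen_atoms.
by field: key; rewrite ?k0 ?A0.
Qed.

Hypotheses (kap1 : 1 <= kap) (A1 : 1 <= A) (bA : beta <= A).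

Let k0 : 0 < kap. Proof. exact: lt_le_trans kap1. Qed.
Let A0 : 0 < A. Proof. exact: lt_le_trans A1. Qed.

Definition env_list : seq (R -> R -> R) :=
  [:: env_cos; env_sin; dx env_cos; dx env_sin; dx (dx env_cos); dx (dx env_sin);
      dx (dx (dx env_cos)); dx (dx (dx env_sin));
      env_cos3; env_sin3; dx env_cos3; dx env_sin3; dx (dx env_cos3); dx (dx env_sin3);
      dx (dx (dx env_cos3)); dx (dx (dx env_sin3)); dt env_cos3; dt env_sin3].

Lemma all_snice_env_list : all_snice env_list.
Proof.
have sc := snice_env_cos; have ss := snice_env_sin.
have sc3 := snice_env_cos3; have ss3 := snice_env_sin3.
do 16![split; first by snice_tac]; split; first exact: snice_dt.
by split; first exact: snice_dt.
Qed.

Variable K : R.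
Hypotheses (K1 : 1 <= K) (bK : all_unit_bound K env_list).

Let b := beta / (24 * A).

Let b_ge0 : 0 <= b. Proof. by rewrite divr_ge0 ?mulr_ge0 ?ltW. Qed.

Let b_le1 : b <= 1.
Proof. by rewrite /b ler_pdivrMr ?mulr_gt0// mul1r (le_trans bA)// ler_peMl ?(ltW A0)// ler1n. Qed.

Let K0 : 0 <= K. Proof. exact: le_trans K1. Qed.

Let w1_le p q t x e : `|p t x| <= e -> `|q t x| <= e -> `|w1 p q t x| <= 2 * e.
Proof.
move=> pe qe; have := norm_wave (carrier_cos_le1 kap A t x) (carrier_sin_le1 kap A t x) pe qe.
by rewrite mulr1.
Qed.

Let w3_le p q t x e : `|p t x| <= e -> `|q t x| <= e -> `|w3 p q t x| <= 8 * e.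
Proof.
move=> pe qe; have := norm_wave (carrier_cos3_le4 kap A t x) (carrier_sin3_le4 kap A t x) pe qe.
by rewrite -natrM.
Qed.

Section Pointwise.
Variables (t x : R).
Hypothesis t1 : `|t| <= 1.
Let j := jap x.
Let j0 : 0 <= j. Proof. exact: jap_ge0. Qed.
Let j1 : j <= 1. Proof. exact: jap_le1. Qed.

Let V1 := w1 env_cos env_sin t x.
Let V3 := w3 env_cos3 env_sin3 t x.

Lemma V1_le : `|V1| <= 2 * (K * j).
Proof. by move: bK => /= [] p [q] _; apply: w1_le; [exact: p|exact: q]. Qed.

Lemma V3_le : `|V3| <= 8 * (K * j).
Proof.
move: bK => /= [] _ [] _ [] _ [] _ [] _ [] _ [] _ [] _ [] p [] q _.
by apply: w3_le; [exact: p|exact: q].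
Qed.

Let Kj_ge0 : 0 <= K * j. Proof. exact: mulr_ge0. Qed.

Let K_kap : K * j <= kap * (K * j). Proof. exact: ler_peMl. Qed.

Lemma dV1_le : `|dx (w1 env_cos env_sin) t x| <= 4 * kap * (K * j).
Proof.
rewrite dx_w1; move: bK => /= [] p [] q [] p' [] q' _.
have := p t x t1; have := q t x t1; have := p' t x t1; have := q' t x t1.
rewrite -/j => hq' hp' hq hp.
rewrite (_ : 4 * kap * (K * j) = 2 * (kap * (K * j) + kap * (K * j))); last by ring.
have le1 y : `|y| <= K * j -> `|y| <= kap * (K * j) by move/le_trans; apply.
have k0' := ltW k0.
by apply: w1_le; [apply: norm_leB|apply: norm_leD]; (try exact: le1);
  rewrite mul1r; exact: norm_leZ.
Qed.

Lemma dV3_le : `|dx (w3 env_cos3 env_sin3) t x| <= 32 * kap * (K * j).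
Proof.
rewrite dx_w3.
move: bK => /= [] _ [] _ [] _ [] _ [] _ [] _ [] _ [] _ [] p [] q [] p' [] q' _.
have := p t x t1; have := q t x t1; have := p' t x t1; have := q' t x t1.
rewrite -/j => hq' hp' hq hp.
rewrite (_ : 32 * kap * (K * j) = 8 * (kap * (K * j) + 3 * kap * (K * j))); last by ring.
have le1 y : `|y| <= K * j -> `|y| <= kap * (K * j) by move/le_trans; apply.
have k3 : 0 <= 3 * kap by rewrite mulr_ge0// ltW.
by apply: w3_le; [apply: norm_leB|apply: norm_leD]; (try exact: le1); exact: norm_leZ.
Qed.

Lemma approx_sub_le : `|approx t x - V1| <= 8 * b * (K * j).
Proof.
rewrite (_ : approx t x - V1 = - b * V3); last by rewrite /approx -/V1 -/V3 -/b; ring.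
rewrite mulNr normrN (_ : 8 * b * (K * j) = b * (8 * (K * j))); last by ring.
by apply: norm_leZ => //; exact: V3_le.
Qed.

Lemma approx_le : `|approx t x| <= 10 * (K * j).
Proof.
rewrite -(subrK V1 (approx t x)) (_ : 10 * (K * j) = 8 * (K * j) + 2 * (K * j)); last by ring.
apply: norm_leD V1_le; apply: (le_trans approx_sub_le).
by rewrite ler_wpM2r// ler_piMr.
Qed.

Lemma dx_approx_sub_le :
  `|dx approx t x - dx (w1 env_cos env_sin) t x| <= 32 * kap * b * (K * j).
Proof.
rewrite dx_approx -/b (_ : _ - _ = - (b * dx (w3 env_cos3 env_sin3) t x)); last by gring.
rewrite normrN (_ : 32 * kap * b * (K * j) = b * (32 * kap * (K * j))); last by ring.
by apply: norm_leZ => //; exact: dV3_le.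
Qed.

Lemma dx_approx_le : `|dx approx t x| <= 36 * kap * (K * j).
Proof.
rewrite -(subrK (dx (w1 env_cos env_sin) t x) (dx approx t x)).
rewrite (_ : 36 * kap * (K * j) = 32 * kap * (K * j) + 4 * kap * (K * j)); last by ring.
apply: norm_leD dV1_le; apply: (le_trans dx_approx_sub_le).
by rewrite ler_wpM2r// ler_piMr// mulr_ge0// ltW.
Qed.

(** The terms in [kap ^ 2] vanish on the first harmonic; on the third they remain, but with the
    small factor [beta / (24 A)]. *)
Lemma osc_approx_le :
  `|osc kap approx t x| <= (6 * kap + 5 * beta * kap ^+ 2 / A) * (K * j).
Proof.
have sc := snice_env_cos; have ss := snice_env_sin.
have sc3 := snice_env_cos3; have ss3 := snice_env_sin3.
have [bc bs] := bnice_carrier kap A; have [bc3 bs3] := bnice_carrier3 kap A.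
have -> : osc kap approx t x = osc kap (w1 env_cos env_sin) t x -
    b * osc kap (w3 env_cos3 env_sin3) t x.
  rewrite /osc dx_approx dxa; [|exact: snice_dx s1|exact: snice_dx s3].
  by rewrite /approx -/b; gring.
rewrite (osc_wave (carrier_cos_x kap A) (carrier_sin_x kap A) sc ss).
rewrite (osc_wave (carrier_cos3_x kap A) (carrier_sin3_x kap A) sc3 ss3).
move: bK => /= [] p [] q [] p' [] q' [] p'' [] q'' [] _ [] _.
move=> [] p3 [] q3 [] p3' [] q3' [] p3'' [] q3'' _.
have := p t x t1; have := q t x t1; have := p' t x t1; have := q' t x t1.
have := p'' t x t1; have := q'' t x t1.
have := p3 t x t1; have := q3 t x t1; have := p3' t x t1; have := q3' t x t1.
have := p3'' t x t1; have := q3'' t x t1; rewrite -/j.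
move=> hq3'' hp3'' hq3' hp3' hq3 hp3 hq'' hp'' hq' hp' hq hp.
have k0' := ltW k0; have k2 : 0 <= kap ^+ 2 by rewrite sqr_ge0.
have kk : kap <= kap ^+ 2 by rewrite expr2 ler_peMl.
apply: (@le_trans _ _ (2 * (K * j + 2 * kap * (K * j)) +
   b * (8 * (K * j + 6 * kap * (K * j) + 8 * kap ^+ 2 * (K * j))))).
  apply: norm_leB; last apply: norm_leZ => //.
    apply: w1_le; rewrite expr1n subrr mul0r mul0r addr0 mulr1; [apply: norm_leB|apply: norm_leD] => //;
      by apply: norm_leZ => //; rewrite mulr_ge0.
  rewrite (_ : 1 - 3 ^+ 2 = - 8); last by ring.
  rewrite (_ : 2 * 3 * kap = 6 * kap); last by ring.
  apply: w3_le; rewrite !mulNr; apply: norm_leB;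
    [apply: norm_leB|by apply: norm_leZ; rewrite ?mulr_ge0|apply: norm_leD|by apply: norm_leZ; rewrite ?mulr_ge0] => //;
    by apply: norm_leZ => //; rewrite mulr_ge0.
have -> : 5 * beta * kap ^+ 2 / A = 120 * b * kap ^+ 2.
  by rewrite /b; field; rewrite gt_eqF.
have b15 : b * (8 * (K * j + 6 * kap * (K * j) + 8 * kap ^+ 2 * (K * j))) <=
    120 * b * kap ^+ 2 * (K * j).
  rewrite (_ : 120 * b * kap ^+ 2 * (K * j) = b * (120 * (kap ^+ 2 * (K * j)))); last by ring.
  rewrite ler_wpM2l//.
  have := ler_wpM2r Kj_ge0 kk; have := K_kap; have := Kj_ge0; lra.
have := K_kap; lra.
Qed.

Lemma residual_le : `|residual t x| <= (8 * K + 12 * beta * K + 32 * beta * K ^+ 3 +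
  600 * beta ^+ 2 * K ^+ 3) * (A / kap ^+ 2 + kap^-1 + A^-1) * j.
Proof.
rewrite residualE ?gt_eqF//.
have k0' := ltW k0; have A0' := ltW A0; have b0' := ltW beta0.
have ki : 0 <= kap^-1 by rewrite invr_ge0.
have Ai : 0 <= A^-1 by rewrite invr_ge0.
have k2 : 0 <= kap ^+ 2 by rewrite sqr_ge0.
have kk : kap <= kap ^+ 2 by rewrite expr2 ler_peMl.
set del := A / kap ^+ 3.
have del0 : 0 <= del by rewrite /del divr_ge0// exprn_ge0.
have delk : del * kap = A / kap ^+ 2 by rewrite /del; field; rewrite gt_eqF.
have mu0 : 0 <= A / kap ^+ 2 by rewrite divr_ge0.
have bdel : b * (del * kap ^+ 2) = beta / 24 * kap^-1.
  by rewrite /b /del; field; rewrite !gt_eqF.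
have c0 : 0 <= 4 * beta / kap by rewrite divr_ge0// mulr_ge0.
(* Dispersion of the envelope. *)
have T1 : `|w1 (fun t x => del * (dx (dx (dx env_cos)) t x - 3 * kap * dx (dx env_sin) t x))
     (fun t x => del * (dx (dx (dx env_sin)) t x + 3 * kap * dx (dx env_cos) t x)) t x|
    <= 8 * K * (A / kap ^+ 2) * j.
  move: bK => /= [] _ [] _ [] _ [] _ [] p2 [] q2 [] p3 [] q3 _.
  have := p2 t x t1; have := q2 t x t1; have := p3 t x t1; have := q3 t x t1; rewrite -/j.
  move=> hq3 hp3 hq2 hp2.
  apply: (@le_trans _ _ (2 * (del * (K * j + 3 * kap * (K * j))))).
    by apply: w1_le; apply: norm_leZ => //; [apply: norm_leB|apply: norm_leD] => //;
      apply: norm_leZ => //; rewrite mulr_ge0.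
  rewrite -delk (_ : 8 * K * (del * kap) * j = 2 * (del * (4 * (kap * (K * j))))); last by ring.
  by rewrite ler_wpM2l// ler_wpM2l//; have := K_kap; lra.
(* Evolution and transport of the third harmonic. *)
have T2 : `|b * w3 (fun t x => dt env_cos3 t x + del * (dx (dx (dx env_cos3)) t x -
        9 * kap * dx (dx env_sin3) t x - 24 * kap ^+ 2 * dx env_cos3 t x))
     (fun t x => dt env_sin3 t x + del * (dx (dx (dx env_sin3)) t x +
        9 * kap * dx (dx env_cos3) t x - 24 * kap ^+ 2 * dx env_sin3 t x)) t x|
    <= 12 * beta * K * (kap^-1 + A^-1) * j.
  move: bK => /= [] _ [] _ [] _ [] _ [] _ [] _ [] _ [] _ [] _ [] _.
  move=> [] p1 [] q1 [] p2 [] q2 [] p3 [] q3 [] pt [] qt _.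
  have := p1 t x t1; have := q1 t x t1; have := p2 t x t1; have := q2 t x t1.
  have := p3 t x t1; have := q3 t x t1; have := pt t x t1; have := qt t x t1; rewrite -/j.
  move=> hqt hpt hq3 hp3 hq2 hp2 hq1 hp1.
  apply: (@le_trans _ _ (b * (8 * (K * j + del * (K * j + 9 * kap * (K * j) +
      24 * kap ^+ 2 * (K * j)))))).
    apply: norm_leZ => //; apply: w3_le; apply: norm_leD => //; apply: norm_leZ => //;
      apply: norm_leB; [apply: norm_leB|by apply: norm_leZ; rewrite ?mulr_ge0|
      apply: norm_leD|by apply: norm_leZ; rewrite ?mulr_ge0] => //;
      by apply: norm_leZ => //; rewrite mulr_ge0.
  have h1 : K * j + 9 * kap * (K * j) + 24 * kap ^+ 2 * (K * j) <= 34 * (kap ^+ 2 * (K * j)).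
    by have := ler_wpM2r Kj_ge0 kk; have := K_kap; lra.
  have h2 := ler_wpM2l b_ge0 (ler_wpM2l del0 h1).
  have h3 : b * (del * (34 * (kap ^+ 2 * (K * j)))) = 34 / 24 * beta * kap^-1 * (K * j).
    transitivity (34 * (b * (del * kap ^+ 2)) * (K * j)); first by ring.
    by rewrite bdel; field; rewrite gt_eqF.
  have h4 : b * (K * j) = beta / 24 * A^-1 * (K * j).
    by rewrite /b; field; rewrite gt_eqF.
  have p4 : 0 <= beta * kap^-1 * (K * j) by rewrite !mulr_ge0.
  have p5 : 0 <= beta * A^-1 * (K * j) by rewrite !mulr_ge0.
  lra.
(* The part of the cubic term in which the derivative falls on the envelope. *)
have T3 : `|4 * beta / kap * (V1 ^+ 2 * w1 (dx env_cos) (dx env_sin) t x)| <=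
    32 * beta * K ^+ 3 * kap^-1 * j.
  have h : `|w1 (dx env_cos) (dx env_sin) t x| <= 2 * (K * j).
    move: bK => /= [] _ [] _ [] p [] q _.
    by apply: w1_le; [exact: p|exact: q].
  apply: (@le_trans _ _ (4 * beta / kap * ((2 * (K * j)) ^+ 2 * (2 * (K * j))))).
    by apply: norm_leZ => //; apply: norm_leM h; rewrite !expr2; apply: norm_leM; exact: V1_le.
  rewrite (_ : 4 * beta / kap * ((2 * (K * j)) ^+ 2 * (2 * (K * j))) =
    32 * beta * K ^+ 3 * kap^-1 * j * j ^+ 2); last by field; rewrite gt_eqF.
  rewrite ler_piMr//; last by rewrite exprn_ile1.
  by rewrite !mulr_ge0// exprn_ge0.
(* Interactions with the third harmonic: the factor [kap] of the derivative cancels [1 / kap], and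
   smallness comes from [b], that is from [1 / A]. *)
have T4 : `|4 * beta / kap * (- b * (dx (w1 env_cos env_sin) t x *
       (2 * V1 * V3 + - b * V3 ^+ 2) +
       dx (w3 env_cos3 env_sin3) t x * approx t x ^+ 2))| <=
    600 * beta ^+ 2 * K ^+ 3 * A^-1 * j.
  have v1 := V1_le; have v3 := V3_le; have d1 := dV1_le; have d3 := dV3_le; have va := approx_le.
  have h1 : `|2 * V1 * V3 + - b * V3 ^+ 2| <= 2 * (2 * (K * j)) * (8 * (K * j)) + 1 * (8 * (K * j)) ^+ 2.
    apply: norm_leD; first by apply: norm_leM v3; exact: norm_leZ.
    rewrite !expr2; apply: norm_leM; last exact: norm_leM.
    by rewrite normrN ger0_norm.
  apply: (@le_trans _ _ (4 * beta / kap * (b * (4 * kap * (K * j) * (2 * (2 * (K * j)) * (8 * (K * j)) +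
     1 * (8 * (K * j)) ^+ 2) + 32 * kap * (K * j) * (10 * (K * j)) ^+ 2)))).
    apply: norm_leZ => //; rewrite mulNr normrN; apply: norm_leZ => //; apply: norm_leD.
      exact: norm_leM.
    by apply: norm_leM => //; rewrite !expr2; apply: norm_leM.
  rewrite (_ : 4 * beta / kap * (b * (4 * kap * (K * j) * (2 * (2 * (K * j)) * (8 * (K * j)) +
     1 * (8 * (K * j)) ^+ 2) + 32 * kap * (K * j) * (10 * (K * j)) ^+ 2)) =
     (14336 / 24) * beta ^+ 2 * K ^+ 3 * A^-1 * j * j ^+ 2); last first.
    by rewrite /b; field; rewrite !gt_eqF.
  have n0 : 0 <= beta ^+ 2 * K ^+ 3 * A^-1 * j by rewrite !mulr_ge0 ?sqr_ge0 ?exprn_ge0.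
  have j21 : j ^+ 2 <= 1 by rewrite exprn_ile1.
  have := ler_wpM2l n0 j21; lra.
have := norm_leB (norm_leB (norm_leB T1 T2) T3) T4.
rewrite /V1 /V3 /b => /le_trans; apply.
have q1 : 0 <= K * j * (kap^-1 + A^-1) by rewrite mulr_ge0 ?addr_ge0// mulr_ge0.
have q2 : 0 <= beta * K * j * (A / kap ^+ 2) by apply: mulr_ge0 => //; rewrite !mulr_ge0.
have q3 : 0 <= beta * K ^+ 3 * j * (A / kap ^+ 2 + A^-1).
  by apply: mulr_ge0; [rewrite !mulr_ge0// exprn_ge0|exact: addr_ge0].
have q4 : 0 <= beta ^+ 2 * K ^+ 3 * j * (A / kap ^+ 2 + kap^-1).
  by apply: mulr_ge0; [rewrite !mulr_ge0 ?sqr_ge0// exprn_ge0|exact: addr_ge0].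
rewrite -subr_ge0 (_ : _ - _ = 8 * (K * j * (kap^-1 + A^-1)) + 12 * (beta * K * j * (A / kap ^+ 2))
  + 32 * (beta * K ^+ 3 * j * (A / kap ^+ 2 + A^-1)) +
  600 * (beta ^+ 2 * K ^+ 3 * j * (A / kap ^+ 2 + kap^-1))); last by ring.
lra.
Qed.

End Pointwise.

End Approximation.

Ltac nn := repeat first [ assumption | (apply: ltW; assumption) | exact: ler0n
  | exact: ler01 | apply: sqr_ge0 | apply: exprn_ge0 | apply: mulr_ge0 | apply: addr_ge0
  | rewrite invr_ge0 ].

(** * Approximation of exact solutions in the moving frame *)

Section Frame.
Context {R : realType}.

(** [pi] is not opaque and unfolds to a product, which [rewrite] would enter. *)
Fact cpi_key : unit. Proof. by []. Qed.
Definition cpi : R := locked_with cpi_key (1 + pi).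

Lemma cpiE : cpi = 1 + pi. Proof. exact: unlock. Qed.

Lemma cpi_ge1 : 1 <= cpi. Proof. by rewrite cpiE lerDl pi_ge0. Qed.

Lemma cpi_gt0 : 0 < cpi. Proof. exact: lt_le_trans cpi_ge1. Qed.

Lemma pi_le_cpi2 : pi <= cpi ^+ 2.
Proof. by rewrite cpiE; have := pi_ge0 R; move: (pi : R) => p; rewrite expr2; nra. Qed.

Lemma dx_eq (f g : R -> R -> R) t : f t = g t -> dx f t = dx g t.
Proof. by rewrite dx.unlock => fg; apply/funext => x; rewrite fg. Qed.

Lemma nrm_jap_le (f : R -> R) C : decay f -> 0 <= C ->
  (forall x, `|f x| <= C * jap x) -> nrm f <= C * cpi.
Proof.
move=> df C0 fC; have c0 : 0 <= C * cpi by rewrite mulr_ge0// ltW// cpi_gt0.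
rewrite -(@ler_pXn2r _ 2)// ?nnegrE ?nrm_ge0//.
apply: (le_trans (nrm_jap df C0 fC)); rewrite exprMn; apply: ler_wpM2l.
  exact: sqr_ge0.
exact: pi_le_cpi2.
Qed.

Lemma Int_jap_le (f : R -> R) C : integ f -> 0 <= C ->
  (forall x, `|f x| <= C * jap x) -> Int f <= C * cpi ^+ 2.
Proof.
move=> If C0 fC; apply: (le_trans (ler_norm _)); apply: (le_trans (Int_bound If fC)).
by apply: ler_wpM2l => //; exact: pi_le_cpi2.
Qed.

Lemma nrmZ (f : R -> R) c : decay f -> 0 <= c -> nrm (fun x => c * f x) = c * nrm f.
Proof.
move=> df c0; rewrite /nrm (@eq_Int _ _ (fun x => c ^+ 2 * f x ^+ 2)); last first.
  by move=> x; rewrite exprMn.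
rewrite IntZ; last by apply: decay_integ; exact: (decayMM df df).
by rewrite sqrtrM ?sqr_ge0// sqrtr_sqr ger0_norm.
Qed.

Lemma nrmN (f : R -> R) : nrm (fun x => - f x) = nrm f.
Proof. by congr Num.sqrt; apply: eq_Int => x; rewrite sqrrN. Qed.

Lemma nrmB_le (f g : R -> R) : decay f -> decay g ->
  nrm (fun x => f x - g x) <= nrm f + nrm g.
Proof.
move=> df dg; rewrite -(nrmN g); apply: nrm_triangle => //; exact: decayN.
Qed.

Variables (phi : R -> R) (beta : R).
Hypothesis sphi : snice (fun _ => phi).
Hypothesis beta0 : 0 < beta.

(** In the application [m ^ 2 = N / L ^ 2] and [kap * m ^ 2 = N ^ 2 / L], so [eta] measures the two
    errors of the ansatz. The value of [rho] is the one for which the cubic coefficient of the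
    equation for [w / rho] becomes [4 beta / kap]. *)
Theorem frame_approx : exists C eta : R, [/\ 1 <= C, 0 < eta, eta <= 1 &
  forall kap m rho (Up Um : R -> R -> R), 0 < m -> m <= eta -> eta^-1 <= kap * m ^+ 2 ->
    0 < rho -> rho ^+ 2 = 2 * beta / (3 * m ^+ 2) ->
    let Va := approx phi beta kap (kap ^+ 2 * m ^+ 2) in
    let w0 x := rho * Va 0 x in
    snice Up -> snice Um ->
    kdv (m ^+ 2 / kap) (3 * kap ^+ 2) Up -> kdv (m ^+ 2 / kap) (3 * kap ^+ 2) Um ->
    (forall x, Up 0 x = w0 x ^+ 2 + derive1 w0 x) ->
    (forall x, Um 0 x = w0 x ^+ 2 - derive1 w0 x) ->
    exists w, [/\ snice w, forall t x, Up t x = dx w t x + w t x ^+ 2,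
      forall t, nrm (w t) <= C * rho &
      forall t, 0 <= t <= 1 -> nrm (fun x => rho^-1 * w t x - Va t x) <= C * m ^+ 2]].
Proof.
have [K K1 bK] := common_bound (all_snice_env_list beta sphi).
have K0 : 0 < K by exact: lt_le_trans K1.
pose cp := cpi.
have cp1 : 1 <= cp by exact: cpi_ge1.
have cp0 : 0 < cp by exact: cpi_gt0.
have b0 := ltW beta0; have K0' := ltW K0; have cp0' := ltW cp0.
pose M := 8 * K + 12 * beta * K + 32 * beta * K ^+ 3 + 600 * beta ^+ 2 * K ^+ 3.
have M0 : 0 < M.
  rewrite /M; have : 0 <= beta * K by rewrite mulr_ge0.
  have : 0 <= beta * K ^+ 3 by rewrite mulr_ge0// exprn_ge0.
  have : 0 <= beta ^+ 2 * K ^+ 3 by rewrite mulr_ge0 ?sqr_ge0// exprn_ge0.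
  lra.
pose Cv := 36 * K.
pose KK := 8 * beta * (Cv ^+ 2 + Cv) + 2.
pose Cz := 3 * M * cp * expR (KK / 2).
have Cz0 : 0 < Cz by rewrite !mulr_gt0 ?expR_gt0.
pose Go := (6 + 5 * beta) * K.
have Go0 : 0 < Go by rewrite mulr_gt0// ltr_pwDl// mulr_ge0.
(* [Gv * (kap / m)] bounds the norm of [w'' + kap ^ 2 w] divided by [rho]. *)
pose Gv := 1 + 2 * cp ^+ 2 * (Go ^+ 2 + 10 * beta * (10 * K) ^+ 2 * (36 * K) ^+ 2
    + 2 * beta ^+ 2 * (10 * K) ^+ 6).
have Gv1 : 1 <= Gv by rewrite lerDl; nn.
pose CG := Go * cp + Gv.
have CG0 : 0 < CG by apply: addr_gt0; [exact: mulr_gt0|exact: lt_le_trans Gv1].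
pose Cw := 10 * K * cp.
have Cw0 : 0 < Cw by rewrite !mulr_gt0.
pose Cd := 36 * K + (10 * K) ^+ 2.
have Cd0 : 0 <= Cd by rewrite /Cd; nn.
pose Ca := 8 * beta * Cw * (2 + beta) * Cd * cp.
have Ca0 : 0 <= Ca by rewrite /Ca; nn.
pose C := 1 + Cz + Cw.
(* After [1], the terms pay in turn for [beta <= A], for the two halves of the smallness condition
   of [stability], and for [w ^ 2 <= kap ^ 2 / 4]. *)
pose X := 1 + beta + 4 * CG * Cz + 16 * (Cz * CG ^+ 3) + Ca.
have t1 : 0 <= 4 * CG * Cz by nn.
have t2 : 0 <= 16 * (Cz * CG ^+ 3) by nn.
have X1 : 1 <= X by rewrite /X; lra.
have X0 : 0 < X by exact: lt_le_trans X1.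
exists C, X^-1; split; first by rewrite /C; have := ltW Cz0; have := ltW Cw0; lra.
- by rewrite invr_gt0.
- by rewrite invf_le1.
move=> kap m rho Up Um m0 mX kX rho0 rhoE Va w0 sUp sUm kUp kUm U0p U0m.
rewrite invrK in kX.
have m0' := ltW m0.
have m1 : m <= 1 by apply: (le_trans mX); rewrite invf_le1.
have mX1 : m * X <= 1 by rewrite -ler_pdivlMr// div1r.
have m2 : 0 < m ^+ 2 by rewrite exprn_gt0.
have m21 : m ^+ 2 <= m by rewrite expr2 ler_piMr.
have m2' := ltW m2.
have k0 : 0 < kap.
  by rewrite -(pmulr_lgt0 _ m2); exact: lt_le_trans kX.
have k0' := ltW k0.
have km : X <= kap * m by apply: (le_trans kX); rewrite ler_wpM2l.
have kX' : X <= kap by apply: (le_trans km); rewrite ler_piMr.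
have k1 : 1 <= kap by exact: le_trans kX'.
have kn0 : kap != 0 by rewrite gt_eqF.
have mn0 : m != 0 by rewrite gt_eqF.
set A := kap ^+ 2 * m ^+ 2.
have AX : X <= A.
  rewrite /A expr2 -mulrA; apply: (le_trans kX'); rewrite ler_peMr//.
  by apply: le_trans kX.
have A1 : 1 <= A by exact: le_trans AX.
have bA : beta <= A by apply: le_trans AX; rewrite /X; lra.
have A0 : 0 < A by exact: lt_le_trans A1.
have sVa : snice Va by exact: snice_approx.
have rn0 : rho != 0 by rewrite gt_eqF.
have r2b : rho ^+ 2 <= beta / m ^+ 2.
  rewrite rhoE ler_pdivlMr// (_ : 2 * beta / (3 * m ^+ 2) * m ^+ 2 = 2 / 3 * beta); last by field.
  by lra.
have r20 : 0 <= rho ^+ 2 by exact: sqr_ge0.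
have sw0' : snice (fun t x => rho * Va t x) by exact: sniceZ.
have sw0 : snice (fun _ => w0) by exact: (snice_freeze 0 sw0').
have [w [sw w_0 kw Uw]] := inverse_miura (divr_ge0 m2' k0') sUp sUm kUp kUm sw0 U0p U0m.
have t00 : `|0 : R| <= 1 by rewrite normr0.
have jap1 x : jap x <= 1 :> R by exact: jap_le1.
have j0 x : 0 <= jap x :> R by exact: jap_ge0.
have dk : A / kap ^+ 2 = m ^+ 2 by rewrite /A; field.
have m2i : (m ^+ 2)^-1 <= kap.
  by rewrite -[(m ^+ 2)^-1]mul1r ler_pdivrMr//; apply: le_trans kX.
have ki : kap^-1 <= m ^+ 2.
  by rewrite -[kap^-1]mul1r ler_pdivrMr// mulrC; apply: le_trans kX.
have Ai : A^-1 <= m ^+ 2.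
  rewrite -[A^-1]mul1r ler_pdivrMr// /A (_ : m ^+ 2 * _ = (kap * m ^+ 2) ^+ 2); last by ring.
  by rewrite exprn_ege1//; apply: le_trans kX.
have mi : m^-1 <= kap by rewrite -[m^-1]mul1r ler_pdivrMr//; apply: le_trans km.
have oscb t x : `|t| <= 1 -> `|osc kap Va t x| <= Go * kap * jap x.
  move=> tt; apply: (le_trans (osc_approx_le sphi beta0 k1 A1 K1 bK x tt)).
  rewrite -/A (_ : 5 * beta * kap ^+ 2 / A = 5 * beta * (m ^+ 2)^-1); last first.
    by rewrite /A; field; rewrite kn0 mn0.
  rewrite mulrA ler_wpM2r// /Go.
  have := ler_wpM2l (mulr_ge0 b0 K0') m2i; lra.
have vab t x : `|t| <= 1 -> `|Va t x| <= 10 * K * jap x.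
  move=> tt; rewrite -mulrA.
  exact: (approx_le beta0 kap A1 bA K1 bK x tt).
have dvab t x : `|t| <= 1 -> `|dx Va t x| <= 36 * K * kap * jap x.
  move=> tt; rewrite (_ : 36 * K * kap * jap x = 36 * kap * (K * jap x)); last by ring.
  exact: (dx_approx_le sphi beta0 k1 A1 bA K1 bK x tt).
have resb t x : `|t| <= 1 ->
    `|residual phi beta kap A t x| <= 3 * M * m ^+ 2 * jap x.
  move=> tt; apply: (le_trans (residual_le sphi beta0 k1 A1 bA K1 bK x tt)).
  rewrite -/M dk ler_wpM2r// (_ : 3 * M * m ^+ 2 = M * (m ^+ 2 + m ^+ 2 + m ^+ 2)); last by ring.
  by apply: ler_wpM2l; [exact: ltW|exact: lerD (lerD (lexx _) ki) Ai].
have dxw0 : dx w 0 = fun x => rho * dx Va 0 x.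
  have -> : (fun x => rho * dx Va 0 x) = dx (fun t x => rho * Va t x) 0.
    by apply/funext => x; apply/esym/dx_val/hasDZ; exact: snice_dxD.
  exact: dx_eq.
have dxxw0 : dx (dx w) 0 = fun x => rho * dx (dx Va) 0 x.
  have sd := snice_dx sVa.
  have -> : (fun x => rho * dx (dx Va) 0 x) = dx (fun t x => rho * dx Va t x) 0.
    by apply/funext => x; apply/esym/dx_val/hasDZ; exact: snice_dxD.
  exact: dx_eq.
have oscw0 x : osc kap w 0 x = rho * osc kap Va 0 x.
  by rewrite /osc dxxw0 w_0 /w0; ring.
have rk : rho <= (1 + beta) * kap.
  have : rho <= (1 + beta) * m^-1.
    have c0 : 0 <= (1 + beta) / m by nn.
    rewrite -(@ler_pXn2r _ 2)// ?nnegrE// ?(ltW rho0)//.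
    apply: (le_trans r2b); rewrite exprMn exprVn ler_wpM2r ?invr_ge0//.
    by have := sqr_ge0 beta; rewrite expr2; nra.
  by move/le_trans; apply; rewrite ler_wpM2l//; nn.
have nw t : nrm (w t) <= Cw * rho.
  have -> : nrm (w t) = nrm (w 0).
    by rewrite /nrm (mkdv_mass t sw kw).
  rewrite w_0 /w0 nrmZ; [|exact: snice_decay|exact: ltW].
  rewrite mulrC; apply: ler_wpM2r; [exact: ltW|]; rewrite /Cw; apply: nrm_jap_le.
  - exact: snice_decay.
  - by rewrite mulr_ge0.
  - by move=> x; exact: vab.
have ndw t : nrm (dx w t) <= rho * (2 + beta) * kap * Cd * cp.
  have B0 : 0 <= rho * (2 + beta) * kap * Cd.
    by nn.
  have B1 : 0 <= rho * (2 + beta) * kap * Cd * cp by nn.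
  rewrite -(@ler_pXn2r _ 2)// ?nnegrE ?nrm_ge0//.
  apply: (le_trans (miura_dx_bound t sw sUp kUp Uw)).
  have sI : snice (fun t x => dx w t x ^+ 2 + w t x ^+ 4) by snice_tac.
  have step x : `|dx w 0 x ^+ 2 + w 0 x ^+ 4| <= (rho * (2 + beta) * kap * Cd) ^+ 2 * jap x.
    have h1 : `|dx w 0 x| <= rho * (36 * K * kap).
      rewrite dxw0; apply: norm_leZ; first exact: ltW.
      by apply: (le_trans (dvab 0 x t00)); rewrite ler_piMr//; nn.
    have h2 : `|w 0 x| <= rho * (10 * K) * jap x.
      by rewrite w_0 /w0 -mulrA; apply: norm_leZ; [exact: ltW|exact: vab].
    have h1' : `|dx w 0 x| <= rho * (36 * K * kap) * jap x.
      by rewrite dxw0 -mulrA; apply: norm_leZ; [exact: ltW|exact: dvab].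
    have h3 : `|w 0 x| <= rho * (10 * K).
      by apply: (le_trans h2); rewrite ler_piMr//; nn.
    have -> : dx w 0 x ^+ 2 + w 0 x ^+ 4 = dx w 0 x * dx w 0 x + w 0 x * w 0 x * (w 0 x * w 0 x) by ring.
    apply: (le_trans (norm_leD (norm_leM h1 h1') (norm_leM (norm_leM h3 h3) (norm_leM h3 h2)))).
    rewrite (_ : _ + _ = rho ^+ 2 * ((36 * K) ^+ 2 * kap ^+ 2 + rho ^+ 2 * (10 * K) ^+ 4) * jap x); last by ring.
    rewrite ler_wpM2r//.
    rewrite (_ : (rho * (2 + beta) * kap * Cd) ^+ 2 = rho ^+ 2 * (((2 + beta) * kap) ^+ 2 * Cd ^+ 2)); last by ring.
    rewrite ler_wpM2l//.
    have r2k : rho ^+ 2 <= ((1 + beta) * kap) ^+ 2.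
      by rewrite lerXn2r ?nnegrE//; nn.
    have q1 : 0 <= (10 * K) ^+ 4 by nn.
    have q2 := ler_wpM2r q1 r2k.
    have q3 : 0 <= kap ^+ 2 by rewrite sqr_ge0.
    have q4 : 0 <= (36 * K) ^+ 2 by rewrite sqr_ge0.
    apply: (@le_trans _ _ ((36 * K) ^+ 2 * kap ^+ 2 + ((1 + beta) * kap) ^+ 2 * (10 * K) ^+ 4)).
      by rewrite lerD2l.
    have cd2 : (36 * K) ^+ 2 + (10 * K) ^+ 4 <= Cd ^+ 2.
      rewrite -subr_ge0 (_ : _ - _ = 2 * ((36 * K) * (10 * K) ^+ 2)); last by rewrite /Cd; ring.
      by nn.
    apply: (@le_trans _ _ (((2 + beta) * kap) ^+ 2 * ((36 * K) ^+ 2 + (10 * K) ^+ 4))); last first.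
      by rewrite ler_wpM2l// sqr_ge0.
    rewrite mulrDr; apply: lerD.
      rewrite mulrC ler_wpM2r// lerXn2r ?nnegrE//; nn.
      by rewrite ler_peMl//; lra.
    rewrite ler_wpM2r// lerXn2r ?nnegrE//; nn.
    by rewrite ler_wpM2r//; lra.
  rewrite [leRHS]exprMn; apply: Int_jap_le step; last exact: sqr_ge0.
  exact: (snice_integ 0 sI).
(* The bounds on [w] and [w'] give [w ^ 2] of size [rho ^ 2 kap], that is [kap / m ^ 2], which the
   lower bound on [kap * m ^ 2] makes small against [kap ^ 2]. *)
have wsmall t x : w t x ^+ 2 <= kap ^+ 2 / 4.
  apply: (le_trans (snice_sup t x sw)).
  apply: (@le_trans _ _ (2 * (Cw * rho * (rho * (2 + beta) * kap * Cd * cp)))).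
    by rewrite ler_wpM2l// ler_pM// nrm_ge0.
  rewrite (_ : _ * _ = rho ^+ 2 * (2 * Cw * (2 + beta) * Cd * cp) * kap); last by ring.
  have q0 : 0 <= 2 * Cw * (2 + beta) * Cd * cp by nn.
  apply: (@le_trans _ _ (beta / m ^+ 2 * (2 * Cw * (2 + beta) * Cd * cp) * kap)).
    by rewrite ler_wpM2r// ler_wpM2r.
  rewrite (_ : _ * kap = Ca / m ^+ 2 / 4 * kap); last by rewrite /Ca; field.
  have cm : Ca / m ^+ 2 <= kap.
    by rewrite ler_pdivrMr//; apply: le_trans kX; rewrite /X; lra.
  by have := ler_wpM2r k0' cm; rewrite expr2; lra.
have nosc t : nrm (osc kap w t) <= rho * (Gv * (kap / m)).
  have g0 : 0 <= rho * (Gv * (kap / m)) by nn; exact: le_trans Gv1.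
  rewrite -(@ler_pXn2r _ 2)// ?nnegrE ?nrm_ge0//.
  apply: (le_trans (miura_osc_bound sw sUp kw kUp Uw (wsmall t))).
  have so := snice_osc kap sw; have sw1 := snice_dx sw.
  have sI : snice (fun t x => osc kap w t x ^+ 2 +
    10 * (w t x ^+ 2 * dx w t x ^+ 2) + 2 * w t x ^+ 6) by snice_tac.
  have rn : 0 <= rho by exact: ltW.
  pose Q := Go ^+ 2 + 10 * beta * (10 * K) ^+ 2 * (36 * K) ^+ 2 + 2 * beta ^+ 2 * (10 * K) ^+ 6.
  have Q0 : 0 <= Q by rewrite /Q; nn.
  have step x : `|osc kap w 0 x ^+ 2 + 10 * (w 0 x ^+ 2 * dx w 0 x ^+ 2) + 2 * w 0 x ^+ 6|
      <= rho ^+ 2 * (kap / m) ^+ 2 * Q * jap x.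
    have h1 : `|osc kap w 0 x| <= rho * (Go * kap) * jap x.
      by rewrite oscw0 -mulrA; apply: norm_leZ => //; exact: oscb.
    have h2 : `|w 0 x| <= rho * (10 * K) * jap x.
      by rewrite w_0 /w0 -mulrA; apply: norm_leZ => //; exact: vab.
    have h3 : `|dx w 0 x| <= rho * (36 * K * kap) * jap x.
      by rewrite dxw0 -mulrA; apply: norm_leZ => //; exact: dvab.
    have u1 : `|osc kap w 0 x| <= rho * (Go * kap) by apply: (le_trans h1); rewrite ler_piMr//; nn.
    have u2 : `|w 0 x| <= rho * (10 * K) by apply: (le_trans h2); rewrite ler_piMr//; nn.
    have u3 : `|dx w 0 x| <= rho * (36 * K * kap) by apply: (le_trans h3); rewrite ler_piMr//; nn.
    have m4 : (m ^+ 2)^-1 ^+ 2 <= (kap / m) ^+ 2.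
      rewrite lerXn2r ?nnegrE//; [by nn|by nn|].
      by rewrite expr2 invfM ler_wpM2r ?invr_ge0.
    (* Since [1 / m <= kap], the extra fourth power of the amplitude in the sextic term still fits
       into [(kap / m) ^ 2]. *)
    have r4 : rho ^+ 2 * rho ^+ 2 <= beta ^+ 2 * (kap / m) ^+ 2.
      apply: (@le_trans _ _ (beta / m ^+ 2 * (beta / m ^+ 2))); first by rewrite ler_pM.
      rewrite (_ : _ * _ = beta ^+ 2 * (m ^+ 2)^-1 ^+ 2); last by field.
      by rewrite ler_wpM2l// sqr_ge0.
    have k2m : kap ^+ 2 <= (kap / m) ^+ 2.
      rewrite lerXn2r ?nnegrE//; first by nn.
      by rewrite ler_peMr// invf_ge1.
    have z1 : `|osc kap w 0 x ^+ 2| <= rho * (Go * kap) * (rho * (Go * kap) * jap x).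
      by rewrite expr2; exact: norm_leM.
    have z2 : `|10 * (w 0 x ^+ 2 * dx w 0 x ^+ 2)| <= 10 * (rho * (10 * K) * (rho * (10 * K)) *
        (rho * (36 * K * kap) * (rho * (36 * K * kap) * jap x))).
      by rewrite !expr2; apply: norm_leZ => //; apply: norm_leM; exact: norm_leM.
    have z3 : `|2 * w 0 x ^+ 6| <= 2 * ((rho * (10 * K)) ^+ 5 * (rho * (10 * K) * jap x)).
      apply: norm_leZ => //; rewrite exprSr; apply: norm_leM => //.
      by rewrite normrX lerXn2r ?nnegrE//; nn.
    apply: (le_trans (norm_leD (norm_leD z1 z2) z3)).
    rewrite (_ : _ + _ = rho ^+ 2 * (Go ^+ 2 * kap ^+ 2 + rho ^+ 2 * (10 * (10 * K) ^+ 2 * (36 * K) ^+ 2) * kap ^+ 2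
       + (rho ^+ 2 * rho ^+ 2) * (2 * (10 * K) ^+ 6)) * jap x); last by ring.
    rewrite ler_wpM2r// -[leRHS]mulrA ler_wpM2l//.
    rewrite /Q !mulrDr; apply: lerD; [apply: lerD|].
    - by rewrite mulrC ler_wpM2r// sqr_ge0.
    - have c1 : 0 <= 10 * (10 * K) ^+ 2 * (36 * K) ^+ 2 by nn.
      apply: (@le_trans _ _ (beta / m ^+ 2 * (10 * (10 * K) ^+ 2 * (36 * K) ^+ 2) * kap ^+ 2)).
        by rewrite ler_wpM2r ?sqr_ge0// ler_wpM2r.
      by rewrite le_eqVlt; apply/orP; left; apply/eqP; field.
    - have c2 : 0 <= 2 * (10 * K) ^+ 6 by nn.
      by have := ler_wpM2r c2 r4; lra.
  have QC : 0 <= rho ^+ 2 * (kap / m) ^+ 2 * Q by nn.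
  have := Int_jap_le (snice_integ 0 sI) QC step => IQ.
  apply: (@le_trans _ _ (rho ^+ 2 * (kap / m) ^+ 2 * (2 * cp ^+ 2 * Q))).
    rewrite (_ : _ * (2 * cp ^+ 2 * Q) = 2 * (rho ^+ 2 * (kap / m) ^+ 2 * Q * cp ^+ 2)); last by ring.
    by rewrite ler_wpM2l.
  rewrite (_ : (rho * (Gv * (kap / m))) ^+ 2 = rho ^+ 2 * (kap / m) ^+ 2 * Gv ^+ 2); last by ring.
  rewrite ler_wpM2l//; first by nn.
  have q2 : 0 <= 2 * cp ^+ 2 * Q by nn.
  have -> : Gv = 1 + 2 * cp ^+ 2 * Q by [].
  rewrite expr2; apply: (@le_trans _ _ Gv); first by rewrite -/Q /Gv -/Q lerDr.
  by rewrite ler_peMl// (le_trans _ Gv1).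
pose V t x := rho^-1 * w t x.
have sV : snice V by exact: sniceZ.
have ri : 0 <= rho^-1 by rewrite invr_ge0 ltW.
pose E := residual phi beta kap A.
have sE : snice E by exact: snice_residual.
have nE t : 0 <= t <= 1 -> nrm (E t) <= 3 * M * m ^+ 2 * cp.
  move=> /andP[tt0 tt1]; apply: nrm_jap_le; first exact: snice_decay.
    by nn.
  by move=> x; apply: resb; rewrite ger0_norm.
have sw1 := snice_dx sw; have sw2 := snice_dx sw1.
have dV1 : dx V = fun t x => rho^-1 * dx w t x.
  by apply: dxE => t x; apply: hasDZ; exact: snice_dxD.
have dV2 : dx (dx V) = fun t x => rho^-1 * dx (dx w) t x.
  by rewrite dV1; apply: dxE => t x; apply: hasDZ; exact: snice_dxD.
have dV3 : dx (dx (dx V)) = fun t x => rho^-1 * dx (dx (dx w)) t x.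
  by rewrite dV2; apply: dxE => t x; apply: hasDZ; exact: snice_dxD.
have eV t x : dt V t x = - (m ^+ 2 / kap * (dx (dx (dx V)) t x + 3 * kap ^+ 2 * dx V t x)) +
     4 * beta / kap * (V t x ^+ 2 * dx V t x).
  have -> : dt V t x = rho^-1 * dt w t x by apply: dt_val; apply: hasDZ; exact: snice_dtD.
  rewrite kw dV3 dV1 /V.
  have -> : 4 * beta / kap = 6 * (m ^+ 2 / kap) * rho ^+ 2.
    by rewrite rhoE; field; rewrite kn0 mn0.
  by gen_atoms; field; rewrite rn0 kn0.
have AE : A / kap ^+ 3 = m ^+ 2 / kap by rewrite /A; field.
have eVa t x : dt Va t x = - (m ^+ 2 / kap * (dx (dx (dx Va)) t x + 3 * kap ^+ 2 * dx Va t x)) +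
     4 * beta / kap * (Va t x ^+ 2 * dx Va t x) + E t x.
  by rewrite /E /residual -/A -/Va AE; gring.
have V0 x : V 0 x = Va 0 x by rewrite /V w_0 /w0 mulrA mulVf// mul1r.
have in1 t : 0 <= t <= 1 -> `|t| <= 1 by move=> /andP[? ?]; rewrite ger0_norm.
have bVa t x : 0 <= t <= 1 -> `|Va t x| <= Cv.
  move=> /in1 tt; apply: (le_trans (vab t x tt)); rewrite /Cv.
  apply: (@le_trans _ _ (10 * K)); first by rewrite ler_piMr//; nn.
  by lra.
have bVa1 t x : 0 <= t <= 1 -> `|dx Va t x| <= Cv * kap.
  by move=> /in1 tt; apply: (le_trans (dvab t x tt)); rewrite /Cv ler_piMr//; nn.
have bG t : 0 <= t <= 1 -> nrm (osc kap (fun t x => V t x - Va t x) t) <= CG * (kap / m).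
  move=> /in1 tt; have so := snice_osc kap sw; have soa := snice_osc kap sVa.
  rewrite (oscB kap sV sVa) (oscZ kap rho^-1 sw).
  apply: (le_trans (nrmB_le _ _)).
  - exact: (snice_decay t (sniceZ _ so)).
  - exact: snice_decay.
  rewrite nrmZ//; last exact: snice_decay.
  have h1 : rho^-1 * nrm (osc kap w t) <= Gv * (kap / m).
    by rewrite mulrC ler_pdivrMr// mulrC.
  have h2 : nrm (osc kap Va t) <= Go * cp * (kap / m).
    apply: (@le_trans _ _ (Go * kap * cp)).
      by apply: nrm_jap_le; [exact: snice_decay|nn|move=> x; exact: oscb].
    by rewrite mulrAC; apply: ler_wpM2l; [nn|rewrite ler_peMr// invf_ge1].
  have -> : CG * (kap / m) = Gv * (kap / m) + Go * cp * (kap / m) by rewrite {1}/CG; ring.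
  exact: lerD.
have e0 : 0 < 3 * M * m ^+ 2 * cp by rewrite !mulr_gt0.
have Cv0 : 0 <= Cv by rewrite /Cv; nn.
have GG0 : 0 <= CG * (kap / m) by nn.
have small : 2 * ((kap * (3 * M * m ^+ 2 * cp * expR (KK / 2)) +
    Num.sqrt (3 * M * m ^+ 2 * cp * expR (KK / 2) * (CG * (kap / m)))) * (CG * (kap / m))) <= kap ^+ 2.
  have -> : 3 * M * m ^+ 2 * cp * expR (KK / 2) = Cz * m ^+ 2 by rewrite /Cz; ring.
  have s1 : Num.sqrt (Cz * m ^+ 2 * (CG * (kap / m))) * (CG * (kap / m)) <= kap ^+ 2 / 4.
    have -> : kap ^+ 2 / 4 = kap * m / (4 * CG) * (CG * (kap / m)).
      by field; rewrite mn0 gt_eqF.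
    apply: ler_wpM2r => //.
    have q0 : 0 <= kap * m / (4 * CG) by nn.
    rewrite -[leRHS]ger0_norm// -sqrtr_sqr; apply: ler_wsqrtr.
    rewrite (_ : Cz * m ^+ 2 * (CG * (kap / m)) = Cz * CG * (kap * m)); last by field.
    rewrite (_ : (kap * m / (4 * CG)) ^+ 2 = (kap * m) * (kap * m) / (16 * CG ^+ 2)); last first.
      by field; rewrite gt_eqF.
    rewrite ler_pdivlMr ?mulr_gt0 ?exprn_gt0//.
    rewrite (_ : Cz * CG * (kap * m) * (16 * CG ^+ 2) = (kap * m) * (16 * (Cz * CG ^+ 3))); last by ring.
    apply: ler_wpM2l; first by nn.
    by apply: le_trans km; rewrite /X; lra.
  have s2 : kap * (Cz * m ^+ 2) * (CG * (kap / m)) <= kap ^+ 2 / 4.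
    rewrite (_ : _ * _ = kap ^+ 2 / 4 * (m * (4 * CG * Cz))); last by field.
    rewrite ler_piMr//; first by nn.
    apply: le_trans mX1; apply: ler_wpM2l => //; rewrite /X; lra.
  by rewrite mulrDl; lra.
exists w; split=> //.
- move=> t; apply: (le_trans (nw t)); apply: ler_wpM2r; first exact: ltW.
  by rewrite /C; have := ltW Cz0; lra.
- move=> t tt.
  have := stability k0 beta0 e0 Cv0 GG0 sV sVa sE eV eVa V0 bVa bVa1 nE bG small tt.
  move=> /le_trans; apply.
  rewrite -/KK (_ : _ * expR _ = Cz * m ^+ 2); last by rewrite /Cz; ring.
  by apply: ler_wpM2r => //; rewrite /C; have := ltW Cw0; lra.
Qed.

End Frame.

(** * The Fourier transform of Schwartz functions *)

Section Fubini.
Context {R : realType}.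
Local Notation mu := (@lebesgue_measure R).

Lemma IntE (f : R -> R) : integ f -> (\int[mu]_x (f x)%:E = (Int f)%:E)%E.
Proof.
by move=> If; rewrite /Int /Rintegral fineK//; exact: integrable_fin_num If.
Qed.

(** The majorant is a tensor product of two copies of [jap], integrable on the plane. *)
Lemma Int_Fubini (f g : R -> R) (k : R -> R -> R) : decay f -> decay g ->
  measurable_fun [set: measurableTypeR R * measurableTypeR R] (fun z => k z.1 z.2) ->
  (forall x, continuous (k x)) -> (forall y, continuous (k ^~ y)) ->
  (forall x y, `|k x y| <= 1) ->
  Int (fun x => f x * Int (fun y => g y * k x y)) =
  Int (fun y => g y * Int (fun x => f x * k x y)).
Proof.
move=> df dg mk ck ck' k1; have [cf [C fC]] := df; have [cg [D gD]] := dg.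
pose F (z : measurableTypeR R * measurableTypeR R) := (f z.1 * (g z.2 * k z.1 z.2))%:E.
have mf : measurable_fun [set: measurableTypeR R] f by exact: continuous_measurable_fun.
have mg : measurable_fun [set: measurableTypeR R] g by exact: continuous_measurable_fun.
have mj : measurable_fun [set: measurableTypeR R] (@jap R).
  exact: continuous_measurable_fun continuous_jap.
have mF : measurable_fun [set: measurableTypeR R * measurableTypeR R] F.
  apply/measurable_EFinP; apply: measurable_funM; first exact: measurableT_comp.
  by apply: measurable_funM => //; exact: measurableT_comp.
pose H (z : measurableTypeR R * measurableTypeR R) := (`|C| * jap z.1 * (`|D| * jap z.2))%:E.
have mH : measurable_fun [set: measurableTypeR R * measurableTypeR R] H.
  apply/measurable_EFinP; apply: measurable_funM.
    by apply: measurable_funM => //; exact: measurableT_comp.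
  by apply: measurable_funM => //; exact: measurableT_comp.
have j0 (x : R) := jap_ge0 x.
have ij c : integ (fun x : R => c * jap x) by apply: integZ; exact: integ_jap.
have iH : (mu \x mu)%E.-integrable setT H.
  apply/(integrable12ltyP mu mu mH).
  rewrite (_ : (fun x => _) = (fun x : R => (`|C| * `|D| * pi * jap x)%:E)); last first.
    apply/funext => x; rewrite [LHS](_ : _ = \int[mu]_y (`|C| * jap x * `|D| * jap y)%:E)%E.
      by rewrite IntE// IntZ ?Int_jap//; [congr (_%:E); ring|exact: integ_jap].
    by apply: eq_integral => y _; rewrite /H /= ger0_norm ?mulr_ge0// !mulrA.
  by rewrite IntE ?ltry.
have iF : (mu \x mu)%E.-integrable setT F.
  apply: le_integrable iH => // z _; rewrite /F /H /= lee_fin normrM normrM.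
  rewrite (@ger0_norm _ (_ * _)) ?mulr_ge0//; apply: ler_pM => //.
    by apply: (le_trans (fC _)); rewrite ler_wpM2r// ler_norm.
  apply: (@le_trans _ _ `|g z.2|); first by rewrite ler_piMr.
  by apply: (le_trans (gD _)); rewrite ler_wpM2r// ler_norm.
have e1 x : (\int[mu]_y F (x, y))%E = (f x * Int (fun y => g y * k x y))%:E.
  have Ig : integ (fun y => g y * k x y).
    by apply: decay_integ; apply: decayM => //; by exists 1.
  by rewrite -IntZ// -IntE//; exact: integZ.
have e2 y : (\int[mu]_x F (x, y))%E = (g y * Int (fun x => f x * k x y))%:E.
  have If : integ (fun x => f x * k x y).
    by apply: decay_integ; apply: decayM => //; by exists 1.
  rewrite -IntZ// -IntE; last exact: integZ.
  by apply: eq_integral => x _; rewrite /F /= mulrCA.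
have := Fubini iF.
rewrite /Int /Rintegral => /(congr1 fine).
rewrite (eq_integral _ _ (fun x _ => e1 x)) (eq_integral _ _ (fun x _ => e2 x)).
by [].
Qed.
End Fubini.

(** * Cosine and sine transforms of Schwartz functions *)

Section FourierTransform.
Context {R : realType}.
Implicit Types (f g h : R -> R).

Definition sch f := snice (fun _ : R => f).

Lemma sch_hasD f x : sch f -> hasD f x (derive1 f x).
Proof. by move=> sf; have := snice_dxD 0 x sf; rewrite dx.unlock. Qed.

Lemma sch_derive1 f : sch f -> sch (derive1 f).
Proof. by move=> sf; have := snice_dx sf; rewrite dx.unlock. Qed.

Lemma sch_cont f : sch f -> continuous f. Proof. exact: (@snice_cont _ (fun _ => f) 0). Qed.

Lemma sch_decay f : sch f -> decay f. Proof. exact: (@snice_decay _ (fun _ => f) 0). Qed.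

Lemma sch_integ f : sch f -> integ f. Proof. exact: (@snice_integ _ (fun _ => f) 0). Qed.

Lemma sch_bound f k : sch f -> exists2 C, 0 <= C & forall x, `|f x| <= C * jap x ^+ k.
Proof.
move=> sf; have [C C0 fC] := snice_bound k 0 sf; exists C => // x.
by apply: (fC 0); rewrite normr0.
Qed.

Lemma jap_mulX_le (x : R) : `|x| * jap x <= 1.
Proof. by have := norm_mul_jap x 1; rewrite !expr1. Qed.

(** One power of decay pays for the factor [x]. *)
Lemma nice_mulX k n (f : R -> R -> R) : nice k.+1 n f -> nice k n (fun t x => x * f t x).
Proof.
have bnd (h : R -> R -> R) : jap_bounded k.+1 h -> jap_bounded k (fun t x => x * h t x).
  move=> bh T; have [C hC] := bh T; exists `|C| => t x tT.
  rewrite normrM; apply: (@le_trans _ _ (`|x| * (`|C| * jap x ^+ k.+1))).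
    rewrite ler_wpM2l//; apply: (le_trans (hC _ _ tT)).
    by rewrite ler_wpM2r ?japX_ge0// ler_norm.
  rewrite exprS (mulrCA `|C|) [leLHS]mulrA -[leRHS]mul1r.
  by apply: (ler_wpM2r _ (jap_mulX_le x)); rewrite mulr_ge0 ?japX_ge0.
elim: n f => [|n IH] f nf; first by split=> //; exact: bnd (nice_jap nf).
apply: (@niceS _ _ _ _ (fun t x => x * dt f t x) (fun t x => f t x + x * dx f t x)).
- exact: bnd (nice_jap nf).
- by move=> t x; apply: hasDZ; exact: nice_dtD nf.
- move=> t x; apply: hasD_eq (hasDM (hasD_id x) (nice_dxD t x nf)) _.
  by rewrite mul1r.
- by apply: IH; exact: nice_dt.
- apply: niceD; last by apply: IH; exact: nice_dx.
  by apply: nice_weak (niceW nf).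
Qed.

Lemma snice_mulX (f : R -> R -> R) : snice f -> snice (fun t x => x * f t x).
Proof. by move=> sf k n; apply: nice_mulX; exact: sf. Qed.

Lemma sch_mulX f : sch f -> sch (fun x => x * f x).
Proof. exact: (@snice_mulX (fun _ => f)). Qed.

Lemma schN f : sch f -> sch (fun x => - f x). Proof. exact: (@sniceN _ (fun _ => f)). Qed.

Lemma hasD_mulr (x a : R) : hasD (fun y => y * a) x a.
Proof. by apply: hasD_eq (hasDM (hasD_id x) (hasD_cst x a)) _; ring. Qed.

Lemma hasD_mull (x a : R) : hasD (fun y => a * y) x a.
Proof. by apply: hasD_eq (hasDZ a (hasD_id x)) _; ring. Qed.

Lemma continuous_osc (t : R -> R) (xi : R) : continuous t -> continuous (fun x : R => t (x * xi)).
Proof.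
move=> ct x; apply: (@continuous_comp _ _ _ (fun x : R => x * xi) t); last exact: ct.
exact: hasD_continuous (hasD_mulr x xi).
Qed.

Lemma decay_cos f xi : decay f -> decay (fun x => f x * cos (x * xi)).
Proof.
move=> df; apply: decayM => //; first by apply: continuous_osc; exact: continuous_cos.
by exists 1 => x; exact: cos_max.
Qed.

Lemma decay_sin f xi : decay f -> decay (fun x => f x * sin (x * xi)).
Proof.
move=> df; apply: decayM => //; first by apply: continuous_osc; exact: continuous_sin.
by exists 1 => x; exact: sin_max.
Qed.

Lemma fourier_cos_deriv f xi : sch f -> fourier_cos (derive1 f) xi = xi * fourier_sin f xi.
Proof.
move=> sf; have df := sch_decay sf; have sf1 := sch_derive1 sf.
have [C C0 fC] := sch_bound 2 sf; have [D D0 fD] := sch_bound 2 sf1.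
have cf1 := decay_cos xi (sch_decay sf1); have sf0 := decay_sin xi df.
have j0 (x : R) := japX_ge0 x 2.
apply/eqP; rewrite -subr_eq0; apply/eqP.
rewrite /fourier_cos /fourier_sin -!/(Int _) -IntZ ?decay_integ// -IntB; first last.
- by apply: integZ; exact: decay_integ.
- exact: decay_integ.
apply: (@Int_deriv0 _ _ (fun x => f x * cos (x * xi)) (C + D + `|xi| * C)).
- exact: (decayB cf1 (decayZ xi sf0)).1.
- move=> x; apply: (@le_trans _ _ (D * jap x ^+ 2 * 1 + `|xi| * (C * jap x ^+ 2 * 1))).
    apply: (le_trans (ler_normB _ _)); rewrite !normrM; apply: lerD.
      by apply: ler_pM => //; exact: cos_max.
    by apply: ler_wpM2l => //; apply: ler_pM => //; exact: sin_max.
  by have := mulr_ge0 C0 (j0 x); have := mulr_ge0 (normr_ge0 xi) (mulr_ge0 C0 (j0 x)); lra.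
- move=> x; apply: hasD_eq (hasDM (sch_hasD x sf) (hasD_cos (hasD_mulr x xi))) _; ring.
- move=> x; rewrite normrM; have c1 := @cos_max R (x * xi).
  have jj : jap x ^+ 2 <= jap x by rewrite expr2 ler_piMr ?jap_ge0 ?jap_le1.
  apply: (@le_trans _ _ (C * jap x * 1)).
    by apply: ler_pM => //; apply: (le_trans (fC x)); rewrite ler_wpM2l.
  by rewrite mulr1 ler_wpM2r ?jap_ge0// -addrA lerDl addr_ge0// mulr_ge0.
Qed.

Lemma fourier_sin_deriv f xi : sch f -> fourier_sin (derive1 f) xi = - (xi * fourier_cos f xi).
Proof.
move=> sf; have df := sch_decay sf; have sf1 := sch_derive1 sf.
have [C C0 fC] := sch_bound 2 sf; have [D D0 fD] := sch_bound 2 sf1.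
have cf1 := decay_sin xi (sch_decay sf1); have sf0 := decay_cos xi df.
have j0 (x : R) := japX_ge0 x 2.
apply/eqP; rewrite -subr_eq0 opprK; apply/eqP.
rewrite /fourier_cos /fourier_sin -!/(Int _) -IntZ ?decay_integ// -IntD; first last.
- by apply: integZ; exact: decay_integ.
- exact: decay_integ.
apply: (@Int_deriv0 _ _ (fun x => f x * sin (x * xi)) (C + D + `|xi| * C)).
- exact: (decayD cf1 (decayZ xi sf0)).1.
- move=> x; apply: (@le_trans _ _ (D * jap x ^+ 2 * 1 + `|xi| * (C * jap x ^+ 2 * 1))).
    apply: (le_trans (ler_normD _ _)); rewrite !normrM; apply: lerD.
      by apply: ler_pM => //; exact: sin_max.
    by apply: ler_wpM2l => //; apply: ler_pM => //; exact: cos_max.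
  by have := mulr_ge0 C0 (j0 x); have := mulr_ge0 (normr_ge0 xi) (mulr_ge0 C0 (j0 x)); lra.
- move=> x; apply: hasD_eq (hasDM (sch_hasD x sf) (hasD_sin (hasD_mulr x xi))) _; ring.
- move=> x; rewrite normrM; have c1 := @sin_max R (x * xi).
  have jj : jap x ^+ 2 <= jap x by rewrite expr2 ler_piMr ?jap_ge0 ?jap_le1.
  apply: (@le_trans _ _ (C * jap x * 1)).
    by apply: ler_pM => //; apply: (le_trans (fC x)); rewrite ler_wpM2l.
  by rewrite mulr1 ler_wpM2r ?jap_ge0// -addrA lerDl addr_ge0// mulr_ge0.
Qed.

Lemma fourier_sinN f xi : decay f -> fourier_sin (fun x => - f x) xi = - fourier_sin f xi.
Proof.
move=> df; rewrite -mulN1r /fourier_sin -!/(Int _) -IntZ; last first.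
  by apply: decay_integ; exact: decay_sin.
by apply: eq_Int => x; ring.
Qed.

Lemma fourier_cos_hasD f xi : sch f ->
  hasD (fourier_cos f) xi (- fourier_sin (fun x => x * f x) xi).
Proof.
move=> sf; have sxf := sch_mulX sf; have [C C0 fC] := sch_bound 1 sxf.
have -> : - fourier_sin (fun x => x * f x) xi = Int (fun x => -1 * (x * f x * sin (x * xi))).
  by rewrite IntZ ?mulN1r//; apply: decay_integ; apply: decay_sin; exact: sch_decay.
apply: (@hasD_Int _ (fun xi x => f x * cos (x * xi))
  (fun xi x => -1 * (x * f x * sin (x * xi))) xi C).
- by move=> t; apply: decay_integ; apply: decay_cos; exact: sch_decay.
- move=> t x; apply: hasD_eq (hasDZ _ (hasD_cos (hasD_mull t x))) _; ring.
- move=> t x _; rewrite mulN1r normrN normrM -[leRHS]mulr1; apply: ler_pM; [by []|by []|exact: fC|exact: sin_max].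
Qed.

Lemma fourier_sin_hasD f xi : sch f ->
  hasD (fourier_sin f) xi (fourier_cos (fun x => x * f x) xi).
Proof.
move=> sf; have sxf := sch_mulX sf; have [C C0 fC] := sch_bound 1 sxf.
apply: (@hasD_Int _ (fun xi x => f x * sin (x * xi))
  (fun xi x => x * f x * cos (x * xi)) xi C).
- by move=> t; apply: decay_integ; apply: decay_sin; exact: sch_decay.
- move=> t x; apply: hasD_eq (hasDZ _ (hasD_sin (hasD_mull t x))) _; ring.
- move=> t x _; rewrite normrM -[leRHS]mulr1; apply: ler_pM; [by []|by []|exact: fC|exact: cos_max].
Qed.

(** Differentiation and multiplication by the frequency exchange cosine and sine transforms. The
    sums of both kinds form a class stable under the two operations, so that decay and smoothness
    follow by one induction each. *)
Definition fourier_image h := exists g1 g2, [/\ sch g1, sch g2 &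
  h = fun xi => fourier_cos g1 xi + fourier_sin g2 xi].

Lemma fourier_image_mulX h : fourier_image h -> fourier_image (fun xi => xi * h xi).
Proof.
move=> [g1 [g2 [s1 s2 ->]]]; exists (derive1 g2), (fun x => - derive1 g1 x).
split; [exact: sch_derive1|exact/schN/sch_derive1|].
apply/funext => xi; rewrite fourier_cos_deriv// fourier_sinN; last first.
  exact/sch_decay/sch_derive1.
by rewrite fourier_sin_deriv// opprK; ring.
Qed.

Lemma fourier_image_hasD h : fourier_image h -> exists2 h', fourier_image h' &
  forall xi, hasD h xi (h' xi).
Proof.
move=> [g1 [g2 [s1 s2 ->]]].
exists (fun xi => fourier_cos (fun x => x * g2 x) xi + fourier_sin (fun x => - (x * g1 x)) xi).
  exists (fun x => x * g2 x), (fun x => - (x * g1 x)).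
  by split=> //; [exact: sch_mulX|exact/schN/sch_mulX].
move=> xi; apply: hasD_eq (hasDD (fourier_cos_hasD xi s1) (fourier_sin_hasD xi s2)) _.
have dx1 : decay (fun x => x * g1 x) by exact/sch_decay/sch_mulX.
by rewrite (fourier_sinN xi dx1) addrC.
Qed.

Lemma norm_fourier_cos f xi : decay f -> `|fourier_cos f xi| <= Int (fun x => `|f x|).
Proof.
move=> df; have Ic := decay_integ (decay_cos xi df).
apply: (le_trans (Int_norm_le Ic)); apply: Int_le; first exact: integ_norm.
  exact/integ_norm/decay_integ.
by move=> x; rewrite normrM ler_piMr// cos_max.
Qed.

Lemma norm_fourier_sin f xi : decay f -> `|fourier_sin f xi| <= Int (fun x => `|f x|).
Proof.
move=> df; have Ic := decay_integ (decay_sin xi df).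
apply: (le_trans (Int_norm_le Ic)); apply: Int_le; first exact: integ_norm.
  exact/integ_norm/decay_integ.
by move=> x; rewrite normrM ler_piMr// sin_max.
Qed.

Lemma fourier_image_jap k h : fourier_image h -> exists C, forall xi, `|h xi| <= C * jap xi ^+ k.
Proof.
elim: k h => [|k IH] h Qh.
  move: Qh => [g1 [g2 [s1 s2 ->]]].
  exists (Int (fun x => `|g1 x|) + Int (fun x => `|g2 x|)) => xi; rewrite mulr1.
  apply: (le_trans (ler_normD _ _)).
  by apply: lerD; [apply: norm_fourier_cos|apply: norm_fourier_sin]; exact: sch_decay.
have [C hC] := IH _ Qh; have [D hD] := IH _ (fourier_image_mulX (fourier_image_mulX Qh)).
exists (C + D) => xi; rewrite exprS mulrCA mulrC -ler_pdivrMr ?jap_gt0// /jap invrK.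
rewrite mulrC -[X in X * `|_|]ger0_norm ?addr_ge0 ?sqr_ge0// -normrM mulrDl mul1r mulrDl.
apply: (le_trans (ler_normD _ _)); apply: lerD; first exact: hC.
by rewrite expr2 -mulrA; exact: hD.
Qed.

Lemma fourier_image_sch h : fourier_image h -> sch h.
Proof.
move=> Qh k n; elim: n h Qh => [|n IH] h Qh.
  by split=> // T; have [C hC] := fourier_image_jap k Qh; exists C => t x _.
have [h' Qh' hD] := fourier_image_hasD Qh.
apply: (@niceS _ _ _ _ (fun _ _ => 0) (fun _ => h')).
- by move=> T; have [C hC] := fourier_image_jap k Qh; exists C => t x _.
- by move=> t x; exact: hasD_cst.
- by move=> t x; exact: hD.
- move: Qh => [g1 [_ [s1 _ _]]]; have := sniceZ 0 s1.
  rewrite (_ : (fun t x => _) = (fun _ _ => 0)); first exact.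
  by apply/funext => t; apply/funext => x; rewrite mul0r.
- exact: IH.
Qed.

End FourierTransform.

(** * Fourier inversion and the Plancherel identity *)

Section Inversion.
Context {R : realType}.
Implicit Types (f g h G : R -> R).

Lemma gauss_jap k : exists C : R, forall x, expR (- x ^+ 2) <= C * jap x ^+ k.
Proof.
(* From [1 + x ^ 2 <= (k + 1) (1 + x ^ 2 / (k + 1))] and [1 + y <= exp y], raised to the power
   [k]. *)
exists (k.+1%:R ^+ k) => x; have x2 := sqr_ge0 x.
have k0 : 0 < k.+1%:R :> R by rewrite ltr0n.
rewrite /jap exprVn ler_pdivlMr ?exprn_gt0 ?ltr_pwDl// mulrC.
rewrite -ler_pdivlMr ?expR_gt0// expRN invrK.
apply: (@le_trans _ _ ((k.+1%:R * expR (x ^+ 2 / k.+1%:R)) ^+ k)).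
  apply: lerXn2r; [exact: addr_ge0|exact: mulr_ge0 (ltW k0) (expR_ge0 _)|].
  apply: (@le_trans _ _ (k.+1%:R * (1 + x ^+ 2 / k.+1%:R))).
    have -> : k.+1%:R * (1 + x ^+ 2 / k.+1%:R) = k.+1%:R + x ^+ 2.
      by move: k0; move: (k.+1%:R : R) => c c0; field; rewrite gt_eqF.
    by rewrite lerD2r ler1n.
  by apply: ler_wpM2l; [exact: ltW|exact: expR_ge1Dx].
rewrite exprMn; apply: ler_wpM2l; first exact: exprn_ge0 (ltW k0).
rewrite -expRM_natl ler_expR mulrCA ler_piMr// ler_pdivrMr// mul1r ler_nat.
exact: leqnSn.
Qed.

Lemma gauss_hasD x : hasD (fun y : R => expR (- y ^+ 2)) x (- (2 * (x * expR (- x ^+ 2)))).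
Proof.
have h : hasD (fun y : R => - y ^+ 2) x (- (2 * x)).
  by apply: hasDN; apply: hasD_eq (hasDM (hasD_id x) (hasD_id x)) _; ring.
by apply: hasD_eq (hasD_expR h) _; ring.
Qed.

Lemma gauss_sch : sch (fun x : R => expR (- x ^+ 2)).
Proof.
have bnd k : jap_bounded k (fun _ x : R => expR (- x ^+ 2)).
  by move=> T; have [C hC] := gauss_jap k; exists C => t x _; rewrite ger0_norm ?expR_ge0.
move=> k n; elim: n k => [|n IH] k; first by split=> //; exact: bnd.
apply: (@niceS _ _ _ _ (fun _ x => 0 * expR (- x ^+ 2))
  (fun _ x => - 2 * (x * expR (- x ^+ 2)))) => //.
- by move=> t x; apply: hasD_eq (hasD_cst t _) _; rewrite mul0r.
- by move=> t x; apply: hasD_eq (gauss_hasD x) _; ring.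
- by have := niceM (nice_cst n (0 : R)) (IH k).
- by have := niceM (nice_cst n (-2 : R)) (nice_mulX (IH k.+1)).
Qed.

(** Positivity forces the primitive to vanish identically, and the integrand is its derivative. *)
Lemma Int_eq0 h x : decay h -> (forall x, 0 <= h x) -> Int h = 0 -> h x = 0.
Proof.
move=> dh h0 I0; have Ih := decay_integ dh.
have p0 y : prim h y = 0.
  apply/eqP; rewrite -normr_le0; apply: (le_trans (norm_prim_le y Ih)).
  by rewrite (@eq_Int _ _ h) ?I0// => z; rewrite ger0_norm.
apply: (hasD_unique (prim_hasD x Ih (dh.1))).
by rewrite (_ : prim h = fun=> 0); [exact: hasD_cst|apply/funext].
Qed.

Lemma sch_lipschitz f : sch f -> exists2 C, 0 <= C & forall x y, `|f x - f y| <= C * `|x - y|.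
Proof.
move=> sf; have [C C0 fC] := sch_bound 0 (sch_derive1 sf); exists C => // x y.
have [c _ ->] := hasD_MVT y x (fun z => sch_hasD z sf).
by rewrite normrM ler_wpM2r//; have := fC c; rewrite mulr1.
Qed.

Lemma sch_scale f (a : R) : a != 0 -> sch f -> sch (fun x => f (a * x)).
Proof.
move=> a0 sf; have E : (fun t x => f (a * x + 0 * t)) = fun _ x => f (a * x).
  by apply/funext => t; apply/funext => x; rewrite mul0r addr0.
by have := snice_frame 0 a0 sf; rewrite E.
Qed.

Lemma sch_shift f (a : R) : sch f -> sch (fun x => f (x + a)).
Proof.
move=> sf; have E : (fun x => f (1 * x + a * 1)) = fun x => f (x + a).
  by apply/funext => x; rewrite mul1r mulr1.
by have := snice_freeze 1 (snice_frame a (oner_neq0 R) sf); rewrite E.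
Qed.

Lemma schM f g : sch f -> sch g -> sch (fun x => f x * g x).
Proof. exact: (@sniceM _ (fun _ => f) (fun _ => g)). Qed.

Lemma sch_cos f : sch f -> sch (fourier_cos f).
Proof.
move=> sf; apply: fourier_image_sch; exists f, (fun x => 0 * f x).
split=> //; first exact: (@sniceZ _ 0 (fun _ => f)).
apply/funext => xi; rewrite [X in _ + X](_ : _ = 0) ?addr0//.
rewrite /fourier_sin -/(Int _) (@eq_Int _ _ (fun x => 0 * f x)); last by move=> x; rewrite !mul0r.
by rewrite IntZ ?mul0r//; exact: sch_integ.
Qed.

Lemma sch_sin f : sch f -> sch (fourier_sin f).
Proof.
move=> sf; apply: fourier_image_sch; exists (fun x => 0 * f x), f.
split=> //; first exact: (@sniceZ _ 0 (fun _ => f)).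
apply/funext => xi; rewrite [X in X + _](_ : _ = 0) ?add0r//.
rewrite /fourier_cos -/(Int _) (@eq_Int _ _ (fun x => 0 * f x)); last by move=> x; rewrite !mul0r.
by rewrite IntZ ?mul0r//; exact: sch_integ.
Qed.

Lemma Int_dilation h G : sch h -> sch G -> exists C, forall e, 0 < e ->
  `|Int (fun x => h x * G (e * x)) - G 0 * Int h| <= e * C.
Proof.
move=> sh sG; have [K K0 GK] := sch_lipschitz sG.
have [C C0 hC] := sch_bound 1 (sch_mulX sh).
exists (K * C * pi) => e e0.
have sGe : sch (fun x => G (e * x)) by apply: sch_scale; rewrite ?gt_eqF.
have I1 := sch_integ (schM sh sGe); have I2 := sch_integ sh.
have I3 : integ (fun x => h x * G (e * x) - G 0 * h x).
  by apply: decay_integ; apply: decayB; [exact: sch_decay (schM sh sGe)|exact/decayZ/sch_decay].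
rewrite -IntZ// -IntB//; last exact: integZ.
have -> : e * (K * C * pi) = e * K * C * pi by ring.
apply: Int_bound => //.
move=> x; rewrite (_ : _ - _ = h x * (G (e * x) - G 0)); last by ring.
rewrite normrM; apply: (le_trans (ler_wpM2l (normr_ge0 _) (GK _ _))).
rewrite subr0 normrM (gtr0_norm e0).
rewrite [leLHS](_ : _ = e * K * (`|x| * `|h x|)); last by ring.
rewrite -[leRHS]mulrA; apply: ler_wpM2l; first exact: mulr_ge0 (ltW e0) K0.
by rewrite -normrM; exact: hC.
Qed.

Lemma continuous_mulr_fst_snd (t : R -> R) : continuous t ->
  measurable_fun [set: measurableTypeR R * measurableTypeR R] (fun z => t (z.2 * z.1)).
Proof.
move=> ct; apply: (@measurableT_comp _ _ _ _ _ _ t).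
  exact: continuous_measurable_fun.
by apply: measurable_funM; [exact: measurable_snd|exact: measurable_fst].
Qed.

Lemma Int_fourier_cos f g : decay f -> decay g ->
  Int (fun x => f x * fourier_cos g x) = Int (fun y => g y * fourier_cos f y).
Proof.
move=> df dg; rewrite [LHS](Int_Fubini df dg (k := fun x y => cos (y * x))).
- apply: eq_Int => y; congr (_ * _); apply: eq_Int => x; congr (_ * cos _); exact: mulrC.
- by apply: continuous_mulr_fst_snd; exact: continuous_cos.
- by move=> x; apply: continuous_osc; exact: continuous_cos.
- move=> y; rewrite (_ : (fun x => _) = fun x : R => cos (x * y)).
    by apply: continuous_osc; exact: continuous_cos.
  by apply/funext => x; rewrite mulrC.
- by move=> x y; exact: cos_max.
Qed.

Lemma Int_fourier_sin f g : decay f -> decay g ->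
  Int (fun x => f x * fourier_sin g x) = Int (fun y => g y * fourier_sin f y).
Proof.
move=> df dg; rewrite [LHS](Int_Fubini df dg (k := fun x y => sin (y * x))).
- apply: eq_Int => y; congr (_ * _); apply: eq_Int => x; congr (_ * sin _); exact: mulrC.
- by apply: continuous_mulr_fst_snd; exact: continuous_sin.
- by move=> x; apply: continuous_osc; exact: continuous_sin.
- move=> y; rewrite (_ : (fun x => _) = fun x : R => sin (x * y)).
    by apply: continuous_osc; exact: continuous_sin.
  by apply/funext => x; rewrite mulrC.
- by move=> x y; exact: sin_max.
Qed.

(** The multiplication formula is applied to [f] and [G (e x)]; a rescaling then moves the dilation
    from the transform of [G] onto [f]. *)
Lemma Int_fourier_dilation f G (e : R) : sch f -> sch G -> 0 < e ->
  Int (fun x => fourier_cos f x * G (e * x)) = Int (fun y => fourier_cos G y * f (e * y)).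
Proof.
move=> sf sG e0; have en0 : e != 0 by rewrite gt_eqF.
have sGe : sch (fun x => G (e * x)) by exact: sch_scale.
transitivity (Int (fun x => f x * fourier_cos (fun y => G (e * y)) x)).
  rewrite Int_fourier_cos; [|exact: sch_decay|exact: sch_decay].
  by apply: eq_Int => x; rewrite mulrC.
have [C C0 GC] := sch_bound 2 sG.
have dil x : fourier_cos (fun y => G (e * y)) x = e^-1 * fourier_cos G (e^-1 * x).
  rewrite /fourier_cos -!/(Int _).
  rewrite -(@Int_affine _ (fun y => G y * cos (y * (e^-1 * x))) C e 0)//.
  - by apply: eq_Int => y; rewrite addr0; congr (_ * cos _); field.
  - by have := decay_cos (e^-1 * x) (sch_decay sG) => -[].
  - move=> y; rewrite normrM -[leRHS]mulr1; apply: ler_pM; [by []|by []|exact: GC|exact: cos_max].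
have [D D0 GD] := sch_bound 2 (sch_cos sG); have [F F0 fF] := sch_bound 0 sf.
have sh : sch (fun y => fourier_cos G y * f (e * y)).
  by apply: schM; [exact: sch_cos|exact: sch_scale].
have [H H0 hH] := sch_bound 2 sh.
have ei : 0 < e^-1 by rewrite invr_gt0.
have := Int_affine 0 ei (sch_cont sh) hH.
rewrite invrK => E; apply: (mulfI en0); rewrite -E -IntZ; last first.
  apply: sch_integ; apply: schM => //; exact: sch_cos.
apply: eq_Int => x; rewrite dil addr0 (_ : e * (e^-1 * x) = x); first by field.
by rewrite mulrA mulfV// mul1r.
Qed.

(** Both sides of the previous identity converge as [e] tends to [0], to
    [G 0 * Int (fourier_cos f)] and to [f 0 * Int (fourier_cos G)]. *)
Lemma Int_fourier_cos_eq f G : sch f -> sch G ->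
  G 0 * Int (fourier_cos f) = f 0 * Int (fourier_cos G).
Proof.
move=> sf sG; have [C fC] := Int_dilation (sch_cos sf) sG.
have [D gD] := Int_dilation (sch_cos sG) sf.
apply/eqP; rewrite -subr_eq0 -normr_le0; apply/ler_addgt0Pr => e e0; rewrite add0r.
pose d := e / (1 + `|C| + `|D|).
have p0 : 0 < 1 + `|C| + `|D| by rewrite -addrA ltr_pwDl// addr_ge0.
have d0 : 0 < d by rewrite divr_gt0.
have h1 := fC d d0; have h2 := gD d d0; rewrite Int_fourier_dilation// in h1.
set I := Int (fun y => _) in h1 h2.
have h3 : d * (C + D) <= e.
  rewrite /d mulrAC ler_pdivrMr//; apply: ler_wpM2l; first exact: ltW.
  by apply: (le_trans (lerD (ler_norm C) (ler_norm D))); rewrite -addrA lerDr.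
rewrite (_ : _ - _ = (I - f 0 * Int (fourier_cos G)) - (I - G 0 * Int (fourier_cos f))).
  apply: (le_trans (ler_normB _ _)); apply: le_trans h3.
  by rewrite mulrDr addrC; exact: lerD.
by move: (G 0 * _) (f 0 * _) => p q; ring.
Qed.

Lemma fourier_cos_shift f (a xi : R) : sch f ->
  fourier_cos (fun x => f (x + a)) xi = fourier_cos f xi * cos (xi * a) + fourier_sin f xi * sin (xi * a).
Proof.
move=> sf; have [C C0 fC] := sch_bound 2 sf; have df := sch_decay sf.
have Ic := decay_integ (decay_cos xi df); have Is := decay_integ (decay_sin xi df).
rewrite mulrC [X in _ + X]mulrC /fourier_cos /fourier_sin -!/(Int _) -!IntZ// -IntD; first last.
- exact: integZ.
- exact: integZ.
pose F y := f y * cos ((y - a) * xi).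
rewrite (@eq_Int _ _ (fun x => F (1 * x + a))); last first.
  by move=> x; rewrite /F mul1r addrK.
rewrite (@Int_affine _ F C)// ?invr1 ?mul1r.
- apply: eq_Int => x; rewrite /F (_ : (x - a) * xi = x * xi - xi * a) ?cosB; ring.
- rewrite (_ : F = fun y => cos (xi * a) * (f y * cos (y * xi)) + sin (xi * a) * (f y * sin (y * xi))).
    have h1 := decayZ (cos (xi * a)) (decay_cos xi df).
    have h2 := decayZ (sin (xi * a)) (decay_sin xi df).
    exact: (decayD h1 h2).1.
  by apply/funext => x; rewrite /F (_ : (x - a) * xi = x * xi - xi * a) ?cosB; ring.
- move=> y; rewrite normrM -[leRHS]mulr1; apply: ler_pM; [by []|by []|exact: fC|exact: cos_max].
Qed.

(** The constant [2 pi] of Fourier inversion, of which only the positivity matters. *)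
Definition cF : R := Int (fourier_cos (fun x : R => expR (- x ^+ 2))).

(** [Int_fourier_cos_eq] is applied to the translate of [f] by [a] and to the Gaussian, whose value
    at [0] is [1]. *)
Lemma fourier_inversion f (a : R) : sch f ->
  fourier_cos (fourier_cos f) a + fourier_sin (fourier_sin f) a = cF * f a.
Proof.
move=> sf; have := Int_fourier_cos_eq (sch_shift a sf) gauss_sch.
rewrite expr0n oppr0 expR0 mul1r add0r mulrC => <-.
rewrite (@eq_Int _ _ (fun xi => fourier_cos f xi * cos (xi * a) + fourier_sin f xi * sin (xi * a))).
  by rewrite IntD//; apply: decay_integ; [apply: decay_cos|apply: decay_sin];
    apply: sch_decay; [exact: sch_cos|exact: sch_sin].
by move=> xi; rewrite fourier_cos_shift.
Qed.

Lemma parseval f : sch f ->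
  Int (fun xi => fourier_cos f xi ^+ 2) + Int (fun xi => fourier_sin f xi ^+ 2) =
  cF * Int (fun x => f x ^+ 2).
Proof.
move=> sf; have sc := sch_cos sf; have ss := sch_sin sf.
have df := sch_decay sf; have dc := sch_decay sc; have ds := sch_decay ss.
have -> : Int (fun xi => fourier_cos f xi ^+ 2) = Int (fun x => f x * fourier_cos (fourier_cos f) x).
  by rewrite (Int_fourier_cos df dc); apply: eq_Int => x; rewrite /= expr2.
have -> : Int (fun xi => fourier_sin f xi ^+ 2) = Int (fun x => f x * fourier_sin (fourier_sin f) x).
  by rewrite (Int_fourier_sin df ds); apply: eq_Int => x; rewrite /= expr2.
rewrite -IntD; [|exact: sch_integ (schM sf (sch_cos sc))|exact: sch_integ (schM sf (sch_sin ss))].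
rewrite -IntZ; last by apply: decay_integ; exact: decayMM.
apply: eq_Int => x; rewrite -mulrDr fourier_inversion//; ring.
Qed.

(** The Plancherel identity for the Gaussian gives the sign without computing an integral: the left
    side is positive because the cosine transform at [0] is the integral of the Gaussian, which does
    not vanish. *)
Lemma cF_gt0 : 0 < cF.
Proof.
pose g (x : R) := expR (- x ^+ 2); have sg : sch g := gauss_sch.
have g0 : g 0 = 1 by rewrite /g expr0n /= oppr0 expR0.
have I2 : 0 < Int (fun x => g x ^+ 2).
  rewrite lt_def Int_ge0 ?andbT; last by move=> x; exact: sqr_ge0.
  apply/eqP => I0; have := Int_eq0 0 (decayMM (sch_decay sg) (sch_decay sg)) (fun x => sqr_ge0 (g x)) I0.
  by rewrite g0 mulr1 => /eqP; rewrite oner_eq0.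
have sc := sch_cos sg; have ss := sch_sin sg.
rewrite -(pmulr_lgt0 _ I2) -parseval//; apply: ltr_pwDl; last first.
  by apply: Int_ge0 => x; exact: sqr_ge0.
rewrite lt_def Int_ge0 ?andbT; last by move=> x; exact: sqr_ge0.
apply/eqP => I0.
have := Int_eq0 0 (decayMM (sch_decay sc) (sch_decay sc)) (fun x => sqr_ge0 (fourier_cos g x)) I0.
move=> /eqP; rewrite mulf_eq0 orbb /fourier_cos -/(Int _) (@eq_Int _ _ g); last first.
  by move=> x; rewrite mulr0 cos0 mulr1.
move=> /eqP J0; have := Int_eq0 0 (sch_decay sg) (fun x => expR_ge0 _) J0.
by rewrite g0 => /eqP; rewrite oner_eq0.
Qed.

End Inversion.

(** * Sobolev norms of Schwartz functions *)

Section Sobolev.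
Context {R : realType}.
Local Notation mu := (@lebesgue_measure R).
Implicit Types (f g : schwartz R) (v r c : R -> R).

Lemma schwartz_sch f : sch f. Proof. exact: schwartz_snice. Qed.

Lemma sch_schwartz v : sch v -> exists f : schwartz R, (f : R -> R) = v.
Proof.
by move=> sv; exists (Schwartz (snice_schwartz_pred 0 sv)).
Qed.

Lemma measurable_sch v : sch v -> measurable_fun [set: R] v.
Proof. by move=> sv; apply: continuous_measurable_fun; exact: sch_cont. Qed.

Lemma distrB f g : distr f - distr g = distr (f - g).
Proof.
apply/funext => h; have If := sch_integ (schM (schwartz_sch f) (schwartz_sch h)).
have Ig := sch_integ (schM (schwartz_sch g) (schwartz_sch h)).
transitivity (Int (fun x => f x * h x) - Int (fun x => g x * h x)); first by [].
by rewrite -IntB//; apply: eq_Int => x; rewrite -mulrBl.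
Qed.

Lemma tempered_distr f : tempered (distr f).
Proof.
have sf := schwartz_sch f; split.
  move=> a g h; have Ig := sch_integ (schM sf (schwartz_sch g)).
  have Ih := sch_integ (schM sf (schwartz_sch h)).
  transitivity (a * Int (fun x => f x * g x) + Int (fun x => f x * h x)); last by [].
  rewrite -IntZ// -IntD//; last exact: integZ.
  apply: eq_Int => x; rewrite mulrCA -mulrDr; by [].
exists 1%N, (Int (fun x => `|f x|)) => g; rewrite !big_ord1.
have Ifg := sch_integ (schM sf (schwartz_sch g)).
apply: (le_trans (Int_norm_le Ifg)).
have If := integ_norm (sch_integ sf).
rewrite mulrC -IntZ//; apply: Int_le; [exact: integ_norm|exact: integZ|].
move=> x; rewrite normrM mulrC ler_wpM2r//.
by have := le_schwartz_seminorm 0 0 g x; rewrite expr0 mul1r.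
Qed.

Lemma fourier_function_distr f :
  fourier_function (distr f) (fourier_cos f) (fun xi => - fourier_sin f xi).
Proof.
have sf := schwartz_sch f; have sc := sch_cos sf; have ss := sch_sin sf.
split; [exact: measurable_sch|by apply: measurable_sch; exact: (schN ss)|move=> g].
have sg := schwartz_sch g; split.
- exact: (sch_integ (schM sc sg)).
- exact: (sch_integ (schM (schN ss) sg)).
- move=> c cE; transitivity (Int (fun x => f x * fourier_cos g x)).
    by rewrite -cE.
  rewrite (Int_fourier_cos (sch_decay sf) (sch_decay sg)).
  by apply: eq_Int => x; rewrite mulrC.
- move=> c cE; transitivity (- Int (fun x => f x * fourier_sin g x)).
    by rewrite -cE.
  rewrite (Int_fourier_sin (sch_decay sf) (sch_decay sg)) -mulN1r -IntZ; last first.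
    exact: (sch_integ (schM sg ss)).
  by apply: eq_Int => x; ring.
Qed.

(** The first term covers [1 + xi ^ 2 >= N ^ 2] and the second covers lower frequencies, where
    [-1 <= s] enters. *)
Lemma powR_weight_le (s N xi : R) : 0 < N -> -1 <= s -> s <= 0 ->
  (1 + xi ^+ 2) `^ s <= N `^ (2 * s) * (1 + N ^+ 2 / (1 + xi ^+ 2)).
Proof.
move=> N0 s1 s0; have N2 : 0 < N ^+ 2 by exact: exprn_gt0.
have x0 : 0 < 1 + xi ^+ 2 by rewrite ltr_pwDl ?sqr_ge0.
pose y := (1 + xi ^+ 2) / N ^+ 2; have y0 : 0 < y by exact: divr_gt0.
have -> : 1 + xi ^+ 2 = N ^+ 2 * y by rewrite /y mulrC divfK// gt_eqF.
have -> : N ^+ 2 / (N ^+ 2 * y) = y^-1.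
  by rewrite invfM mulrA mulfV ?gt_eqF// mul1r.
rewrite (powRM _ (ltW N2) (ltW y0)) -(powR_mulrn 2 (ltW N0)) -powRrM.
apply: ler_wpM2l; first exact: powR_ge0.
have [y1|y1] := leP 1 y.
  apply: (@le_trans _ _ 1); last by rewrite lerDl invr_ge0 ltW.
  by have := ler_powR y1 s0; rewrite powRr0.
have : y `^ s <= y `^ (-1) by apply: ger_powR s1; rewrite y0 ltW.
by rewrite powR_inv1 ?(ltW y0)// => /le_trans; apply; rewrite lerDr.
Qed.

Lemma powR_inv_weight_le (s N xi : R) : 0 < N -> -1 <= s -> s <= 0 ->
  ((1 + xi ^+ 2) `^ s)^-1 <= N `^ (- (2 * s)) * (1 + (1 + xi ^+ 2) / N ^+ 2).
Proof.
move=> N0 s1 s0; have N2 : 0 < N ^+ 2 by exact: exprn_gt0.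
have x0 : 0 < 1 + xi ^+ 2 by rewrite ltr_pwDl ?sqr_ge0.
pose y := (1 + xi ^+ 2) / N ^+ 2; have y0 : 0 < y by exact: divr_gt0.
have -> : (1 + xi ^+ 2) / N ^+ 2 = y by [].
have -> : 1 + xi ^+ 2 = N ^+ 2 * y by rewrite /y mulrC divfK// gt_eqF.
rewrite -powRN (powRM _ (ltW N2) (ltW y0)) -(powR_mulrn 2 (ltW N0)) -powRrM -mulrN.
apply: ler_wpM2l; first exact: powR_ge0.
have s0' : 0 <= - s by rewrite oppr_ge0.
have s1' : - s <= 1 by rewrite lerNl.
have [y1|y1] := leP 1 y.
  apply: (@le_trans _ _ y); last by rewrite lerDr.
  by have := ler_powR y1 s1'; rewrite powRr1// ltW.
apply: (@le_trans _ _ 1); last by rewrite lerDl ltW.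
have y01 : 0 < y <= 1 by rewrite y0 ltW.
by have := ger_powR y01 s0'; rewrite powRr0.
Qed.

Lemma sqrD_le (a b : R) : (a + b) ^+ 2 <= 2 * (a ^+ 2 + b ^+ 2).
Proof. by have := sqr_ge0 (a - b); rewrite !expr2; nra. Qed.

(** The loss [N ^ 2 / (1 + xi ^ 2)] in the weight at low frequencies is repaid by the factor
    [xi ^ 2] of a derivative. This is why the datum is split into [derive1 v] and a remainder
    estimated in [L ^ 2]. *)
Lemma Hs_norm_le f v r (s N B : R) : 0 < N -> -1 <= s -> s <= 0 -> 0 <= B ->
  sch v -> sch r -> (f : R -> R) = (fun x => derive1 v x + r x) ->
  2 * cF * (N `^ (2 * s) * (nrm (derive1 v) ^+ 2 + N ^+ 2 * nrm v ^+ 2) + nrm r ^+ 2)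
    <= B ^+ 2 ->
  (Hs_norm s (distr f) <= B%:E)%E.
Proof.
move=> N0 s1 s0 B0 sv sr fE leB; have sf := schwartz_sch f; have sv1 := sch_derive1 sv.
have sc := sch_cos sf; have ss := sch_sin sf.
pose w (xi : R) := (1 + xi ^+ 2) `^ s.
pose P := N `^ (2 * s); have P0 : 0 <= P by exact: powR_ge0.
pose sq v xi := fourier_cos v xi ^+ 2 + fourier_sin v xi ^+ 2.
have sq0 u xi : 0 <= sq u xi by rewrite addr_ge0 ?sqr_ge0.
have ssq u : sch u -> sch (sq u).
  by move=> su; apply: (@sniceD _ (fun _ xi => fourier_cos u xi ^+ 2));
    apply: (@sniceXS _ (fun _ => _) 1); [exact: sch_cos|exact: sch_sin].
have Isq u : sch u -> Int (sq u) = cF * nrm u ^+ 2.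
  move=> su; rewrite nrm_sq -parseval// -IntD//; apply: decay_integ; apply: sch_decay;
    apply: (@sniceXS _ (fun _ => _) 1); [exact: sch_cos|exact: sch_sin].
pose H xi := 2 * (P * (sq (derive1 v) xi + N ^+ 2 * sq v xi) + sq r xi).
have I1 := sch_integ (ssq _ sv1); have I2 := sch_integ (ssq _ sv); have I3 := sch_integ (ssq _ sr).
have I4 := integD I1 (integZ (N ^+ 2) I2).
have I5 := integD (integZ P I4) I3.
have IH : integ H by exact: integZ.
have HE : Int H = 2 * cF * (P * (nrm (derive1 v) ^+ 2 + N ^+ 2 * nrm v ^+ 2) + nrm r ^+ 2).
  rewrite /H IntZ// IntD//; last exact: integZ.
  rewrite IntZ// IntD//; last exact: integZ.
  by rewrite IntZ// !Isq//; ring.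
have w0 xi : 0 <= w xi by exact: powR_ge0.
have le_wH xi : w xi * sq f xi <= H xi.
  have x0 : 0 < 1 + xi ^+ 2 by rewrite ltr_pwDl ?sqr_ge0.
  have cE : fourier_cos f xi = xi * fourier_sin v xi + fourier_cos r xi.
    rewrite -fourier_cos_deriv// /fourier_cos fE -!/(Int _) -IntD.
    - by apply: eq_Int => x; rewrite mulrDl.
    - by apply: decay_integ; apply: decay_cos; exact: sch_decay.
    - by apply: decay_integ; apply: decay_cos; exact: sch_decay.
  have sE : fourier_sin f xi = - (xi * fourier_cos v xi) + fourier_sin r xi.
    rewrite -fourier_sin_deriv// /fourier_sin fE -!/(Int _) -IntD.
    - by apply: eq_Int => x; rewrite mulrDl.
    - by apply: decay_integ; apply: decay_sin; exact: sch_decay.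
    - by apply: decay_integ; apply: decay_sin; exact: sch_decay.
  have sqv : sq (derive1 v) xi = xi ^+ 2 * sq v xi.
    by rewrite /sq fourier_cos_deriv// fourier_sin_deriv//; ring.
  have h1 : sq f xi <= 2 * (sq (derive1 v) xi + sq r xi).
    have := lerD (sqrD_le (xi * fourier_sin v xi) (fourier_cos r xi))
      (sqrD_le (- (xi * fourier_cos v xi)) (fourier_sin r xi)).
    rewrite -cE -sE => /le_trans; apply; rewrite sqv /sq.
    by rewrite le_eqVlt; apply/orP; left; apply/eqP; ring.
  apply: (le_trans (ler_wpM2l (w0 xi) h1)).
  rewrite /H mulrCA ler_wpM2l// mulrDr; apply: lerD; last first.
    rewrite ler_piMl//.
    have x1 : 1 <= 1 + xi ^+ 2 by rewrite lerDl sqr_ge0.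
    by have := ler_powR x1 s0; rewrite powRr0.
  rewrite sqv; apply: (le_trans (ler_wpM2r _ (powR_weight_le xi N0 s1 s0))).
    by rewrite mulr_ge0 ?sqr_ge0.
  rewrite -/P -[leLHS]mulrA ler_wpM2l// mulrA -[X in _ <= X]mulrDl ler_wpM2r//.
  rewrite mulrDl mul1r lerD2l -mulrA ler_piMr ?sqr_ge0//.
  by rewrite mulrC ler_pdivrMr// mul1r lerDr.
apply: (@le_trans _ _ ((\int[mu]_xi (w xi * (fourier_cos f xi ^+ 2 + (- fourier_sin f xi) ^+ 2))%:E) `^ 2^-1)%E).
  apply: ereal_inf_lbound; exists (fourier_cos f), (fun xi => - fourier_sin f xi).
  by split; first exact: fourier_function_distr.
have intle : (\int[mu]_xi (w xi * (fourier_cos f xi ^+ 2 + (- fourier_sin f xi) ^+ 2))%:E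
    <= (B ^+ 2)%:E)%E.
  apply: (@le_trans _ _ (\int[mu]_xi (H xi)%:E)%E); last first.
    by rewrite IntE// lee_fin HE.
  apply: ge0_le_integral => //.
  - by move=> xi _; rewrite lee_fin mulr_ge0 ?addr_ge0 ?sqr_ge0.
  - apply/measurable_EFinP; apply: measurable_funM.
      apply: (@measurableT_comp _ _ _ _ _ _ (fun x => x `^ s)); first exact: measurable_powR.
      by apply: measurable_funD => //; exact: measurable_funX.
    by apply: measurable_funD; apply: measurable_funX; [|apply: measurableT_comp => //];
      apply: measurable_sch; [exact: sc|exact: ss].
  - by apply/measurable_EFinP; apply: measurable_sch; rewrite /H;
      apply: (@sniceZ _ 2 (fun _ => _)); apply: (@sniceD _ (fun _ => _) (fun _ => _)) (ssq _ sr);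
      apply: (@sniceZ _ P (fun _ => _)); apply: (@sniceD _ (fun _ => _) (fun _ => _)) (ssq _ sv1) _;
      apply: (@sniceZ _ (N ^+ 2) (fun _ => _)); exact: ssq.
  - by move=> xi _; rewrite lee_fin; apply: le_trans (le_wH xi); rewrite sqrrN.
have i0 : (0 <= \int[mu]_xi (w xi * (fourier_cos f xi ^+ 2 + (- fourier_sin f xi) ^+ 2))%:E)%E.
  by apply: integral_ge0 => xi _; rewrite lee_fin mulr_ge0 ?addr_ge0 ?sqr_ge0.
move: intle i0; case: (\int[mu]_xi _)%E => [y| |]//=; rewrite !lee_fin => yB y0.
rewrite powR12_sqrt// -(ger0_norm B0) -sqrtr_sqr; exact: ler_wsqrtr.
Qed.

Lemma Hs_distr f s : -1 <= s -> s <= 0 -> Hs s (distr f).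
Proof.
move=> s1 s0; split; first exact: tempered_distr.
have sf := schwartz_sch f.
(* The zero function, so that all of [f] counts as remainder in [Hs_norm_le]. *)
pose z : R -> R := fun x => 0 * f x.
have sz : sch z by exact: (@sniceZ _ 0 (fun _ => f)).
pose X : R := 2 * cF * (1 `^ (2 * s) * (nrm (derive1 z) ^+ 2 + 1 ^+ 2 * nrm z ^+ 2) + nrm f ^+ 2).
pose B := Num.sqrt X.
apply: (@le_lt_trans _ _ B%:E); last exact: ltry.
apply: (@Hs_norm_le f z f s 1) => //; first exact: sqrtr_ge0.
  apply/funext => x; rewrite (@hasD_derive1 _ _ _ 0) ?add0r//.
  rewrite /z; apply: hasD_ext (hasD_cst x 0) => y; by rewrite mul0r.
have c0 : 0 <= cF :> R by exact: ltW cF_gt0.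
have p0 : 0 <= 1 `^ (2 * s) :> R by exact: powR_ge0.
by rewrite /B (sqr_sqrtr (a := X)) ?lexx// /X; nn.
Qed.

Lemma ler_norm_AMGM (x a p : R) : 0 < x -> `|a * p| <= x * a ^+ 2 + x^-1 * p ^+ 2.
Proof.
move=> x0; have := sqr_ge0 (x * `|a| - `|p|).
rewrite normrM -(real_normK (num_real a)) -(real_normK (num_real p)).
move: (normr_ge0 a) (normr_ge0 p); move: `|a| `|p| => y q y0 q0 h.
rewrite -(ler_pM2l x0) mulrDr mulrA mulrA mulVKf ?gt_eqF//.
by move: h; rewrite !expr2; have := mulr_ge0 (ltW x0) (mulr_ge0 y0 q0); nra.
Qed.

(** The representative [a + i b] of the transform of [distr f] is reached only
    through test functions: by inversion, [cF * c] is the sum of the cosine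
    transform of [fourier_cos c] and the sine transform of [fourier_sin c]. *)
Lemma Hs_norm_dual f c (s N eps lam : R) : 0 < N -> -1 <= s -> s <= 0 -> 0 < lam -> 0 < eps ->
  sch c -> (Hs_norm s (distr f) < eps%:E)%E ->
  cF * `|Int (fun x => f x * c x)| <= lam * eps ^+ 2 +
    lam^-1 * (N `^ (- (2 * s)) *
      (cF * (nrm c ^+ 2 + (N ^+ 2)^-1 * (nrm c ^+ 2 + nrm (derive1 c) ^+ 2)))).
Proof.
move=> N0 s1 s0 l0 e0 sc /ereal_inf_lt[_ [a [b [[ma mb ab] ->]]] Ilt].
have sf := schwartz_sch f; have scc := sch_cos sc; have sss := sch_sin sc.
have sc1 := sch_derive1 sc.
pose w (xi : R) := (1 + xi ^+ 2) `^ s.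
have x0 (xi : R) : 0 < 1 + xi ^+ 2 by rewrite ltr_pwDl ?sqr_ge0.
have w0 xi : 0 < w xi by exact: powR_gt0.
pose q xi := w xi * (a xi ^+ 2 + b xi ^+ 2).
have q0 xi : 0 <= q xi by rewrite mulr_ge0 ?addr_ge0 ?sqr_ge0// ltW.
have i0 : (0 <= \int[mu]_xi (q xi)%:E)%E by apply: integral_ge0 => xi _; rewrite lee_fin.
have ilt : (\int[mu]_xi (q xi)%:E <= (eps ^+ 2)%:E)%E.
  move: Ilt i0; rewrite -/w; rewrite -/(q _).
  case: (\int[mu]_xi _)%E => [y| |]//=; last by rewrite invr_eq0 pnatr_eq0.
  rewrite lte_fin !lee_fin => + y0; rewrite powR12_sqrt// => ye.
  by rewrite -(sqr_sqrtr y0) lerXn2r ?nnegrE ?sqrtr_ge0 ?(ltW e0) ?(ltW ye).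
have mq : measurable_fun setT q.
  apply: measurable_funM.
    apply: (@measurableT_comp _ _ _ _ _ _ (fun x => x `^ s)); first exact: measurable_powR.
    by apply: measurable_funD => //; exact: measurable_funX.
  by apply: measurable_funD; exact: measurable_funX.
have Iq : integ q.
  apply/integrableP; split; first exact/measurable_EFinP.
  apply: (le_lt_trans _ (ltry (eps ^+ 2))); apply: le_trans ilt.
  rewrite le_eqVlt; apply/orP; left; apply/eqP; apply: eq_integral => xi _.
  by rewrite /= ger0_norm.
have qe : Int q <= eps ^+ 2 by rewrite -lee_fin -IntE.
have [f1 f1E] := sch_schwartz scc; have [f2 f2E] := sch_schwartz sss.
have [g1 g1E] := sch_schwartz (sch_cos scc); have [g2 g2E] := sch_schwartz (sch_sin sss).
have [Ia _ Ea _] := ab f1; have [_ Ib _ Eb] := ab f2.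
have {}Ea := Ea g1; rewrite g1E f1E in Ea; have {}Ea := Ea erefl.
have {}Eb := Eb g2; rewrite g2E f2E in Eb; have {}Eb := Eb erefl.
have split_f : cF * Int (fun x => f x * c x) =
    Int (fun xi => a xi * fourier_cos c xi) - Int (fun xi => b xi * fourier_sin c xi).
  have -> : Int (fun xi => a xi * fourier_cos c xi) = Int (fun x => f x * g1 x) by exact: esym Ea.
  have -> : Int (fun xi => b xi * fourier_sin c xi) = - Int (fun x => f x * g2 x) by exact: esym Eb.
  rewrite opprK g1E g2E -IntD; [|exact: sch_integ (schM sf (sch_cos scc))|exact: sch_integ (schM sf (sch_sin sss))].
  rewrite -IntZ; last exact: sch_integ (schM sf sc).
  by apply: eq_Int => x; rewrite -mulrDr fourier_inversion//; ring.
pose sq v xi := fourier_cos v xi ^+ 2 + fourier_sin v xi ^+ 2.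
have sq0 u xi : 0 <= sq u xi by rewrite addr_ge0 ?sqr_ge0.
have ssq u : sch u -> sch (sq u).
  by move=> su; apply: (@sniceD _ (fun _ xi => fourier_cos u xi ^+ 2));
    apply: (@sniceXS _ (fun _ => _) 1); [exact: sch_cos|exact: sch_sin].
have Isq u : sch u -> Int (sq u) = cF * nrm u ^+ 2.
  move=> su; rewrite nrm_sq -parseval// -IntD//; apply: decay_integ; apply: sch_decay;
    apply: (@sniceXS _ (fun _ => _) 1); [exact: sch_cos|exact: sch_sin].
pose P := N `^ (- (2 * s)); have P0 : 0 <= P by exact: powR_ge0.
pose H xi := P * (sq c xi + (N ^+ 2)^-1 * (sq c xi + sq (derive1 c) xi)).
have I1 := sch_integ (ssq _ sc); have I2 := sch_integ (ssq _ sc1).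
have I3 := integD I1 (integZ (N ^+ 2)^-1 (integD I1 I2)).
have IH : integ H by exact: integZ.
have HE : Int H = P * (cF * (nrm c ^+ 2 + (N ^+ 2)^-1 * (nrm c ^+ 2 + nrm (derive1 c) ^+ 2))).
  have I4 := integD I1 I2.
  rewrite /H (IntZ _ I3) (IntD I1 (integZ _ I4)) (IntZ _ I4) (IntD I1 I2) !Isq//.
  by move: (nrm c ^+ 2) (nrm _ ^+ 2) (N ^+ 2)^-1 => y z t; ring.
(* The weight goes to [a] and [b], which are known only through the Sobolev norm, and its inverse to
   the transforms of [c]; [lam] stays free for later optimisation. *)
have pt xi : `|a xi * fourier_cos c xi - b xi * fourier_sin c xi| <= lam * q xi + lam^-1 * H xi.
  apply: (le_trans (ler_normB _ _)).
  have lw : 0 < lam * w xi by exact: mulr_gt0.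
  apply: (le_trans (lerD (ler_norm_AMGM _ _ lw) (ler_norm_AMGM _ _ lw))).
  rewrite addrACA -!mulrDr; apply: lerD; first by rewrite /q mulrA.
  rewrite invfM -mulrA ler_wpM2l ?invr_ge0 ?(ltW l0)// -/(sq c xi).
  apply: (le_trans (ler_wpM2r (sq0 _ _) (powR_inv_weight_le xi N0 s1 s0))).
  rewrite -/P -mulrA /H ler_wpM2l//.
  have -> : sq (derive1 c) xi = xi ^+ 2 * sq c xi.
    by rewrite /sq fourier_cos_deriv// fourier_sin_deriv//; ring.
  by rewrite le_eqVlt; apply/orP; left; apply/eqP; ring.
have Iab : integ (fun xi => a xi * fourier_cos c xi - b xi * fourier_sin c xi).
  have Ia' : integ (fun xi => a xi * fourier_cos c xi) by rewrite -f1E.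
  have Ib' : integ (fun xi => -1 * (b xi * fourier_sin c xi)) by rewrite -f2E; exact: integZ.
  have := integD Ia' Ib'; congr integ; apply/funext => xi; by rewrite mulN1r.
have Ia' : integ (fun xi => a xi * fourier_cos c xi) by rewrite -f1E.
have Ib' : integ (fun xi => b xi * fourier_sin c xi) by rewrite -f2E.
rewrite -[X in X * _](gtr0_norm cF_gt0) -normrM split_f -IntB//.
apply: (le_trans (Int_norm_le Iab)).
apply: (@le_trans _ _ (Int (fun xi => lam * q xi + lam^-1 * H xi))).
  apply: Int_le; [exact: integ_norm|by apply: integD; exact: integZ|exact: pt].
rewrite IntD; [|exact: integZ|exact: integZ].
rewrite (IntZ _ Iq) (IntZ _ IH) HE lerD2r ler_wpM2l//; exact: ltW.
Qed.

End Sobolev.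

(** * Separation of two modulated waves *)

Section Pairing.
Context {R : realType}.

Lemma nrm_le (f g : R -> R) : decay f -> decay g -> (forall x, `|f x| <= g x) ->
  nrm f <= nrm g.
Proof.
move=> df dg fg; apply: ler_wsqrtr; apply: Int_le.
- exact: decay_integ (decayMM df df).
- exact: decay_integ (decayMM dg dg).
- move=> x; rewrite -(real_normK (num_real (f x))) lerXn2r ?nnegrE//.
  exact: le_trans (fg x).
Qed.

Lemma Int_by_parts (f g : R -> R -> R) t : snice f -> snice g ->
  Int (fun x => dx f t x * g t x) = - Int (fun x => f t x * dx g t x).
Proof.
move=> sf sg; have sf1 := snice_dx sf; have sg1 := snice_dx sg.
have D t' x : hasD (fun x => f t' x * g t' x) x (dx f t' x * g t' x + f t' x * dx g t' x).
  by apply: hasDM; exact: snice_dxD.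
apply/eqP; rewrite -addr_eq0 -IntD; [|exact: snice_integ (sniceM sf1 sg)|exact: snice_integ (sniceM sf sg1)].
by have := Int_dx0 t (sniceM sf sg); rewrite (dxE D) => ->.
Qed.

Variables (kap A : R) (p q : R -> R -> R).
Hypotheses (sp : snice p) (sq : snice q).

Let cc := carrier_cos kap A.
Let cs := carrier_sin kap A.
Definition main_wave := wave cc cs p q.
(** In phase with the derivative of [main_wave], up to the factor [kap]. *)
Definition test_wave := wave cc cs (fun t x => - q t x) p.

Lemma snice_main_wave : snice main_wave.
Proof. by have [bc bs] := bnice_carrier kap A; exact: snice_wave. Qed.

Lemma snice_test_wave : snice test_wave.
Proof. by have [bc bs] := bnice_carrier kap A; apply: snice_wave => //; exact: sniceN. Qed.

Lemma dx_main_wave t x : dx main_wave t x =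
  (dx p t x - kap * q t x) * cc t x - (dx q t x + kap * p t x) * cs t x.
Proof.
have [bc bs] := bnice_carrier kap A.
rewrite /main_wave (dx_wave (carrier_cos_x kap A) (carrier_sin_x kap A) sp sq) /wave.
by rewrite mul1r.
Qed.

Lemma dx_test_wave t x : dx test_wave t x =
  - (kap * main_wave t x) - (dx q t x * cc t x + dx p t x * cs t x).
Proof.
have [bc bs] := bnice_carrier kap A.
rewrite /test_wave (dx_wave (carrier_cos_x kap A) (carrier_sin_x kap A) (sniceN sq) sp) /wave.
have -> : dx (fun t x => - q t x) = fun t x => - dx q t x.
  by apply: dxE => u y; apply: hasDN; exact: snice_dxD.
by rewrite /main_wave /wave -/cc -/cs; gring.
Qed.

(** By parts, the left side is half the integral of
    [main_wave' * test_wave - main_wave * test_wave'], where the oscillation cancels. *)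
Lemma Int_main_test t : Int (fun x => dx main_wave t x * test_wave t x) =
  kap / 2 * Int (fun x => p t x ^+ 2 + q t x ^+ 2) +
  2^-1 * Int (fun x => dx q t x * p t x - dx p t x * q t x).
Proof.
have sW := snice_main_wave; have sT := snice_test_wave.
have sW1 := snice_dx sW; have sT1 := snice_dx sT.
have sp1 := snice_dx sp; have sq1 := snice_dx sq.
have I0 : Int (fun x => dx main_wave t x * test_wave t x + main_wave t x * dx test_wave t x) = 0.
  rewrite IntD ?Int_by_parts ?addNr//; [exact: snice_integ (sniceM sW1 sT)|exact: snice_integ (sniceM sW sT1)].
have s1 : snice (fun t x => p t x ^+ 2 + q t x ^+ 2) by snice_tac.
have s2 : snice (fun t x => dx q t x * p t x - dx p t x * q t x) by snice_tac.
have s3 : snice (fun t x => dx main_wave t x * test_wave t x +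
  main_wave t x * dx test_wave t x) by snice_tac.
rewrite -[LHS]subr0 -(mulr0 2^-1) -I0.
have i1 := snice_integ t s1; have i2 := snice_integ t s2; have i3 := snice_integ t s3.
rewrite -(IntZ _ i1) -(IntZ _ i2) -(IntZ _ i3).
rewrite -(IntD (integZ _ i1) (integZ _ i2)) -(IntB (snice_integ t (sniceM sW1 sT)) (integZ _ i3)).
apply: eq_Int => x; rewrite dx_main_wave dx_test_wave /main_wave /test_wave /wave.
have := carrier_sq kap A t x; rewrite -/cc -/cs.
move: (cc t x) (cs t x) => c s cs1.
rewrite (_ : kap / 2 * (p t x ^+ 2 + q t x ^+ 2) + 2^-1 * (dx q t x * p t x - dx p t x * q t x) =
  (c ^+ 2 + s ^+ 2) * (kap / 2 * (p t x ^+ 2 + q t x ^+ 2) + 2^-1 * (dx q t x * p t x - dx p t x * q t x))).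
  by clear cs1; gen_atoms; field.
by rewrite cs1 mul1r.
Qed.

Variables (t K : R) (phi : R -> R).
Hypothesis dphi : decay phi.
Hypotheses (p_le : forall x, `|p t x| <= K * phi x) (q_le : forall x, `|q t x| <= K * phi x).

Lemma main_wave_le x : `|main_wave t x| <= 2 * K * phi x.
Proof.
have := norm_wave (carrier_cos_le1 kap A t x) (carrier_sin_le1 kap A t x) (p_le x) (q_le x).
by rewrite mulr1 mulrA.
Qed.

Lemma test_wave_le x : `|test_wave t x| <= 2 * K * phi x.
Proof.
have qN y : `|- q t y| <= K * phi y by rewrite normrN.
have := @norm_wave R cc cs (fun t x => - q t x) p t x _ _ (carrier_cos_le1 kap A t x)
  (carrier_sin_le1 kap A t x) (qN x) (p_le x).
by rewrite mulr1 mulrA.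
Qed.

Lemma nrm_test_wave : 0 <= K -> nrm (test_wave t) <= 2 * K * nrm phi.
Proof.
move=> K0; rewrite -nrmZ ?mulr_ge0//; apply: nrm_le; last exact: test_wave_le.
  exact: snice_decay snice_test_wave.
exact: decayZ.
Qed.

Lemma nrm_dx_test_wave : 0 <= K -> 0 <= kap ->
  nrm (dx test_wave t) <= kap * (2 * K * nrm phi) + (nrm (dx p t) + nrm (dx q t)).
Proof.
move=> K0 k0; have sp1 := snice_dx sp; have sq1 := snice_dx sq.
have dp := decay_norm (snice_decay t sp1); have dq := decay_norm (snice_decay t sq1).
have d1 := decayZ (kap * (2 * K)) dphi.
apply: (@le_trans _ _ (nrm (fun x => kap * (2 * K) * phi x + (`|dx p t x| + `|dx q t x|)))).
  apply: nrm_le; first exact: snice_decay (snice_dx snice_test_wave).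
    by apply: decayD => //; exact: decayD.
  move=> x; rewrite dx_test_wave (le_trans (ler_normB _ _))// normrN; apply: lerD.
    by rewrite -mulrA; apply: norm_leZ => //; exact: main_wave_le.
  rewrite addrC (le_trans (ler_normD _ _))// !normrM; apply: lerD.
    by rewrite ler_piMr// carrier_sin_le1.
  by rewrite ler_piMr// carrier_cos_le1.
apply: (le_trans (nrm_triangle d1 (decayD dp dq))); apply: lerD.
  by rewrite nrmZ ?mulrA// !mulr_ge0.
by apply: (le_trans (nrm_triangle dp dq)); rewrite !nrm_norm.
Qed.

End Pairing.

(** * Phase separation of two solutions *)

Section Lower.
Context {R : realType}.

Definition gauss (x : R) : R := expR (- x ^+ 2).

Lemma sch_gauss : sch gauss. Proof. exact: gauss_sch. Qed.

Lemma gauss_ge0 x : 0 <= gauss x. Proof. exact: expR_ge0. Qed.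

Lemma gauss_le1 x : gauss x <= 1.
Proof. by rewrite /gauss -expR0 ler_expR oppr_le0 sqr_ge0. Qed.

Lemma decay_gauss : decay gauss. Proof. exact: sch_decay sch_gauss. Qed.

(** Half of a lower bound for the squared [L ^ 2] distance of two envelopes whose phases differ by
    [gauss ^ 2]. *)
Definition cphi : R := Int (fun x => gauss x ^+ 2 * (1 - cos (gauss x ^+ 2))).

Lemma decay_cphi : decay (fun x => gauss x ^+ 2 * (1 - cos (gauss x ^+ 2))).
Proof.
have s2 : snice (fun _ x : R => gauss x ^+ 2) by apply: (@sniceXS _ (fun _ => gauss) 1); exact: sch_gauss.
have s3 := sniceMb s2 (bnice_cos (snice_bnice s2)).
have := snice_decay 0 (sniceB s2 s3); congr decay.
by apply/funext => x; rewrite mulrBr mulr1.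
Qed.

Lemma cphi_gt0 : 0 < cphi.
Proof.
have h0 x : 0 <= gauss x ^+ 2 * (1 - cos (gauss x ^+ 2)).
  by rewrite mulr_ge0 ?sqr_ge0// subr_ge0 cos_le1.
rewrite lt_def Int_ge0// andbT; apply/eqP => I0.
have := Int_eq0 0 decay_cphi h0 I0.
rewrite /gauss expr0n /= oppr0 expR0 expr1n mul1r => /eqP; rewrite subr_eq0 eq_sym => /eqP c1.
have s1 : 0 < sin (1 : R).
  apply: sin_gt0_pi; rewrite ltr01/=; apply: lt_le_trans (pi_ge2 R).
  by rewrite ltr1n.
have := cos2Dsin2 (1 : R); rewrite c1 expr1n => /eqP.
rewrite -subr_eq0 addrAC subrr add0r sqrf_eq0 => /eqP s0.
by rewrite s0 ltxx in s1.
Qed.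

Variables (b1 b2 tau C : R).
Hypotheses (b1_gt0 : 0 < b1) (b12 : b1 <= b2) (b21 : b2 <= 4 * b1).
Hypotheses (tau0 : 0 < tau) (tau1 : tau <= 1) (btau : (b2 - b1) * tau = 1) (C1 : 1 <= C).

Let r := Num.sqrt (b2 / b1).

Let b2_gt0 : 0 < b2. Proof. exact: lt_le_trans b12. Qed.

Lemma ratio_sq : r ^+ 2 = b2 / b1.
Proof. by rewrite sqr_sqrtr// divr_ge0// ltW. Qed.

Lemma ratio_ge1 : 1 <= r.
Proof.
by rewrite -(@ler_pXn2r _ 2)// ?nnegrE ?sqrtr_ge0// ratio_sq expr1n ler_pdivlMr// mul1r.
Qed.

Lemma ratio_le2 : r <= 2.
Proof.
rewrite -(@ler_pXn2r _ 2)// ?nnegrE ?sqrtr_ge0// ratio_sq ler_pdivrMr//.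
by apply: (le_trans b21); rewrite expr2 -natrM.
Qed.

Lemma ratioE rho1 rho2 (m : R) : 0 < rho1 -> 0 < rho2 ->
  rho1 ^+ 2 = 2 * b1 / (3 * m ^+ 2) -> rho2 ^+ 2 = 2 * b2 / (3 * m ^+ 2) -> rho2 = r * rho1.
Proof.
move=> r1 r2 e1 e2.
apply: (@pexpIrn _ 2) => //; rewrite ?nnegrE ?mulr_ge0 ?sqrtr_ge0 ?(ltW r1) ?(ltW r2)//.
rewrite exprMn ratio_sq e1 e2 [RHS]mulrA; congr (_ / _).
by field; rewrite gt_eqF.
Qed.

Let p t x := env_cos gauss b1 t x - r * env_cos gauss b2 t x.
Let q t x := env_sin gauss b1 t x - r * env_sin gauss b2 t x.

Let sp : snice p.
Proof. by apply: sniceB; [|apply: sniceZ]; exact: (snice_env_cos _ sch_gauss). Qed.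

Let sq : snice q.
Proof. by apply: sniceB; [|apply: sniceZ]; exact: (snice_env_sin _ sch_gauss). Qed.

Let env_le (a b : R) x : `|a| <= 1 -> `|b| <= 1 -> `|gauss x * a - r * (gauss x * b)| <= 3 * gauss x.
Proof.
move=> a1 h1; have g0 := gauss_ge0 x; have r2 := ratio_le2; have r1 := ratio_ge1.
apply: (le_trans (ler_normB _ _)).
rewrite (_ : 3 * gauss x = gauss x * 1 + 2 * (gauss x * 1)); last by ring.
apply: lerD; first exact: norm_leZ.
rewrite normrM; apply: ler_pM => //; last exact: norm_leZ.
by rewrite ger0_norm// (le_trans _ r1).
Qed.

Let p_le x : `|p tau x| <= 3 * gauss x.
Proof. by apply: env_le; exact: cos_max. Qed.

Let q_le x : `|q tau x| <= 3 * gauss x.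
Proof. by apply: env_le; exact: sin_max. Qed.

(** At time [tau] the phases differ by [(b2 - b1) * tau * gauss ^ 2 = gauss ^ 2]. The amplitude
    ratio [r >= 1] does not reduce the bound, since [1 + r ^ 2 - 2 r y >= 2 (1 - y)] for
    [y <= 1]. *)
Let pq_ge : 2 * cphi <= Int (fun x => p tau x ^+ 2 + q tau x ^+ 2).
Proof.
have Ic := decay_integ decay_cphi.
rewrite -IntZ//; apply: Int_le; first exact: integZ.
  have s := sniceD (sniceXS 1 sp) (sniceXS 1 sq).
  exact: (snice_integ tau s).
move=> x; rewrite /p /q /env_cos /env_sin.
have r1 := ratio_ge1; set g := gauss x.
set a := b1 * tau * (g * g); set b := b2 * tau * (g * g).
have : cos (b - a) <= 1 by exact: cos_le1.
have E : b - a = g ^+ 2 by rewrite -[g ^+ 2]mul1r -btau /a /b; ring.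
rewrite -{2}E cosB; move: (cos2Dsin2 a) (cos2Dsin2 b).
clearbody a b; clear E; move: (cos b) (sin b) (cos a) (sin a) => c2 s2 c1 s1 h1 h2 le1.
have -> : (g * c1 - r * (g * c2)) ^+ 2 + (g * s1 - r * (g * s2)) ^+ 2 =
  g ^+ 2 * ((c1 ^+ 2 + s1 ^+ 2) + r ^+ 2 * (c2 ^+ 2 + s2 ^+ 2) - 2 * r * (c2 * c1 + s2 * s1)) by ring.
rewrite h1 h2 mulrCA ler_wpM2l ?sqr_ge0//.
move: (c2 * c1 + s2 * s1) le1 => y le1; have := sqr_ge0 (r - 1).
have : 0 <= (r - 1) * (1 - y) by rewrite mulr_ge0 ?subr_ge0.
by rewrite !expr2; lra.
Qed.

Let env_error (b : R) : 0 < b -> exists2 L, 0 <= L & forall (kap m rho : R) (w : R -> R -> R),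
  0 < m -> m <= 1 -> 1 <= kap -> 1 <= kap * m ^+ 2 -> snice w ->
  nrm (fun x => rho^-1 * w tau x - approx gauss b kap (kap ^+ 2 * m ^+ 2) tau x) <= C * m ^+ 2 ->
  nrm (fun x => rho^-1 * w tau x - wave (carrier_cos kap (kap ^+ 2 * m ^+ 2))
    (carrier_sin kap (kap ^+ 2 * m ^+ 2)) (env_cos gauss b) (env_sin gauss b) tau x) <= L * m ^+ 2.
Proof.
move=> b0; have [K K1 bK] := common_bound (all_snice_env_list b sch_gauss).
have K0 : 0 <= K by exact: le_trans K1.
have c0 : 0 <= cpi :> R by exact: ltW cpi_gt0.
have b0' := ltW b0; have C0 : 0 <= C by exact: le_trans C1.
exists (C + b * K * cpi); first by nn.
move=> kap m rho w m0 m1 k1 km sw; set A := kap ^+ 2 * m ^+ 2 => hw.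
have k0 : 0 <= kap by exact: le_trans k1.
have A1 : 1 <= A by rewrite /A expr2 -mulrA; exact: mulr_ege1.
have A0 : 0 < A by exact: lt_le_trans A1.
have Ai : A^-1 <= m ^+ 2.
  rewrite -[A^-1]mul1r ler_pdivrMr// /A (_ : m ^+ 2 * _ = (kap * m ^+ 2) ^+ 2); last by ring.
  by rewrite exprn_ege1.
have t1 : `|tau| <= 1 by rewrite gtr0_norm.
set V := wave _ _ _ _; have sV : snice V.
  have [bc bs] := bnice_carrier kap A.
  by apply: snice_wave => //; [exact: (snice_env_cos _ sch_gauss)|exact: (snice_env_sin _ sch_gauss)].
have sVa : snice (approx gauss b kap A) by exact: (snice_approx _ sch_gauss).
have -> : (fun x => rho^-1 * w tau x - V tau x) = (fun x =>
    (rho^-1 * w tau x - approx gauss b kap A tau x) + (approx gauss b kap A tau x - V tau x)).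
  by apply/funext => x; rewrite addrA subrK.
have d1 := snice_decay tau (sniceB (sniceZ rho^-1 sw) sVa).
have d2 := snice_decay tau (sniceB sVa sV).
rewrite mulrDl; apply: (le_trans (nrm_triangle d1 d2)); apply: lerD => //.
apply: (@le_trans _ _ (8 * (b / (24 * A)) * K * cpi)).
  apply: nrm_jap_le => //; first by rewrite !mulr_ge0// ?invr_ge0 ?mulr_ge0// ltW.
  by move=> x; rewrite -[leRHS]mulrA; exact: (approx_sub_le b0 kap A1 bK x t1).
rewrite (_ : 8 * _ * K * cpi = b * K * cpi * (3^-1 * A^-1)); last by field; rewrite gt_eqF.
apply: ler_wpM2l; first by nn.
by apply: le_trans Ai; rewrite ler_piMl ?invr_ge0 ?(ltW A0)// invf_le1// ler1n.
Qed.

(** The witness [c0] is the wave in quadrature with the difference of the two ansatz waves, so its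
    pairing with the derivative of that difference has size [rho1 * kap]. The parameter [z]
    dominates both [m] and [1 / (kap * m ^ 2)], and [K] does not depend on the scales. *)
Theorem frame_lower : exists2 K, 0 <= K & forall (kap m z rho1 rho2 : R) (w1 w2 : R -> R -> R),
  0 < m -> m <= z -> z <= 1 -> 0 < kap -> 1 <= z * (kap * m ^+ 2) ->
  0 < rho1 -> rho1 ^+ 2 = 2 * b1 / (3 * m ^+ 2) ->
  0 < rho2 -> rho2 ^+ 2 = 2 * b2 / (3 * m ^+ 2) -> snice w1 -> snice w2 ->
  nrm (w1 tau) <= C * rho1 -> nrm (w2 tau) <= C * rho2 ->
  nrm (fun x => rho1^-1 * w1 tau x - approx gauss b1 kap (kap ^+ 2 * m ^+ 2) tau x) <= C * m ^+ 2 ->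
  nrm (fun x => rho2^-1 * w2 tau x - approx gauss b2 kap (kap ^+ 2 * m ^+ 2) tau x) <= C * m ^+ 2 ->
  exists c0, [/\ sch c0, nrm c0 <= 6 * nrm gauss,
    nrm (derive1 c0) <= kap * (6 * nrm gauss) + K &
    rho1 * (kap * cphi - K * (z * kap)) <=
      Int (fun x => (dx w1 tau x + w1 tau x ^+ 2 - (dx w2 tau x + w2 tau x ^+ 2)) * c0 x)].
Proof.
have [L1 L10 err1] := env_error b1_gt0; have [L2 L20 err2] := env_error b2_gt0.
have C0 : 0 <= C by exact: le_trans C1.
have b10 := ltW b1_gt0.
pose J := `|2^-1 * Int (fun x => dx q tau x * p tau x - dx p tau x * q tau x)|.
pose D := nrm (dx p tau) + nrm (dx q tau).
have J0 : 0 <= J by exact: normr_ge0.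
have D0 : 0 <= D by rewrite addr_ge0// nrm_ge0.
pose L := L1 + 2 * L2; have L0 : 0 <= L by rewrite /L; nn.
pose F := 6 * nrm (@gauss); have F0 : 0 <= F by rewrite mulr_ge0// nrm_ge0.
(* [J] comes from the slow variation of the envelopes, [L * (F + D)] from the ansatz error, the
   third term from [w1 ^ 2] and [w2 ^ 2], and [D] from the derivative of the test wave. *)
pose K := J + L * (F + D) + 30 * C ^+ 2 * (1 + b1) + D.
have K2 : 0 <= L * (F + D) by nn.
have K3 : 0 <= 30 * C ^+ 2 * (1 + b1) by nn.
exists K; first by rewrite /K; nn.
move=> kap m z rho1 rho2 w1 w2 m0 mz z1 k0 zkm rho10 rho1E rho20 rho2E sw1 sw2 n1 n2 a1 a2.
have z0 : 0 < z by exact: lt_le_trans mz.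
have m1 : m <= 1 by exact: le_trans z1.
have m0' := ltW m0; have k0' := ltW k0; have z0' := ltW z0.
have m2 : m ^+ 2 <= m by rewrite expr2 ler_piMr.
have m2z : m ^+ 2 <= z by exact: le_trans mz.
have m20 : 0 <= m ^+ 2 by exact: sqr_ge0.
have km : 1 <= kap * m ^+ 2 by apply: (le_trans zkm); rewrite ler_piMl//; nn.
have k1 : 1 <= kap by apply: (le_trans km); rewrite ler_piMr//; exact: le_trans m1.
have zk1 : 1 <= z * kap.
  by apply: (le_trans zkm); rewrite mulrA ler_piMr//; [nn|exact: le_trans m1].
have zk0 : 0 <= z * kap by nn.
set A := kap ^+ 2 * m ^+ 2.
have rE := ratioE rho10 rho20 rho1E rho2E.
have r2 := ratio_le2; have r1 := ratio_ge1; have r0 : 0 < r by exact: lt_le_trans r1.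
pose W := main_wave kap A p q; pose T := test_wave kap A p q.
have sW : snice W by exact: snice_main_wave.
have sT : snice T by exact: snice_test_wave.
have sT1 := snice_dx sT; have sW1 := snice_dx sW.
pose V1 := wave (carrier_cos kap A) (carrier_sin kap A) (env_cos gauss b1) (env_sin gauss b1).
pose V2 := wave (carrier_cos kap A) (carrier_sin kap A) (env_cos gauss b2) (env_sin gauss b2).
have sV b : snice (wave (carrier_cos kap A) (carrier_sin kap A) (env_cos gauss b) (env_sin gauss b)).
  have [bc bs] := bnice_carrier kap A.
  by apply: snice_wave => //; [exact: (snice_env_cos _ sch_gauss)|exact: (snice_env_sin _ sch_gauss)].
pose E1 t x : R := rho1^-1 * w1 t x - V1 t x; pose E2 t x : R := rho2^-1 * w2 t x - V2 t x.
have sE1 : snice E1 by exact: sniceB (sniceZ _ sw1) (sV b1).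
have sE2 : snice E2 by exact: sniceB (sniceZ _ sw2) (sV b2).
pose E t x : R := E1 t x - r * E2 t x.
have sE : snice E by exact: sniceB sE1 (sniceZ r sE2).
have nE : nrm (E tau) <= L * z.
  apply: (le_trans (nrmB_le (snice_decay tau sE1) (snice_decay tau (sniceZ r sE2)))).
  rewrite nrmZ; [|exact: snice_decay|exact: ltW].
  have h1 := err1 _ _ _ _ m0 m1 k1 km sw1 a1; have h2 := err2 _ _ _ _ m0 m1 k1 km sw2 a2.
  apply: (@le_trans _ _ (L * m ^+ 2)); last exact: ler_wpM2l.
  rewrite /L mulrDl -[2 * L2 * _]mulrA; apply: lerD => //.
  by apply: ler_pM => //; [exact: ltW|exact: nrm_ge0].
have T_le x : `|T tau x| <= 6 * gauss x.
  by have := test_wave_le kap A p_le q_le x; rewrite -natrM.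
have w12 t x : w1 t x - w2 t x = rho1 * (W t x + E t x).
  rewrite /E /E1 /E2 /W /V1 /V2 /main_wave /wave /p /q rE.
  by gen_atoms; field; rewrite (gt_eqF rho10) (gt_eqF r0).
exists (T tau); split.
- by have := snice_freeze tau sT.
- have := nrm_test_wave kap A sp sq decay_gauss p_le q_le (ler0n R 3).
  by rewrite -natrM.
- have := nrm_dx_test_wave A sp sq decay_gauss p_le q_le (ler0n R 3) k0'.
  have -> : derive1 (T tau) = dx T tau by rewrite dx.unlock.
  rewrite -natrM => /le_trans; apply.
  by rewrite lerD2l -/D /K lerDr; nn.
have nT1 : nrm (dx T tau) <= kap * F + D.
  have := nrm_dx_test_wave A sp sq decay_gauss p_le q_le (ler0n R 3) k0'.
  by rewrite -natrM.
have sdx1 := snice_dx sw1; have sdx2 := snice_dx sw2.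
(* The error [E] is controlled only in [L ^ 2], so integration by parts moves its derivative to the
   test wave. *)
have step1 : Int (fun x => (dx w1 tau x + w1 tau x ^+ 2 - (dx w2 tau x + w2 tau x ^+ 2)) * T tau x) =
    rho1 * (Int (fun x => dx W tau x * T tau x) - Int (fun x => E tau x * dx T tau x)) +
    (Int (fun x => w1 tau x ^+ 2 * T tau x) - Int (fun x => w2 tau x ^+ 2 * T tau x)).
  have i1 := snice_integ tau (sniceM (sniceXS 1 sw1) sT).
  have i2 := snice_integ tau (sniceM (sniceXS 1 sw2) sT).
  have i3 := snice_integ tau (sniceM sdx1 sT); have i4 := snice_integ tau (sniceM sdx2 sT).
  have i5 := snice_integ tau (sniceM sw1 sT1); have i6 := snice_integ tau (sniceM sw2 sT1).
  have i7 := snice_integ tau (sniceM sW sT1); have i8 := snice_integ tau (sniceM sE sT1).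
  transitivity (Int (fun x => dx w1 tau x * T tau x) - Int (fun x => dx w2 tau x * T tau x) +
    (Int (fun x => w1 tau x ^+ 2 * T tau x) - Int (fun x => w2 tau x ^+ 2 * T tau x))).
    rewrite -IntB// -IntB// -IntD; first last.
    - exact: snice_integ tau (sniceB (sniceM (sniceXS 1 sw1) sT) (sniceM (sniceXS 1 sw2) sT)).
    - exact: snice_integ tau (sniceB (sniceM sdx1 sT) (sniceM sdx2 sT)).
    by apply: eq_Int => x; ring.
  have parts : Int (fun x => w1 tau x * dx T tau x) - Int (fun x => w2 tau x * dx T tau x) =
      rho1 * (Int (fun x => W tau x * dx T tau x) + Int (fun x => E tau x * dx T tau x)).
    rewrite -(IntB i5 i6) -(IntD i7 i8) -(IntZ _ (integD i7 i8)).
    by apply: eq_Int => x; rewrite -mulrBl w12 -mulrA mulrDl.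
  congr (_ + _); rewrite !Int_by_parts//.
  by rewrite -opprD -[X in rho1 * X]opprD mulrN -parts.
have main : kap * cphi - J <= Int (fun x => dx W tau x * T tau x).
  rewrite Int_main_test//.
  have h1 : kap * cphi <= kap / 2 * Int (fun x => p tau x ^+ 2 + q tau x ^+ 2).
    rewrite (_ : kap * cphi = kap / 2 * (2 * cphi)); last by field.
    by apply: ler_wpM2l => //; nn.
  have := lexx J; rewrite {1}/J ler_norml => /andP[h2 _]; exact: lerD.
have err : `|Int (fun x => E tau x * dx T tau x)| <= L * (F + D) * (z * kap).
  apply: (le_trans (norm_Int_CS (snice_decay tau sE) (snice_decay tau sT1))).
  rewrite (_ : L * _ * _ = L * z * (kap * (F + D))); last by ring.
  apply: ler_pM => //; [exact: nrm_ge0|exact: nrm_ge0|].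
  by apply: (le_trans nT1); rewrite mulrDr lerD2l ler_peMl.
have sqb (w : R -> R -> R) rho : snice w -> 0 < rho -> nrm (w tau) <= C * rho ->
    `|Int (fun x => w tau x ^+ 2 * T tau x)| <= 6 * (C ^+ 2 * rho ^+ 2).
  move=> sw rho0 nw; have i2 := snice_integ tau (sniceXS 1 sw).
  have i1 := snice_integ tau (sniceM (sniceXS 1 sw) sT).
  apply: (le_trans (Int_norm_le i1)).
  apply: (@le_trans _ _ (Int (fun x => 6 * w tau x ^+ 2))).
    apply: Int_le; [exact: integ_norm|exact: integZ|move=> x].
    rewrite normrM (ger0_norm (sqr_ge0 _)) mulrC ler_wpM2r ?sqr_ge0//.
    by apply: (le_trans (T_le x)); rewrite ler_piMr// gauss_le1.
  rewrite IntZ// -nrm_sq ler_wpM2l// -exprMn lerXn2r ?nnegrE ?nrm_ge0//.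
  by rewrite mulr_ge0// ltW.
(* The squares in Miura's map have size [rho1 ^ 2] against the main term [rho1 * kap]; they are of
   lower order because [rho1], of size [1 / m], is at most a multiple of [z * kap]. *)
have rho1k : rho1 <= (1 + b1) * (z * kap).
  have : rho1 <= (1 + b1) * m^-1.
    have c0 : 0 <= (1 + b1) / m by nn.
    rewrite -(@ler_pXn2r _ 2)// ?nnegrE// ?(ltW rho10)// rho1E exprMn exprVn.
    rewrite (_ : 2 * b1 / (3 * m ^+ 2) = 2 / 3 * b1 * (m ^+ 2)^-1); last by field; rewrite gt_eqF.
    rewrite ler_wpM2r ?invr_ge0//.
    by have := sqr_ge0 b1; rewrite !expr2; lra.
  move/le_trans; apply; rewrite ler_wpM2l//; first by nn.
  rewrite -[m^-1]mul1r ler_pdivrMr//; apply: (le_trans zkm).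
  by rewrite mulrA ler_wpM2l.
have rho2k : rho2 ^+ 2 <= 4 * rho1 ^+ 2.
  rewrite rE exprMn ler_wpM2r ?sqr_ge0// (_ : 4 = 2 ^+ 2 :> R); last by rewrite expr2 -natrM.
  by rewrite lerXn2r ?nnegrE ?(ltW r0).
rewrite step1.
have q1 := sqb _ _ sw1 rho10 n1; have q2 := sqb _ _ sw2 rho20 n2.
have quad : - (rho1 * (30 * C ^+ 2 * (1 + b1) * (z * kap))) <=
    Int (fun x => w1 tau x ^+ 2 * T tau x) - Int (fun x => w2 tau x ^+ 2 * T tau x).
  apply: (@le_trans _ _ (- (30 * C ^+ 2 * rho1 ^+ 2))).
    rewrite lerN2 expr2 (_ : _ * (rho1 * rho1) = rho1 * (30 * C ^+ 2 * rho1)); last by ring.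
    apply: ler_wpM2l; first exact: ltW.
    by rewrite -[leRHS]mulrA ler_wpM2l//; nn.
  have := ler_wpM2l (sqr_ge0 C) rho2k.
  by move: q1 q2; rewrite !ler_norml => /andP[q11 _] /andP[_ q22]; lra.
have h0 : kap * cphi - K * (z * kap) + 30 * C ^+ 2 * (1 + b1) * (z * kap) <=
   Int (fun x => dx W tau x * T tau x) - Int (fun x => E tau x * dx T tau x).
  have J1 : J <= J * (z * kap) by rewrite ler_peMr.
  have D1 : 0 <= D * (z * kap) by rewrite mulr_ge0.
  have := le_trans (ler_norm _) err.
  have -> : K * (z * kap) = J * (z * kap) + L * (F + D) * (z * kap) +
    30 * C ^+ 2 * (1 + b1) * (z * kap) + D * (z * kap) by rewrite /K; ring.
  lra.
have := ler_wpM2l (ltW rho10) h0; rewrite mulrDr; lra.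
Qed.

End Lower.

(** * The initial data and their rescaling *)

Section Data.
Context {R : realType}.

(** At time [0] the envelope of the first harmonic does not depend on [b], so two ansatz waves share
    their leading part and differ by the third harmonics only. *)
Lemma approx0_bounds (b : R) : 0 < b -> exists2 K, 0 <= K & forall kap A : R,
  1 <= kap -> 1 <= A -> b <= A -> forall x,
  [/\ `|approx gauss b kap A 0 x| <= K * jap x,
      `|approx gauss b kap A 0 x - gauss x * cos (kap * x)| <= K / A * jap x &
      `|dx (approx gauss b kap A) 0 x -
        (derive1 gauss x * cos (kap * x) - kap * (gauss x * sin (kap * x)))| <=
        kap * (K / A) * jap x].
Proof.
move=> b0; have [K K1 bK] := common_bound (all_snice_env_list b (@sch_gauss R)).
have K0 : 0 <= K by exact: le_trans K1.
have b0' := ltW b0; have bk : 0 <= b * K by exact: mulr_ge0.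
exists (10 * K + 2 * (b * K)); first by nn.
move=> kap A k1 A1 bA x; have A0 : 0 < A by exact: lt_le_trans A1.
have j0 := jap_ge0 x; have k0 : 0 <= kap by exact: le_trans k1.
have t0 : `|0 : R| <= 1 by rewrite normr0.
have Ai : 0 <= A^-1 by rewrite invr_ge0 ltW.
pose V := wave (carrier_cos kap A) (carrier_sin kap A) (env_cos gauss b) (env_sin gauss b).
have V0 y : V 0 y = gauss y * cos (kap * y).
  rewrite /V /wave /env_cos /env_sin /carrier_cos /carrier_sin !mulr0 !mul0r cos0 sin0.
  by rewrite subr0; ring.
have dV0 : dx V 0 x = derive1 gauss x * cos (kap * x) - kap * (gauss x * sin (kap * x)).
  apply: dx_val; apply: (hasD_ext (fun y => esym (V0 y))).
  apply: hasD_eq (hasDM (sch_hasD x sch_gauss) (hasD_cos (hasD_mull x kap))) _; ring.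
have c1 : 8 * (b / (24 * A)) <= 2 * b / A.
  rewrite (_ : 8 * (b / (24 * A)) = 3^-1 * (b / A)); last by field; rewrite gt_eqF.
  by rewrite -mulrA ler_wpM2r ?mulr_ge0//; lra.
split.
- apply: (le_trans (approx_le b0 kap A1 bA K1 bK x t0)).
  by rewrite mulrA ler_wpM2r// lerDl; nn.
- rewrite -V0; apply: (le_trans (approx_sub_le b0 kap A1 bK x t0)).
  rewrite mulrA ler_wpM2r//; apply: (le_trans (ler_wpM2r K0 c1)).
  rewrite (_ : 2 * b / A * K = 2 * (b * K) / A); last by ring.
  by rewrite ler_wpM2r// lerDr; nn.
- rewrite -dV0; apply: (le_trans (dx_approx_sub_le sch_gauss b0 k1 A1 K1 bK x t0)).
  rewrite mulrA ler_wpM2r// (_ : 32 * kap * _ * K = kap * ((4/3) * (b * K) / A)); last by field; rewrite gt_eqF.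
  rewrite ler_wpM2l// ler_wpM2r//; lra.
Qed.

(** The general combination serves twice: one coefficient equal to zero bounds a single datum,
    nearly opposite coefficients bound a difference. *)
Lemma data_norms (b1 b2 : R) : 0 < b1 -> 0 < b2 -> exists2 K, 0 <= K &
  forall kap A c1 c2 : R, 1 <= kap -> 1 <= A -> b1 <= A -> b2 <= A -> `|c1| <= 2 -> `|c2| <= 2 ->
  let a1 := approx gauss b1 kap A in let a2 := approx gauss b2 kap A in
  [/\ nrm (fun x => c1 * a1 0 x + c2 * a2 0 x) <= `|c1 + c2| * nrm gauss + K / A,
      nrm (fun x => c1 * dx a1 0 x + c2 * dx a2 0 x) <=
        kap * (`|c1 + c2| * nrm gauss + K / A) + K,
      nrm (fun x => a1 0 x ^+ 2) <= K & nrm (fun x => a2 0 x ^+ 2) <= K].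
Proof.
move=> b10 b20; have [K1 K10 h1] := approx0_bounds b10; have [K2 K20 h2] := approx0_bounds b20.
have cpi0 : 0 <= cpi :> R by exact: ltW cpi_gt0.
pose D := nrm (derive1 (@gauss R)); have D0 : 0 <= D by exact: nrm_ge0.
pose K := 2 * (K1 + K2) * cpi + 4 * D + (K1 ^+ 2 + K2 ^+ 2) * cpi.
have e1 : 0 <= 2 * (K1 + K2) * cpi by nn.
have e2 : 0 <= (K1 ^+ 2 + K2 ^+ 2) * cpi by nn.
have K0 : 0 <= K by rewrite /K; nn.
exists K => // kap A c1 c2 k1 A1 bA1 bA2 c12 c22 a1 a2.
have A0 : 0 < A by exact: lt_le_trans A1.
have Ai : 0 <= A^-1 by rewrite invr_ge0 ltW.
have k0 : 0 <= kap by exact: le_trans k1.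
have s1 : snice a1 by exact: snice_approx sch_gauss _ _.
have s2 : snice a2 by exact: snice_approx sch_gauss _ _.
have dg := @decay_gauss R; have dg1 := sch_decay (sch_derive1 (@sch_gauss R)).
have dj := @decay_jap R.
pose M := 2 * (K1 + K2) / A; have M0 : 0 <= M by rewrite /M; nn.
have Kc : 2 * (K1 + K2) * cpi <= K by rewrite /K -addrA lerDl; nn.
have MA : M * cpi <= K / A by rewrite /M mulrAC ler_wpM2r.
have nj : nrm (@jap R) <= cpi.
  rewrite -[cpi]mul1r; apply: nrm_jap_le => // x.
  by rewrite mul1r ger0_norm// jap_ge0.
have c4 : `|c1 + c2| <= 4 by apply: (le_trans (ler_normD _ _)); lra.
have comb (u1 u2 v B1 B2 : R) : `|u1 - v| <= B1 -> `|u2 - v| <= B2 ->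
    `|c1 * u1 + c2 * u2| <= `|c1 + c2| * `|v| + 2 * (B1 + B2).
  move=> l1 l2; rewrite (_ : c1 * u1 + c2 * u2 = (c1 + c2) * v + (c1 * (u1 - v) + c2 * (u2 - v))); last by ring.
  apply: (le_trans (ler_normD _ _)); rewrite normrM lerD2l [leRHS]mulrDr.
  by apply: norm_leD; rewrite normrM; apply: ler_pM.
have sqn (K' : R) (a : R -> R -> R) : 0 <= K' -> snice a -> (forall x, `|a 0 x| <= K' * jap x) ->
    nrm (fun x => a 0 x ^+ 2) <= K' ^+ 2 * cpi.
  move=> K'0 sa aK; apply: nrm_jap_le; [exact: (snice_decay 0 (sniceXS 1 sa))|exact: sqr_ge0|].
  move=> x; rewrite normrX (_ : K' ^+ 2 * jap x = (K' * 1) * (K' * jap x)); last by ring.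
  rewrite expr2; apply: ler_pM => //; apply: (le_trans (aK x)).
  by rewrite ler_wpM2l// jap_le1.
split.
- have dd := decayD (decayZ `|c1 + c2| dg) (decayZ M dj).
  apply: (le_trans (nrm_le _ dd _)).
  + exact: (snice_decay 0 (sniceD (sniceZ c1 s1) (sniceZ c2 s2))).
  + move=> x; have [_ p1 _] := h1 kap A k1 A1 bA1 x; have [_ p2 _] := h2 kap A k1 A1 bA2 x.
    apply: (le_trans (comb _ _ _ _ _ p1 p2)); apply: lerD.
      rewrite ler_wpM2l// normrM (ger0_norm (gauss_ge0 x)) ler_piMr ?gauss_ge0//.
      exact: cos_max.
    by rewrite le_eqVlt; apply/orP; left; apply/eqP; rewrite /M; ring.
  apply: (le_trans (nrm_triangle (decayZ _ dg) (decayZ _ dj))).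
  rewrite !nrmZ// lerD2l; apply: le_trans MA; exact: ler_wpM2l.
- have dd := decayD (decayZ `|c1 + c2| (decayD (decayZ kap dg) (decay_norm dg1))) (decayZ (kap * M) dj).
  apply: (le_trans (nrm_le _ dd _)).
  + exact: (snice_decay 0 (sniceD (sniceZ c1 (snice_dx s1)) (sniceZ c2 (snice_dx s2)))).
  + move=> x; have [_ _ p1] := h1 kap A k1 A1 bA1 x; have [_ _ p2] := h2 kap A k1 A1 bA2 x.
    apply: (le_trans (comb _ _ _ _ _ p1 p2)); apply: lerD.
      rewrite ler_wpM2l// (le_trans (ler_normB _ _))// addrC; apply: lerD.
        rewrite !normrM (ger0_norm k0) (ger0_norm (gauss_ge0 x)) ler_wpM2l//.
        by rewrite ler_piMr ?gauss_ge0// sin_max.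
      by rewrite normrM ler_piMr// cos_max.
    by rewrite le_eqVlt; apply/orP; left; apply/eqP; rewrite /M; ring.
  have d3 := decayZ `|c1 + c2| (decayD (decayZ kap dg) (decay_norm dg1)).
  apply: (le_trans (nrm_triangle d3 (decayZ _ dj))).
  have kM : 0 <= kap * M by nn.
  rewrite !nrmZ//; last exact: (decayD (decayZ kap dg) (decay_norm dg1)).
  have t1 := nrm_triangle (decayZ kap dg) (decay_norm dg1).
  rewrite nrmZ// nrm_norm -/D in t1.
  have t2 := ler_wpM2l (normr_ge0 (c1 + c2)) t1.
  have t3 : kap * M * nrm (@jap R) <= kap * (K / A).
    by rewrite -mulrA ler_wpM2l//; apply: le_trans MA; exact: ler_wpM2l.
  have t4 : `|c1 + c2| * D <= K.
    apply: (@le_trans _ _ (4 * D)); first by rewrite ler_wpM2r.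
    by rewrite /K; lra.
  apply: (le_trans (lerD t2 t3)); rewrite !mulrDr; lra.
- apply: (le_trans (sqn K1 a1 K10 s1 _)); first by move=> x; have [] := h1 kap A k1 A1 bA1 x.
  have := mulr_ge0 (sqr_ge0 K2) cpi0; rewrite /K mulrDl; lra.
- apply: (le_trans (sqn K2 a2 K20 s2 _)); first by move=> x; have [] := h2 kap A k1 A1 bA2 x.
  have := mulr_ge0 (sqr_ge0 K1) cpi0; rewrite /K mulrDl; lra.
Qed.

Lemma sch_dilate (g : R -> R) (a b : R) : a != 0 -> sch g -> sch (fun x => g (a * x + b)).
Proof.
move=> a0 sg; have s1 := sch_shift b sg; have s2 := sch_scale a0 s1; exact: s2.
Qed.

Lemma Int_dilate (g : R -> R) (a b : R) : 0 < a -> sch g ->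
  Int (fun x => g (a * x + b)) = a^-1 * Int g.
Proof.
move=> a0 sg; have [C C0 gC] := sch_bound 2 sg.
exact: (Int_affine b a0 (sch_cont sg) gC).
Qed.

Lemma nrm_dilate (g : R -> R) (c a b : R) : 0 < a -> sch g ->
  nrm (fun x => c * g (a * x + b)) ^+ 2 = c ^+ 2 * a^-1 * nrm g ^+ 2.
Proof.
move=> a0 sg; rewrite !nrm_sq -mulrA -(Int_dilate b a0 (schM sg sg)).
have s2 := schM sg sg; have s3 := sch_dilate b (lt0r_neq0 a0) s2.
rewrite -IntZ; last exact: sch_integ.
by apply: eq_Int => x; rewrite exprMn.
Qed.

Lemma derive1_dilate (g : R -> R) (c a b : R) : sch g ->
  derive1 (fun x => c * g (a * x + b)) = fun x => c * a * derive1 g (a * x + b).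
Proof.
move=> sg; apply/funext => x; apply: hasD_derive1.
have h : hasD (fun x => a * x + b) x a.
  by apply: hasD_eq (hasDD (hasD_mull x a) (hasD_cst x b)) _; rewrite addr0.
by apply: hasD_eq (hasDZ c (hasD_comp h (sch_hasD _ sg))) _; ring.
Qed.

End Data.

(** * From the laboratory frame to the moving frame *)

Section Lab.
Context {R : realType}.

Lemma dxZ (f : R -> R -> R) c : snice f -> dx (fun t x => c * f t x) = fun t x => c * dx f t x.
Proof. by move=> sf; apply: dxE => t x; apply: hasDZ; exact: snice_dxD. Qed.

Lemma kdv_rescale (v : R -> R -> R) (N L c : R) : c = - (3 * N ^+ 2) -> 0 < N -> 0 < L -> snice v ->
  (forall t x, dt v t x = 6 * v t x * dx v t x - dx (dx (dx v)) t x) ->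
  kdv (L ^- 3) (3 * (N * L) ^+ 2) (fun t X => L ^+ 2 * v t (L * X + c * t)).
Proof.
move=> cE N0 L0 sv eq_v t X; have Ln0 : L != 0 by rewrite gt_eqF.
have sv1 := snice_dx sv; have sv2 := snice_dx sv1.
have sf f : snice f -> snice (fun t X => f t (L * X + c * t)) by exact: snice_frame.
set U := fun t X => L ^+ 2 * v t (L * X + c * t).
have d1 : dx U = fun t X => L ^+ 3 * dx v t (L * X + c * t).
  rewrite /U (dxZ (L ^+ 2) (sf v sv)) (dx_frame _ _ sv).
  by apply/funext => s; apply/funext => x; gring.
have d2 : dx (dx U) = fun t X => L ^+ 4 * dx (dx v) t (L * X + c * t).
  rewrite d1 (dxZ _ (sf _ sv1)) (dx_frame _ _ sv1).
  by apply/funext => s; apply/funext => x; gring.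
have d3 : dx (dx (dx U)) = fun t X => L ^+ 5 * dx (dx (dx v)) t (L * X + c * t).
  rewrite d2 (dxZ _ (sf _ sv2)) (dx_frame _ _ sv2).
  by apply/funext => s; apply/funext => x; gring.
have dtU : dt U t X = L ^+ 2 * (dt v t (L * X + c * t) + c * dx v t (L * X + c * t)).
  apply: dt_val; apply: hasD_eq (hasDZ (L ^+ 2) (hasD_frame _ _ t X (sv 0%N 2%N))) _.
  by gring.
rewrite dtU d3 d1 eq_v /U; gen_atoms; rewrite cE; by field.
Qed.

Lemma lab_kdv (u0 : schwartz R) u (N L : R) : 0 < N -> 0 < L -> kdv_solution u0 u ->
  let U t X := L ^+ 2 * u t (L * X + - (3 * N ^+ 2) * t) in
  snice U /\ kdv (L ^- 3) (3 * (N * L) ^+ 2) U.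
Proof.
move=> N0 L0 [su _ eq_u] U; pose v t x := u t x.
have sv : snice v by exact: smooth_curve_snice.
have Ln0 : L != 0 by rewrite gt_eqF.
split; first exact: (sniceZ (L ^+ 2) (snice_frame _ Ln0 sv)).
apply: (kdv_rescale erefl N0 L0 sv) => t x.
have := eq_u t x; rewrite (iter_dxE 3 v t) /=.
have -> : derive1 (fun t' => u t' x) t = dt v t x by rewrite dt.unlock.
have -> : derive1 (u t) x = dx v t x by rewrite dx.unlock.
by move=> <-; rewrite addrK.
Qed.

Variables (S : schwartz R -> R -> schwartz R).
Hypothesis hS : solution_map S.

Lemma lab_frame (b : R) : 0 < b -> exists C eta : R, [/\ 1 <= C, 0 < eta &
  forall (N L : R) (u0 : schwartz R), 0 < N -> 0 < L ->
  let m := Num.sqrt N / L in let kap := N * L in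
  let rho := Num.sqrt (2 * b / (3 * m ^+ 2)) in
  let v x := L^-1 * rho * approx gauss b kap (kap ^+ 2 * m ^+ 2) 0 (L^-1 * x + 0) in
  m <= eta -> eta^-1 <= kap * m ^+ 2 ->
  (u0 : R -> R) = (fun x => derive1 v x + v x ^+ 2) ->
  exists w, [/\ snice w, forall t X, L ^+ 2 * S u0 t (L * X + - (3 * N ^+ 2) * t) = dx w t X + w t X ^+ 2,
      forall t, nrm (w t) <= C * rho &
      forall t, 0 <= t <= 1 ->
        nrm (fun x => rho^-1 * w t x - approx gauss b kap (kap ^+ 2 * m ^+ 2) t x) <= C * m ^+ 2]].
Proof.
move=> b0; have [C [eta [C1 e0 _ H]]] := frame_approx (@sch_gauss R) b0.
exists C, eta; split=> // N L u0 N0 L0 m kap rho v m_eta eta_k u0E.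
have Ln0 : L != 0 by rewrite gt_eqF.
have m0 : 0 < m by rewrite divr_gt0 ?sqrtr_gt0.
have m2 : m ^+ 2 = N / L ^+ 2 by rewrite /m expr_div_n sqr_sqrtr// ltW.
have rho2 : rho ^+ 2 = 2 * b / (3 * m ^+ 2).
  by rewrite sqr_sqrtr// divr_ge0// mulr_ge0// ?ltW// exprn_gt0.
have rho0 : 0 < rho by rewrite sqrtr_gt0 divr_gt0// mulr_gt0// exprn_gt0.
set A := kap ^+ 2 * m ^+ 2 in v u0E *.
pose a := approx gauss b kap A 0.
have sa : sch a by exact: (snice_freeze 0 (snice_approx b sch_gauss kap A)).
have sv : sch v by exact: (@sniceZ _ (L^-1 * rho) (fun _ => _) (sch_dilate 0 (invr_neq0 Ln0) sa)).
(* The companion datum of the other sign is also Schwartz, so [S] supplies the second KdV solution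
   that the inversion of the Miura map asks for. *)
have [um umE] : exists um : schwartz R, (um : R -> R) = (fun x => v x ^+ 2 - derive1 v x).
  apply: sch_schwartz; apply: (@sniceB _ (fun _ => _) (fun _ => _)); last exact: sch_derive1.
  by apply: (@sniceXS _ (fun _ => v) 1).
have kS f : kdv_solution f (S f) by exact/hS.
have [sUp kUp] := lab_kdv N0 L0 (kS u0); have [sUm kUm] := lab_kdv N0 L0 (kS um).
have delta : L ^- 3 = m ^+ 2 / kap by rewrite m2 /kap; field; rewrite Ln0 gt_eqF.
rewrite -/kap delta in kUp kUm.
have at0 f X : S f 0 (L * X + - (3 * N ^+ 2) * 0) = f (L * X).
  by have [_ -> _] := kS f; rewrite mulr0 addr0.
have vL X : v (L * X) = L^-1 * rho * a X by rewrite /v addr0 mulKf.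
have dvL X : derive1 v (L * X) = L^-1 ^+ 2 * rho * derive1 a X.
  by rewrite (derive1_dilate _ _ _ sa) addr0 mulKf//; ring.
have dw0 X : derive1 (fun x => rho * a x) X = rho * derive1 a X.
  by apply: hasD_derive1; apply: hasDZ; exact: sch_hasD.
have [||w [sw wE nw cw]] := H kap m rho _ _ m0 m_eta eta_k rho0 rho2 sUp sUm kUp kUm.
- move=> X; rewrite at0 u0E vL dvL dw0 -/a; move: (derive1 a X) (a X) => y z; by field.
- move=> X; rewrite at0 umE vL dvL dw0 -/a; move: (derive1 a X) (a X) => y z; by field.
by exists w.
Qed.

End Lab.

(** * Sobolev size of the data *)

Section DataNorm.
Context {R : realType}.

(** With [N ^ (2 s) = 1 / (b1 L N)] the weight, the amplitude [rho b1 / L] and the width [L]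
    compensate, and the derivative part contributes [4 / 3] times a squared envelope norm whatever
    [b1] is. The squares of [v] enter only through [K * z]. *)
Lemma data_upper (b1 b2 : R) : 0 < b1 -> b1 <= b2 -> b2 <= 4 * b1 ->
  exists2 K, 0 <= K & forall (s N L z B c1 c2 : R) (f : schwartz R),
  -1 <= s -> s <= 0 -> 0 < N -> 0 < L -> N `^ (2 * s) = (b1 * L * N)^-1 ->
  let m := Num.sqrt N / L in let kap := N * L in let A := kap ^+ 2 * m ^+ 2 in
  let rho b := Num.sqrt (2 * b / (3 * m ^+ 2)) in
  let v b x := L^-1 * rho b * approx gauss b kap A 0 (L^-1 * x + 0) in
  0 < z -> z <= 1 -> m <= z -> 1 <= z * (kap * m ^+ 2) -> b2 <= A ->
  `|c1| <= 1 -> `|c2| <= 1 -> 0 <= B ->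
  (f : R -> R) = (fun x => derive1 (fun x => c1 * v b1 x + c2 * v b2 x) x +
     (c1 * v b1 x ^+ 2 + c2 * v b2 x ^+ 2)) ->
  2 * cF * (4 / 3 * (`|c1 + c2 * Num.sqrt (b2 / b1)| * nrm (@gauss R) + K * z) ^+ 2 + K * z) <= B ^+ 2 ->
  (Hs_norm s (distr f) <= B%:E)%E.
Proof.
move=> b10 b12 b21; have b20 : 0 < b2 by exact: lt_le_trans b12.
have [K0 K00 HK] := data_norms b10 b20.
exists (2 * K0 + 100 * b1 ^+ 2 * K0 ^+ 2); first by have := ltW b10 => b10'; nn.
set K := 2 * K0 + _.
move=> s N L z B c1 c2 f s1 s0 N0 L0 Ps m kap A rho v z0 z1 mz zkm bA c11 c21 B0 fE leB.
have Ln0 : L != 0 by rewrite gt_eqF.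
have Nn0 : N != 0 by rewrite gt_eqF.
have m0 : 0 < m by rewrite divr_gt0 ?sqrtr_gt0.
have m2 : m ^+ 2 = N / L ^+ 2 by rewrite /m expr_div_n sqr_sqrtr// ltW.
have k0 : 0 < kap by exact: mulr_gt0.
have m1 : m <= 1 by exact: le_trans z1.
have m21 : m ^+ 2 <= 1 by rewrite exprn_ile1// ltW.
have m20 : 0 < m ^+ 2 by exact: exprn_gt0.
have m2z : m ^+ 2 <= z by apply: le_trans mz; rewrite expr2 ler_piMr// ltW.
have z0' := ltW z0; have k0' := ltW k0.
have km : 1 <= kap * m ^+ 2.
  by apply: (le_trans zkm); rewrite ler_piMl// mulr_ge0// ltW.
have k1 : 1 <= kap by apply: (le_trans km); rewrite ler_piMr.
have A1 : 1 <= A by rewrite /A expr2 -mulrA; exact: mulr_ege1.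
have A0 : 0 < A by exact: lt_le_trans A1.
have zk : 1 <= z * kap by apply: (le_trans zkm); rewrite mulrA ler_piMr// mulr_ge0.
have Ai : A^-1 <= z.
  rewrite -[A^-1]mul1r ler_pdivrMr// /A expr2; apply: (le_trans zkm).
  by rewrite ler_wpM2l// -mulrA ler_peMl//; apply: le_trans km.
have rho2 b : 0 < b -> rho b ^+ 2 = 2 * b / (3 * m ^+ 2).
  by move=> b0; rewrite sqr_sqrtr// divr_ge0// mulr_ge0// ltW.
have rho0 b : 0 < b -> 0 < rho b.
  by move=> b0; rewrite sqrtr_gt0 divr_gt0// mulr_gt0.
have r2 := ratio_le2 b10 b12 b21; have r1 := ratio_ge1 b10 b12.
set r := Num.sqrt (b2 / b1) in r2 r1 leB.
have rE : rho b2 = r * rho b1.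
  by apply: (ratioE b10 b12 (rho0 _ b10) (rho0 _ b20) (rho2 _ b10) (rho2 _ b20)).
pose a b := approx gauss b kap A 0.
have sa b : sch (a b) by exact: (snice_freeze 0 (snice_approx b sch_gauss kap A)).
pose g x := c1 * a b1 x + c2 * r * a b2 x.
have sg : sch g.
  exact: (@sniceD _ (fun _ => _) (fun _ => _) (@sniceZ _ c1 (fun _ => _) (sa b1)) (@sniceZ _ (c2 * r) (fun _ => _) (sa b2))).
have dg : derive1 g = fun x => c1 * dx (approx gauss b1 kap A) 0 x + c2 * r * dx (approx gauss b2 kap A) 0 x.
  have e b : derive1 (a b) = dx (approx gauss b kap A) 0 by rewrite dx.unlock.
  by apply/funext => x; rewrite -!e; apply: hasD_derive1; apply: hasDD; apply: hasDZ; exact: sch_hasD.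
have c22 : `|c2 * r| <= 2.
  by rewrite normrM -[2]mul1r; apply: ler_pM => //; rewrite ger0_norm// (le_trans _ r1).
have [n1 n2 n3 n4] := HK kap A c1 (c2 * r) k1 A1 (le_trans b12 bA) bA (le_trans c11 (ler1n _ 2)) c22.
rewrite -/(g _) in n1; rewrite -dg in n2.
set F := `|c1 + c2 * r| * nrm gauss in leB n1 n2.
have F0 : 0 <= F by rewrite mulr_ge0// nrm_ge0.
have b10' := ltW b10.
have Kz : K0 / A + K0 / kap <= K * z.
  have h1 : K0 / A <= K0 * z by rewrite ler_wpM2l.
  have h2 : K0 / kap <= K0 * z by rewrite ler_wpM2l// -[kap^-1]mul1r ler_pdivrMr.
  have h3 : 0 <= 100 * b1 ^+ 2 * K0 ^+ 2 * z by nn.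
  by rewrite /K mulrDl; lra.
have Kz0 : 0 <= K * z by rewrite /K; nn.
have n1' : nrm g <= F + K * z.
  apply: (le_trans n1); rewrite lerD2l; apply: le_trans Kz.
  by rewrite lerDl divr_ge0.
have n2' : nrm (derive1 g) <= kap * (F + K * z).
  apply: (le_trans n2); rewrite (_ : _ + K0 = kap * (F + (K0 / A + K0 / kap))).
    by rewrite ler_wpM2l// lerD2l.
  by field; rewrite !gt_eqF.
pose V x := L^-1 * rho b1 * g (L^-1 * x + 0).
have Li : 0 < L^-1 by rewrite invr_gt0.
have sV : sch V by exact: (@sniceZ _ (L^-1 * rho b1) (fun _ => _) (sch_dilate 0 (invr_neq0 Ln0) sg)).
have VE : (fun x => c1 * v b1 x + c2 * v b2 x) = V.
  by apply/funext => x; rewrite /V /v /g rE /a; ring.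
have sv b : sch (v b) by exact: (@sniceZ _ (L^-1 * rho b) (fun _ => _) (sch_dilate 0 (invr_neq0 Ln0) (sa b))).
have sv2 b : sch (fun x => v b x ^+ 2) by apply: (@sniceXS _ (fun _ => v b) 1); exact: sv.
pose q x := c1 * v b1 x ^+ 2 + c2 * v b2 x ^+ 2.
have sq : sch q.
  exact: (@sniceD _ (fun _ => _) (fun _ => _) (@sniceZ _ c1 (fun _ => _) (sv2 b1)) (@sniceZ _ c2 (fun _ => _) (sv2 b2))).
rewrite VE -/(q _) in fE.
apply: (Hs_norm_le N0 s1 s0 B0 sV sq fE); apply: le_trans leB.
have nV : nrm V ^+ 2 = L^-1 * rho b1 ^+ 2 * nrm g ^+ 2.
  by rewrite (nrm_dilate _ _ Li sg) invrK; field.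
have nV1 : nrm (derive1 V) ^+ 2 = L^-1 ^+ 3 * rho b1 ^+ 2 * nrm (derive1 g) ^+ 2.
  rewrite (derive1_dilate _ _ _ sg) (nrm_dilate _ _ Li (sch_derive1 sg)) invrK.
  by move: (nrm _ ^+ 2) => y; field.
have sqg : nrm g ^+ 2 <= (F + K * z) ^+ 2.
  by rewrite lerXn2r ?nnegrE ?nrm_ge0// addr_ge0.
have sqg1 : nrm (derive1 g) ^+ 2 <= (kap * (F + K * z)) ^+ 2.
  by rewrite lerXn2r ?nnegrE ?nrm_ge0// mulr_ge0// addr_ge0.
have P1 : N `^ (2 * s) * (nrm (derive1 V) ^+ 2 + N ^+ 2 * nrm V ^+ 2) <= 4 / 3 * (F + K * z) ^+ 2.
  have p0 : 0 <= (b1 * L * N)^-1 by rewrite invr_ge0 !mulr_ge0// ltW.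
  apply: (@le_trans _ _ ((b1 * L * N)^-1 * (L^-1 ^+ 3 * rho b1 ^+ 2 * (kap * (F + K * z)) ^+ 2 +
     N ^+ 2 * (L^-1 * rho b1 ^+ 2 * (F + K * z) ^+ 2)))).
    rewrite Ps nV nV1; apply: ler_wpM2l => //; apply: lerD.
      by apply: ler_wpM2l => //; rewrite mulr_ge0 ?sqr_ge0// exprn_ge0// ltW.
    by rewrite ler_wpM2l ?sqr_ge0// ler_wpM2l// mulr_ge0 ?sqr_ge0// ltW.
  rewrite rho2// m2 /kap; move: (F + K * z) => y.
  by rewrite le_eqVlt; apply/orP; left; apply/eqP; field; rewrite Ln0 Nn0 gt_eqF.
have sqv b : 0 < b -> b <= 4 * b1 -> nrm (fun x => a b x ^+ 2) <= K0 ->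
    nrm (fun x => v b x ^+ 2) ^+ 2 <= 8 * (b1 ^+ 2 * K0 ^+ 2 * z).
  move=> b0 bb nb.
  have -> : (fun x => v b x ^+ 2) = (fun x => (L^-1 * rho b) ^+ 2 * (fun y => a b y ^+ 2) (L^-1 * x + 0)).
    by apply/funext => x; rewrite /v exprMn.
  have sa2 : sch (fun y => a b y ^+ 2) by apply: (@sniceXS _ (fun _ => a b) 1); exact: sa.
  rewrite (nrm_dilate _ _ Li sa2) invrK.
  have nb2 : nrm (fun x => a b x ^+ 2) ^+ 2 <= K0 ^+ 2 by rewrite lerXn2r ?nnegrE ?nrm_ge0.
  (* The squared norm of [v b ^ 2] is of size [b ^ 2 / (kap * m ^ 2)], that is [b ^ 2 L / N ^ 2]. *)
  rewrite (_ : ((L^-1 * rho b) ^+ 2) ^+ 2 * L = 4 / 9 * (b ^+ 2 * (kap * m ^+ 2)^-1)); last first.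
    rewrite (_ : _ * L = L^-1 ^+ 4 * (rho b ^+ 2) ^+ 2 * L); last by ring.
    rewrite rho2// m2 /kap.
    by field; rewrite Ln0 Nn0.
  have kmi : (kap * m ^+ 2)^-1 <= z.
    by rewrite -[_^-1]mul1r ler_pdivrMr// (lt_le_trans _ km).
  have bb2 : b ^+ 2 <= 16 * b1 ^+ 2.
    by rewrite (_ : 16 * b1 ^+ 2 = (4 * b1) ^+ 2); [rewrite lerXn2r ?nnegrE ?mulr_ge0// ltW|ring].
  have h1 : b ^+ 2 * (kap * m ^+ 2)^-1 <= 16 * b1 ^+ 2 * z.
    by apply: ler_pM => //; [exact: sqr_ge0|rewrite invr_ge0 mulr_ge0// ltW].
  apply: (@le_trans _ _ (4 / 9 * (16 * b1 ^+ 2 * z) * K0 ^+ 2)).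
    apply: ler_pM => //; first by rewrite !mulr_ge0 ?sqr_ge0 ?invr_ge0 ?mulr_ge0// ltW.
      exact: sqr_ge0.
    by rewrite ler_wpM2l.
  have h2 : 0 <= b1 ^+ 2 * K0 ^+ 2 * z by nn.
  rewrite (_ : _ * K0 ^+ 2 = 64 / 9 * (b1 ^+ 2 * K0 ^+ 2 * z)); last by field.
  by rewrite ler_wpM2r// ler_pdivrMr// -natrM ler_nat.
have Q1 : nrm q ^+ 2 <= K * z.
  have d1 := sch_decay (sv2 b1); have d2 := sch_decay (sv2 b2).
  have t : nrm q <= nrm (fun x => v b1 x ^+ 2) + nrm (fun x => v b2 x ^+ 2).
    apply: (@le_trans _ _ (nrm (fun x => v b1 x ^+ 2 + v b2 x ^+ 2))).
      apply: nrm_le; [exact: sch_decay|exact: decayD|move=> x].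
      apply: (le_trans (ler_normD _ _)); rewrite (normrM c1) (normrM c2) !(ger0_norm (sqr_ge0 _)).
      by apply: lerD; rewrite ler_piMl// sqr_ge0.
    exact: nrm_triangle.
  have t2 : nrm q ^+ 2 <= (nrm (fun x => v b1 x ^+ 2) + nrm (fun x => v b2 x ^+ 2)) ^+ 2.
    by rewrite lerXn2r ?nnegrE ?addr_ge0 ?nrm_ge0.
  apply: (le_trans t2); apply: (le_trans (sqrD_le _ _)).
  have b11 : b1 <= 4 * b1 by rewrite ler_peMl// ler1n.
  have h1 := sqv b1 b10 b11 n3; have h2 := sqv b2 b20 b21 n4.
  have h3 : 0 <= K0 * z by nn.
  have h4 : 0 <= b1 ^+ 2 * K0 ^+ 2 * z by nn.
  have -> : K * z = 2 * (K0 * z) + 100 * (b1 ^+ 2 * K0 ^+ 2 * z) by rewrite /K; ring.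
  have hh := ler_wpM2l (ler0n R 2) (lerD h1 h2).
  apply: (le_trans hh); rewrite (_ : 2 * _ = 32 * (b1 ^+ 2 * K0 ^+ 2 * z)); last by ring.
  apply: (@le_trans _ _ (100 * (b1 ^+ 2 * K0 ^+ 2 * z))); last by rewrite lerDr mulr_ge0.
  by rewrite ler_wpM2r// ler_nat.
apply: ler_wpM2l; last exact: lerD.
by rewrite mulr_ge0// ltW// cF_gt0.
Qed.

End DataNorm.

(** * Choice of the scales and rescaled duality *)

Section Final.
Context {R : realType}.

(** [N = X ^ (1 / e)] with [e = - (4 s + 3)] in [(0, 1]] and [L = N ^ (- 2 s - 1) / b]. *)
Lemma scales (s b X : R) : -1 <= s -> s < - (3 / 4) -> 0 < b -> 1 <= X ->
  exists N L : R, [/\ 1 <= N, 0 < L, N `^ (2 * s) = (b * L * N)^-1 /\ N `^ (- (2 * s)) = b * L * N,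
    N / L ^+ 2 = b ^+ 2 / X & b * X <= N ^+ 2 / L].
Proof.
move=> s1 s2 b0 X1; pose e := - (4 * s + 3).
have e0 : 0 < e by rewrite /e; lra.
have e1 : e <= 1 by rewrite /e; lra.
have X0 : 0 < X by exact: lt_le_trans X1.
pose N := X `^ e^-1.
have XN : X <= N.
  have : 1 <= e^-1 by rewrite invf_ge1.
  by move=> /(ler_powR X1); rewrite powRr1// ltW.
have N1 : 1 <= N by exact: le_trans XN.
have N0 : 0 < N by exact: lt_le_trans N1.
pose Q := N `^ (- (2 * s)); have Q0 : 0 < Q by exact: powR_gt0.
have Ne : N `^ e = X by rewrite /N -powRrM mulVf ?gt_eqF// powRr1// ltW.
(* The exponent [- 4 s] is [3 + e], and [s < - 3 / 4] makes [e] positive. *)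
have Q2 : Q ^+ 2 = N ^+ 3 * X.
  rewrite -Ne -(powR_mulrn 3 (ltW N0)) -powRD; last by rewrite (gt_eqF N0) implybT.
  rewrite expr2 /Q -powRD; last by rewrite (gt_eqF N0) implybT.
  by congr (_ `^ _); rewrite /e; ring.
(* From [-1 <= s]; this is what bounds [N ^ 2 / L] from below. *)
have QN : Q <= N ^+ 2.
  by rewrite -(powR_mulrn 2 (ltW N0)); apply: ler_powR => //; lra.
have Qn0 : Q != 0 by rewrite gt_eqF.
have Nn0 : N != 0 by rewrite gt_eqF.
have bn0 : b != 0 by rewrite gt_eqF.
exists N, (Q / (b * N)).
have bLN : b * (Q / (b * N)) * N = Q by field; rewrite bn0 Nn0.
split=> //.
- exact: divr_gt0 Q0 (mulr_gt0 b0 N0).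
- by rewrite bLN; split=> //; rewrite /Q powRN invrK.
- rewrite (_ : N / (Q / (b * N)) ^+ 2 = b ^+ 2 * N ^+ 3 / Q ^+ 2); last by field; rewrite ?bn0 ?Nn0 ?Qn0.
  by rewrite Q2; field; rewrite ?Nn0 (gt_eqF X0).
- rewrite (_ : N ^+ 2 / (Q / (b * N)) = b * (N * (N ^+ 2 / Q))); last by field; rewrite ?bn0 ?Nn0 ?Qn0.
  rewrite ler_wpM2l ?(ltW b0)//; apply: (le_trans XN).
  by rewrite ler_peMr ?(ltW N0)// ler_pdivlMr// mul1r.
Qed.

(** Taking [lam = nu * rho * N] in [Hs_norm_dual] makes both terms proportional to [rho * N], the
    size of the main term, because [b L ^ 2 N = 3 / 2 * (rho N) ^ 2]. *)
Lemma dual_rescaled (f : schwartz R) (c0 U : R -> R) (s N L b d rho eps nu G : R) :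
  -1 <= s -> s <= 0 -> 1 <= N -> 0 < L -> 0 < b -> N `^ (- (2 * s)) = b * L * N ->
  sch c0 -> nrm c0 <= G -> nrm (derive1 c0) <= N * L * G ->
  0 < rho -> rho ^+ 2 = 2 * b / (3 * (N / L ^+ 2)) ->
  (forall X, L ^+ 2 * f (L * X + d) = U X) ->
  0 < eps -> 0 < nu -> (Hs_norm s (distr f) < eps%:E)%E ->
  cF * (L^-1 * `|Int (fun x => U x * c0 x)|) <=
    rho * N * (nu * eps ^+ 2 + 9 / 2 * cF * G ^+ 2 / nu).
Proof.
move=> s1 s0 N1 L0 b0 NE sc0 nc nc1 rho0 rhoE fU e0 nu0 Hlt.
have Ln0 : L != 0 by rewrite gt_eqF.
have N0 : 0 < N by exact: lt_le_trans N1.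
have Nn0 : N != 0 by rewrite gt_eqF.
have Li : 0 < L^-1 by rewrite invr_gt0.
have G0 : 0 <= G by apply: le_trans nc; exact: nrm_ge0.
have cF0 := @cF_gt0 R.
pose b' := - (L^-1 * d).
pose c x := 1 * c0 (L^-1 * x + b').
have sc : sch c by exact: (@sniceZ _ 1 (fun _ => _) (sch_dilate b' (lt0r_neq0 Li) sc0)).
have sf := schwartz_sch f.
have IE : Int (fun x => f x * c x) = L^-1 * Int (fun x => U x * c0 x).
  have := Int_dilate d L0 (schM sf sc); move/(congr1 (fun y => L * y)).
  rewrite mulVKf// => <-.
  have iU : integ (fun x => f (L * x + d) * c (L * x + d)).
    exact: (sch_integ (sch_dilate d Ln0 (schM sf sc))).
  have -> : (fun x => U x * c0 x) = fun x => L ^+ 2 * (f (L * x + d) * c (L * x + d)).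
    apply/funext => x; rewrite -fU /c mul1r -mulrA; congr (_ * (_ * c0 _)).
    by rewrite /b'; field.
  by rewrite (IntZ _ iU) mulrA; congr (_ * _); field.
have nuY : 0 < nu * (rho * N) by rewrite !mulr_gt0.
have := Hs_norm_dual N0 s1 s0 nuY e0 sc Hlt.
rewrite IE normrM (gtr0_norm Li) NE => /le_trans; apply.
have n1 : nrm c ^+ 2 <= L * G ^+ 2.
  rewrite (nrm_dilate _ _ Li sc0) invrK expr1n mul1r; apply: ler_wpM2l; first exact: ltW.
  by rewrite lerXn2r ?nnegrE ?nrm_ge0.
have n2 : nrm (derive1 c) ^+ 2 <= N ^+ 2 * (L * G ^+ 2).
  rewrite (derive1_dilate _ _ _ sc0) (nrm_dilate _ _ Li (sch_derive1 sc0)) invrK mul1r.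
  apply: (@le_trans _ _ (L^-1 ^+ 2 * L * (N * L * G) ^+ 2)).
    apply: ler_wpM2l; first by rewrite mulr_ge0 ?sqr_ge0// ltW.
    by rewrite lerXn2r ?nnegrE ?nrm_ge0// !mulr_ge0// ltW.
  by rewrite le_eqVlt; apply/orP; left; apply/eqP; field.
set n := L * G ^+ 2 in n1 n2; have n0 : 0 <= n by rewrite mulr_ge0 ?sqr_ge0// ltW.
have N2 : (N ^+ 2)^-1 <= 1 by rewrite invf_le1 ?exprn_gt0// exprn_ege1.
have N20 : 0 <= (N ^+ 2)^-1 by rewrite invr_ge0 sqr_ge0.
have tot : nrm c ^+ 2 + (N ^+ 2)^-1 * (nrm c ^+ 2 + nrm (derive1 c) ^+ 2) <= 3 * n.
  apply: (@le_trans _ _ (n + (N ^+ 2)^-1 * (n + N ^+ 2 * n))).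
    by apply: lerD => //; apply: ler_wpM2l => //; exact: lerD.
  rewrite mulrDr mulKf; last by rewrite expf_neq0.
  rewrite (_ : 3 * n = n + (1 * n + n)); last by ring.
  by rewrite lerD2l lerD2r ler_wpM2r.
apply: (@le_trans _ _ (nu * (rho * N) * eps ^+ 2 + (nu * (rho * N))^-1 * (b * L * N * (cF * (3 * n))))).
  rewrite lerD2l; apply: ler_wpM2l; first by rewrite invr_ge0 ltW.
  apply: ler_wpM2l; first by rewrite !mulr_ge0// ltW.
  by apply: ler_wpM2l => //; exact: ltW.
have bL : b * L * N * L = 3 / 2 * (rho * N) ^+ 2.
  by rewrite exprMn rhoE; field; rewrite Ln0.
rewrite (_ : b * L * N * (cF * (3 * n)) = (b * L * N * L) * (3 * cF * G ^+ 2)); last by rewrite /n; ring.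
rewrite bL; move: (cF) => k; rewrite le_eqVlt; apply/orP; left; apply/eqP.
by field; rewrite Nn0 !gt_eqF.
Qed.

End Final.

Ltac pp := repeat first [ assumption | exact: ltr0Sn | exact: ltr01 | apply: exprn_gt0
  | apply: mulr_gt0 | rewrite invr_gt0 ].

Lemma one_plus_sum_ge (R : realType) (x1 x2 x3 x4 x5 x6 : R) :
  0 <= x1 -> 0 <= x2 -> 0 <= x3 -> 0 <= x4 -> 0 <= x5 -> 0 <= x6 ->
  let W := 1 + x1 + x2 + x3 + x4 + x5 + x6 in
  [/\ 1 <= W, x1 <= W, x2 <= W & x3 <= W] /\ [/\ x4 <= W, x5 <= W & x6 <= W].
Proof. by move=> ? ? ? ? ? ? W; rewrite /W; split; split; lra. Qed.

Lemma quarter_bound (R : realType) (x : R) : x ^+ 2 <= x -> 0 <= x ->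
  4 / 3 * (2 * x) ^+ 2 + x <= 7 * x.
Proof. by rewrite exprMn => ? ?; lra. Qed.

Lemma half_gt_three_eighths (R : realType) (c : R) : 0 < c -> ~ c / 2 <= 3 / 8 * c.
Proof. by move=> ? ?; lra. Qed.

(** * Failure of uniform continuity *)

Section Core.
Context {R : realType}.
Variables (S : schwartz R -> R -> schwartz R) (s : R).
Hypotheses (hS : solution_map S) (s1 : -1 <= s) (s2 : s < - (3 / 4)).

Let s0 : s <= 0. Proof. by apply: ltW; apply: (lt_trans s2); rewrite oppr_lt0 divr_gt0. Qed.

Let Phi := nrm (@gauss R).

Let Phi0 : 0 <= Phi. Proof. exact: nrm_ge0. Qed.

(** The bound of [data_upper] for a single datum, with amplitude ratio at most [2] and errors at
    most [1]; it depends neither on the time nor on the amplitudes. *)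
Let B : R := Num.sqrt (2 * cF * (4 / 3 * (2 * Phi + 1) ^+ 2 + 1)).

Let B2 : B ^+ 2 = 2 * cF * (4 / 3 * (2 * Phi + 1) ^+ 2 + 1).
Proof.
have cF0 : 0 <= cF :> R by exact: ltW cF_gt0.
by rewrite sqr_sqrtr//; nn.
Qed.

Lemma not_solution_map_unif_continuous (T : R) : 0 < T ->
  ~ solution_map_unif_continuous S s (B + 1) T.
Proof.
move=> T0 UC; have cF0 := @cF_gt0 R; have cphi0 := @cphi_gt0 R.
have cF0' := ltW cF0; have cphi0' := ltW cphi0.
(* The extra [1] absorbs the constant of [frame_lower] in the derivative of the test wave, since
   [Kl <= kap]. *)
pose G := 6 * Phi + 1.
have G0 : 0 < G by rewrite ltr_wpDl// mulr_ge0.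
(* With [nu] and [eps] the dual estimate gives at most [(1 / 8 + 1 / 4) * cF * cphi], up to the
   factor [rho * N], while the lower bound is [cF * cphi / 2]. *)
pose nu := 18 * G ^+ 2 / cphi.
have nu0 : 0 < nu by rewrite /nu; pp.
pose eps := Num.sqrt (cF * cphi / (8 * nu)).
have eps0 : 0 < eps by rewrite sqrtr_gt0; pp.
have eps2 : eps ^+ 2 = cF * cphi / (8 * nu).
  by rewrite sqr_sqrtr//; apply: ltW; pp.
have [del del0 H] := UC eps eps0.
(* A time below [T], and at most [1] so that the approximation is valid. *)
pose tau := Num.min T 1 / 2.
have min0 : 0 < Num.min T 1 by rewrite lt_min T0/=.
have tau0 : 0 < tau by rewrite divr_gt0.
have tau1 : tau <= 1.
  by rewrite /tau ler_pdivrMr// mul1r ge_min ler1n orbT.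
have tauT : tau < T.
  apply: (@lt_le_trans _ _ (Num.min T 1)); last by rewrite ge_min lexx.
  by rewrite /tau ltr_pdivrMr// mulr_natr mulr2n ltrDl.
(* If the amplitude defect and [Ku * z] are at most [sig], then [data_upper] bounds the squared
   distance by [14 * cF * sig], which is at most [(del / 2) ^ 2]. *)
pose sig := Num.min 1 (del ^+ 2 / (56 * cF)).
have sig0 : 0 < sig by rewrite lt_min ltr01/=; pp.
have sig0' := ltW sig0.
have sig1 : sig <= 1 by rewrite ge_min lexx.
have sigd : sig * (56 * cF) <= del ^+ 2.
  by rewrite -ler_pdivlMr; [rewrite ge_min lexx orbT|pp].
have ti0 : 0 < tau^-1 by rewrite invr_gt0.
(* [y = tau * b1] is so large that [(r - 1) * Phi <= Phi / y <= sig], where [r] is the ratio of the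
   amplitudes. *)
pose y := 1 + Phi / sig.
have y1 : 1 <= y by rewrite lerDl divr_ge0.
have y0 : 0 < y by exact: lt_le_trans y1.
pose b1 := tau^-1 * y; pose b2 := b1 + tau^-1.
have b10 : 0 < b1 by exact: mulr_gt0.
have tb1 : tau^-1 <= b1 by rewrite ler_peMr// ltW.
have b12 : b1 <= b2 by rewrite lerDl ltW.
have b20 : 0 < b2 by exact: lt_le_trans b12.
have b21 : b2 <= 4 * b1.
  apply: (le_trans (lerD (lexx b1) tb1)).
  by rewrite (_ : b1 + b1 = 2 * b1); [rewrite ler_pM2r// ler_nat|ring].
have btau : (b2 - b1) * tau = 1 by rewrite /b2 addrAC subrr add0r mulVf// gt_eqF.
have [C1 [eta1 [C11 eta10 F1]]] := lab_frame hS b10.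
have [C2 [eta2 [C21 eta20 F2]]] := lab_frame hS b20.
pose C := C1 + C2.
have C1C : C1 <= C by rewrite lerDl (le_trans _ C21).
have C2C : C2 <= C by rewrite lerDr (le_trans _ C11).
have C1' : 1 <= C by exact: le_trans C1C.
have [Kl Kl0 lower] := frame_lower b10 b12 b21 tau0 tau1 btau C1'.
have [Ku Ku0 upper] := data_upper b10 b12 b21.
(* All lower bounds demanded of [kap * m ^ 2] and of [1 / m], gathered after the amplitudes are
   fixed. *)
pose W := 1 + eta1^-1 + eta2^-1 + b2 + Ku / sig + Kl + 2 * Kl / cphi.
have p1 : 0 <= eta1^-1 by rewrite invr_ge0 ltW.
have p2 : 0 <= eta2^-1 by rewrite invr_ge0 ltW.
have p3 : 0 <= b2 by exact: ltW.
have p4 : 0 <= Ku / sig by exact: divr_ge0.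
have p5 : 0 <= 2 * Kl / cphi by rewrite divr_ge0// mulr_ge0.
have [[W1 We1 We2 Wb] [WKu WKl WKl']] : [/\ 1 <= W, eta1^-1 <= W, eta2^-1 <= W &
    b2 <= W] /\ [/\ Ku / sig <= W, Kl <= W & 2 * Kl / cphi <= W].
  exact: one_plus_sum_ge.
have W0 : 0 < W by exact: lt_le_trans W1.
pose z := W^-1.
have z0 : 0 < z by rewrite invr_gt0.
have z1 : z <= 1 by rewrite invf_le1.
(* By [scales], [m ^ 2 = b1 ^ 2 / X] and [kap * m ^ 2 >= b1 * X]: the last term of [X] yields
   [m <= z], the middle one [kap * m ^ 2 >= W]. *)
pose X := 1 + b1^-1 * W + (b1 * W) ^+ 2.
have q1 : 0 <= b1^-1 * W by rewrite mulr_ge0 ?invr_ge0 ?(ltW b10) ?(ltW W0).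
have X1 : 1 <= X by rewrite /X -addrA lerDl addr_ge0// sqr_ge0.
have X0 : 0 < X by exact: lt_le_trans X1.
have XW : b1^-1 * W <= X by rewrite /X addrAC lerDr addr_ge0// sqr_ge0.
have XW2 : (b1 * W) ^+ 2 <= X by rewrite /X lerDr addr_ge0.
have [N [L [N1 L0 [NsE NsE'] mE kE]]] := scales s1 s2 b10 X1.
have N0 : 0 < N by exact: lt_le_trans N1.
have Ln0 : L != 0 by rewrite gt_eqF.
pose m := Num.sqrt N / L; pose kap := N * L.
have m0 : 0 < m by rewrite divr_gt0 ?sqrtr_gt0.
have m2 : m ^+ 2 = N / L ^+ 2 by rewrite /m expr_div_n sqr_sqrtr// ltW.
have km2 : kap * m ^+ 2 = N ^+ 2 / L by rewrite m2 /kap; field.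
have k0 : 0 < kap by exact: mulr_gt0.
have Wk : W <= kap * m ^+ 2.
  rewrite km2; apply: le_trans kE.
  by rewrite -(ler_pM2l b10) mulVKf ?gt_eqF in XW.
have mz : m <= z.
  rewrite -(@ler_pXn2r _ 2)// ?nnegrE ?(ltW m0) ?(ltW z0)// m2 mE.
  by rewrite ler_pdivrMr// /z exprVn mulrC ler_pdivlMr ?exprn_gt0// -exprMn.
have zkm : 1 <= z * (kap * m ^+ 2) by rewrite /z mulrC ler_pdivlMr// mul1r.
have m1 : m <= 1 by exact: le_trans z1.
have m21 : m ^+ 2 <= 1 by rewrite exprn_ile1// ltW.
have kmk : kap * m ^+ 2 <= kap by rewrite ler_piMr// ltW.
have Wkap : W <= kap by exact: le_trans kmk.
set A := kap ^+ 2 * m ^+ 2.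
have bA : b2 <= A.
  apply: (le_trans Wb); apply: (le_trans Wk).
  rewrite /A (expr2 kap) -mulrA ler_peMl//; last exact: le_trans Wkap.
  by rewrite mulr_ge0 ?sqr_ge0// ltW.
pose rho b := Num.sqrt (2 * b / (3 * m ^+ 2)).
have m20 : 0 < m ^+ 2 by exact: exprn_gt0.
have rho0 b : 0 < b -> 0 < rho b by move=> b0; rewrite sqrtr_gt0; pp.
have rho2 b : 0 < b -> rho b ^+ 2 = 2 * b / (3 * m ^+ 2).
  by move=> b0; rewrite sqr_sqrtr//; apply: ltW; pp.
pose v b x := L^-1 * rho b * approx gauss b kap A 0 (L^-1 * x + 0).
have sv b : sch (v b).
  have sa : sch (approx gauss b kap A 0) by exact: (snice_freeze 0 (snice_approx b sch_gauss kap A)).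
  exact: (@sniceZ _ (L^-1 * rho b) (fun _ => _) (sch_dilate 0 (invr_neq0 Ln0) sa)).
have ex b : exists u : schwartz R, (u : R -> R) = fun x => derive1 (v b) x + v b x ^+ 2.
  apply: sch_schwartz; apply: (@sniceD _ (fun _ => _) (fun _ => _)); first exact: sch_derive1.
  by apply: (@sniceXS _ (fun _ => v b) 1); exact: sv.
have [u1 u1E] := ex b1; have [u2 u2E] := ex b2.
have Kuz : Ku * z <= sig.
  by move: WKu; rewrite ler_pdivrMr// mulrC => h; rewrite /z ler_pdivrMr.
have Kuz0 : 0 <= Ku * z by rewrite mulr_ge0// ltW.
have r2 := ratio_le2 b10 b12 b21; have r1 := ratio_ge1 b10 b12.
have rsq := ratio_sq b10 b12.
set r := Num.sqrt (b2 / b1) in r2 r1 rsq.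
have B0 : 0 <= B by exact: sqrtr_ge0.
have ball (c1 c2 : R) (u : schwartz R) : `|c1| <= 1 -> `|c2| <= 1 -> `|c1 + c2 * r| <= 2 ->
    (u : R -> R) = (fun x => derive1 (fun x => c1 * v b1 x + c2 * v b2 x) x +
      (c1 * v b1 x ^+ 2 + c2 * v b2 x ^+ 2)) -> Hs_ball s (B + 1) (distr u).
  move=> c11 c21 c12 uE; split; first exact: Hs_distr.
  apply: (@le_lt_trans _ _ B%:E); last by rewrite lte_fin ltrDl.
  apply: (upper s N L z B c1 c2 u s1 s0 N0 L0 NsE z0 z1 mz zkm bA c11 c21 B0 uE).
  rewrite B2; apply: ler_wpM2l; first by rewrite mulr_ge0.
  apply: lerD; last exact: le_trans sig1.
  apply: ler_wpM2l; first by rewrite divr_ge0.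
  rewrite lerXn2r ?nnegrE//; [by rewrite addr_ge0// mulr_ge0|by rewrite addr_ge0// mulr_ge0|].
  by apply: lerD; [exact: ler_wpM2r|exact: le_trans sig1].
have ball1 : Hs_ball s (B + 1) (distr u1).
  apply: (ball 1 0); rewrite ?normr1 ?normr0 ?mul0r ?addr0 ?normr1 ?ler1n//.
  rewrite u1E; have -> : (fun x => 1 * v b1 x + 0 * v b2 x) = v b1.
    by apply/funext => x; rewrite mul1r mul0r addr0.
  by apply/funext => x; rewrite mul1r mul0r addr0.
have ball2 : Hs_ball s (B + 1) (distr u2).
  apply: (ball 0 1); rewrite ?normr1 ?normr0 ?mul1r ?add0r//.
    by rewrite ger0_norm// (le_trans _ r1).
  rewrite u2E; have -> : (fun x => 0 * v b1 x + 1 * v b2 x) = v b2.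
    by apply/funext => x; rewrite mul1r mul0r add0r.
  by apply/funext => x; rewrite mul1r mul0r add0r.
have close : (Hs_norm s (distr u1 - distr u2)%R < del%:E)%E.
  rewrite distrB; apply: (@le_lt_trans _ _ (del / 2)%:E).
    2: by rewrite lte_fin ltr_pdivrMr// mulr_natr mulr2n ltrDl.
  have d20 : 0 <= del / 2 by rewrite divr_ge0// ltW.
  apply: (upper s N L z (del / 2) 1 (-1) (u1 - u2) s1 s0 N0 L0 NsE z0 z1 mz zkm bA _ _ d20).
  - by rewrite normr1.
  - by rewrite normrN1.
  - have -> : ((u1 - u2 : schwartz R) : R -> R) = fun x => u1 x - u2 x by [].
    rewrite u1E u2E; apply/funext => x.
    have -> : derive1 (fun x => 1 * v b1 x + -1 * v b2 x) x = derive1 (v b1) x - derive1 (v b2) x.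
      apply: hasD_derive1; apply: hasD_ext (hasDB (sch_hasD x (sv b1)) (sch_hasD x (sv b2))) => t.
      by rewrite mul1r mulN1r.
    change (derive1 (v b1) x + v b1 x ^+ 2 - (derive1 (v b2) x + v b2 x ^+ 2) =
      derive1 (v b1) x - derive1 (v b2) x + (1 * v b1 x ^+ 2 + -1 * v b2 x ^+ 2)).
    by move: (derive1 (v b1) x) (derive1 (v b2) x) (v b1 x) (v b2 x) => p q p' q'; ring.
  rewrite -/r -/Phi.
  have rP : `|1 + -1 * r| * Phi <= sig.
    have r10 : 0 <= r - 1 by rewrite subr_ge0.
    rewrite mulN1r distrC ger0_norm//.
    have h : r - 1 <= y^-1.
      apply: (@le_trans _ _ (r ^+ 2 - 1)).
        by rewrite lerD2r expr2 ler_peMl// (le_trans _ r1).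
      rewrite rsq (_ : b2 / b1 - 1 = y^-1)// /b2 /b1.
      by field; rewrite !gt_eqF.
    apply: (le_trans (ler_wpM2r Phi0 h)).
    rewrite mulrC ler_pdivrMr// /y mulrDr mulr1 mulrCA mulfV ?gt_eqF// mulr1.
    by rewrite lerDr.
  have sum : `|1 + -1 * r| * Phi + Ku * z <= 2 * sig by rewrite mulr_natl mulr2n lerD.
  apply: (@le_trans _ _ (2 * cF * (4 / 3 * (2 * sig) ^+ 2 + sig))).
    apply: ler_wpM2l; first by rewrite mulr_ge0.
    apply: lerD => //; apply: ler_wpM2l; first by rewrite divr_ge0.
    by apply: (lerXn2r 2 _ _ sum); rewrite nnegrE; nn.
  have ss : sig ^+ 2 <= sig by rewrite expr2 ler_piMr.
  apply: (@le_trans _ _ (2 * cF * (7 * sig))).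
    apply: ler_wpM2l; first by rewrite mulr_ge0.
    exact: quarter_bound.
  rewrite exprMn exprVn ler_pdivlMr ?exprn_gt0//; apply: le_trans sigd.
  by rewrite le_eqVlt; apply/orP; left; apply/eqP; ring.
have := H u1 u2 ball1 ball2 close; move=> small.
have small_tau : (Hs_norm s (distr (S u1 tau - S u2 tau)%R) < eps%:E)%E.
  rewrite -distrB; apply: le_lt_trans small; apply: ereal_sup_ubound.
  exists tau => //=; rewrite in_itv/= tauT andbT.
  by apply: lt_trans tau0; rewrite oppr_lt0.
have eta1m : m <= eta1.
  by apply: (le_trans mz); rewrite /z -[leRHS]invrK lef_pV2 ?posrE ?invr_gt0.
have eta2m : m <= eta2.
  by apply: (le_trans mz); rewrite /z -[leRHS]invrK lef_pV2 ?posrE ?invr_gt0.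
have [w1 [sw1 w1E nw1 cw1]] := F1 N L u1 N0 L0 eta1m (le_trans We1 Wk) u1E.
have [w2 [sw2 w2E nw2 cw2]] := F2 N L u2 N0 L0 eta2m (le_trans We2 Wk) u2E.
have tau01 : 0 <= tau <= 1 by rewrite (ltW tau0).
have wC w b : 0 < b -> w <= C1 * rho b \/ w <= C2 * rho b -> w <= C * rho b.
  move=> b0 [] h; apply: (le_trans h); apply: ler_wpM2r => //; exact: ltW (rho0 b b0).
have [c0 [sc0 nc0 nc1 low]] := lower kap m z (rho b1) (rho b2) w1 w2 m0 mz z1 k0 zkm
  (rho0 _ b10) (rho2 _ b10) (rho0 _ b20) (rho2 _ b20) sw1 sw2
  (le_trans (nw1 tau) (ler_wpM2r (ltW (rho0 _ b10)) C1C))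
  (le_trans (nw2 tau) (ler_wpM2r (ltW (rho0 _ b20)) C2C))
  (le_trans (cw1 tau tau01) (ler_wpM2r (ltW m20) C1C))
  (le_trans (cw2 tau tau01) (ler_wpM2r (ltW m20) C2C)).
set U := (fun x => dx w1 tau x + w1 tau x ^+ 2 - (dx w2 tau x + w2 tau x ^+ 2)) in low.
have fU Y : L ^+ 2 * (S u1 tau - S u2 tau : schwartz R) (L * Y + - (3 * N ^+ 2) * tau) = U Y.
  by rewrite /U -w1E -w2E -mulrBr.
have nc0G : nrm c0 <= G by apply: (le_trans nc0); rewrite lerDl.
have nc1G : nrm (derive1 c0) <= N * L * G.
  apply: (le_trans nc1); rewrite -/kap /G mulrDr mulr1 lerD2l.
  by apply: (le_trans WKl).
have rhoE : rho b1 ^+ 2 = 2 * b1 / (3 * (N / L ^+ 2)) by rewrite rho2// m2.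
have := dual_rescaled s1 s0 N1 L0 b10 NsE' sc0 nc0G nc1G (rho0 _ b10) rhoE fU eps0 nu0 small_tau.
have Y0 : 0 < rho b1 * N by rewrite mulr_gt0// rho0.
have half : Kl * z <= cphi / 2.
  move: WKl'; rewrite ler_pdivrMr// => h; rewrite ler_pdivlMr//.
  by rewrite /z mulrAC ler_pdivrMr// (mulrC Kl) (mulrC cphi).
have lowI : rho b1 * N * (cphi / 2) <= L^-1 * `|Int (fun x => U x * c0 x)|.
  apply: (@le_trans _ _ (L^-1 * (rho b1 * (kap * cphi - Kl * (z * kap))))); last first.
    apply: ler_wpM2l; first by rewrite invr_ge0 ltW.
    by apply: (le_trans low); exact: ler_norm.
  rewrite (_ : L^-1 * _ = rho b1 * N * (cphi - Kl * z)); last by rewrite /kap; field.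
  apply: ler_wpM2l; first exact: ltW.
  by rewrite lerBrDl -lerBrDr; apply: (le_trans half); rewrite {2}[cphi]splitr addrK.
move=> /(le_trans (ler_wpM2l cF0' lowI)).
rewrite mulrCA ler_pM2l// eps2.
rewrite (_ : nu * _ + _ = 3 / 8 * (cF * cphi)); last first.
  by rewrite /nu; field; rewrite !gt_eqF.
have cc0 : 0 < cF * cphi :> R by exact: mulr_gt0.
by rewrite mulrA => h; exact: half_gt_three_eighths cc0 h.
Qed.

Lemma exists_ball_not_unif_continuous : exists2 M : R, 0 < M &
  forall T : R, 0 < T -> ~ solution_map_unif_continuous S s M T.
Proof.
exists (B + 1); first by rewrite ltr_wpDl// sqrtr_ge0.
exact: not_solution_map_unif_continuous.
Qed.

End Core.

(** An extension agrees with [S] on Schwartz data, so its uniform continuity would restrict to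
    [S]. *)
Lemma not_locally_well_posed (R : realType) (S : schwartz R -> R -> schwartz R) (s M : R) :
  0 < M -> (forall T, 0 < T -> ~ solution_map_unif_continuous S s M T) ->
  ~ locally_well_posed S s.
Proof.
move=> M0 notUC /(_ _ M0)[T T0 [Phi [_ UC ext] _]].
apply: (notUC T T0) => eps eps0.
have [del del0 H] := UC eps eps0; exists del => // i j ballI ballJ close.
apply: le_lt_trans (H _ _ ballI ballJ close).
apply: ge_ereal_sup => _ [t /= tT <-]; apply: ereal_sup_ubound.
by exists t => //=; rewrite !ext.
Qed.

Theorem theorem7 (R : realType) (S : schwartz R -> R -> schwartz R)
    (hS : solution_map S) (s : R) (hs1 : - 1 <= s) (hs2 : s < - (3 / 4)) :
  ~ locally_well_posed S s /\
  exists2 M : R, 0 < M &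
    forall T : R, 0 < T -> ~ solution_map_unif_continuous S s M T.
Proof.
have [M M0 notUC] := exists_ball_not_unif_continuous hS hs1 hs2.
by split; [exact: not_locally_well_posed M0 notUC|exists M].
Qed.
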